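(* Let $C$ be a cusp in $(\mathbb C^2,\mathbf 0)$. Then $$(\mathfrak s_{D_C}(C),\widetilde{\mathfrak s}_{D_C}(C))=(t_{s+1},\tilde t_{s+1}),$$ where $t_{s+1}$ and $\tilde t_{s+1}$ are the last critical values of the semimodule of differential values of the curve $C$.
   Context: Cusps. An irreducible plane curve germ $C$ in $(\mathbb C^2,\mathbf 0)$ with a single Puiseux pair $(n,m)$ ($2\le n<m$ coprime) is called a cusp; there are coordinates $(x,y)$, called adapted coordinates, in which $C$ has a primitive parametrization $\phi(t)=(t^n,b(t))$ with $\operatorname{ord}_t b(t)=m$. For a germ of holomorphic $1$-form $\omega\in\Omega^1_{\mathbb C^2,\mathbf 0}$ with $\phi^*\omega=\alpha(t)dt$ put $\nu_C(\omega)=\operatorname{ord}_t(\alpha)+1$ ($=\infty$ if $\phi^*\omega=0$). The curve $C$ is invariant for $\omega$ if $\nu_C(\omega)=\infty$. The set of such forms is denoted $\Omega^1_{\mathbb C^2,\mathbf 0}[C]$; it is a free $\mathcal O_{\mathbb C^2,\mathbf 0}$-module of rank two, and a basis of it is called a Saito basis for $C$. The semigroup of $C$ is $\Gamma=n\mathbb Z_{\ge0}+m\mathbb Z_{\ge0}$, and the semimodule of differential values is $\Lambda=\{\nu_C(\omega):\omega\in\Omega^1_{\mathbb C^2,\mathbf 0}\}\setminus\{\infty\}$, which satisfies $\Lambda+\Gamma\subset\Lambda$. Divisorial order. $D_C$ is the unique irreducible component of the exceptional divisor of the minimal reduction of singularities of $C$ that meets the strict transform of $C$. In adapted coordinates $(x,y)$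 the divisorial order with respect to $D_C$ is the monomial order: for $h=\sum h_{ij}x^iy^j$, $\nu_{D_C}(h)=\min\{ni+mj: h_{ij}\ne0\}$, and for $\omega=a\,dx+b\,dy$, $\nu_{D_C}(\omega)=\min\{\nu_{D_C}(xa),\nu_{D_C}(yb)\}$. It does not depend on the choice of adapted coordinates. Saito multiplicities. $\mathfrak s_{D_C}(C)=\min\{\nu_{D_C}(\omega):\omega\text{ belongs to a Saito basis of }C\}$ and $\widetilde{\mathfrak s}_{D_C}(C)=\max\{\nu_{D_C}(\omega):\omega\text{ belongs to a Saito basis of }C\}$. Basis and critical values. The basis of $\Lambda$ is the unique strictly increasing sequence $(\lambda_{-1},\lambda_0,\ldots,\lambda_s)$ with $\Lambda=\bigcup_{i=-1}^s(\lambda_i+\Gamma)$ and $\lambda_j\notin\Lambda_{j-1}$ for $0\le j\le s$, where $\Lambda_i=\bigcup_{k=-1}^i(\lambda_k+\Gamma)$; one has $\lambda_{-1}=n$, $\lambda_0=m$. For $1\le i\le s+1$ let $\ell_i^n$ (resp. $\ell_i^m$) be the least integer $\ell\ge1$ with $\lambda_{i-1}+n\ell\in\Lambda_{i-2}$ (resp. $\lambda_{i-1}+m\ell\in\Lambda_{i-2}$). The critical values are defined by $t_{-1}=\lambda_{-1}$, $t_0=\lambda_0$ and, for $1\le i\le s+1$, $t_i^n=t_{i-1}+n\ell_i^n$, $t_i^m=t_{i-1}+m\ell_i^m$, $t_i=\min\{t_i^n,t_i^m\}$, $\tilde t_i=\max\{t_i^n,t_i^m\}$. *)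

(* Defs.v *)
From HB Require Import structures.
From mathcomp Require Import all_boot all_order all_algebra.
From mathcomp Require Import boolp classical_sets reals complex.

Set Implicit Arguments.
Unset Strict Implicit.
Unset Printing Implicit Defensive.

Import Order.TTheory GRing.Theory Num.Theory.
Local Open Scope ring_scope.

(* Formal power series.  [f k] is the coefficient of t^k in [f : fps A]; a     *)
(* series in two variables is [h : fps (fps A)], and [h i j] is the            *)
(* coefficient of x^i y^j.                                                     *)

Definition fps (A : Type) := nat -> A.

HB.instance Definition _ (A : Type) := gen_eqMixin (fps A).
HB.instance Definition _ (A : Type) := gen_choiceMixin (fps A).

Section FpsZmodule.
Variable A : zmodType.
Implicit Types f g h : fps A.

Definition fps_zero : fps A := fun _ => 0.
Definition fps_opp f : fps A := fun k => - f k.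
Definition fps_add f g : fps A := fun k => f k + g k.

Lemma fps_addA : associative fps_add.
Proof. by move=> f g h; apply: funext => k; exact: addrA. Qed.
Lemma fps_addC : commutative fps_add.
Proof. by move=> f g; apply: funext => k; exact: addrC. Qed.
Lemma fps_add0 : left_id fps_zero fps_add.
Proof. by move=> f; apply: funext => k; exact: add0r. Qed.
Lemma fps_addN : left_inverse fps_zero fps_opp fps_add.
Proof. by move=> f; apply: funext => k; exact: addNr. Qed.

HB.instance Definition _ :=
  GRing.isZmodule.Build (fps A) fps_addA fps_addC fps_add0 fps_addN.

End FpsZmodule.

Section FpsRing.
Variable A : comNzRingType.
Implicit Types f g h : fps A.

Definition fps_one : fps A := fun k => (k == 0%N)%:R.
Definition fps_mul f g : fps A := fun k => \sum_(i < k.+1) f i * g (k - i)%N.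

Definition fps_trunc (N : nat) f : {poly A} := \poly_(i < N) f i.

Lemma fps_mul_trunc N f g k : (k < N)%N ->
  fps_mul f g k = (fps_trunc N f * fps_trunc N g)`_k.
Proof.
move=> kN; rewrite coefM; apply: eq_bigr => i _; rewrite !coef_poly.
have iN : (i < N)%N by apply: leq_trans kN; rewrite ltnS -ltnS ltn_ord.
by rewrite iN (leq_ltn_trans (leq_subr _ _) kN).
Qed.

Lemma fps_mulC : commutative fps_mul.
Proof.
by move=> f g; apply: funext => k; rewrite !(fps_mul_trunc _ _ (ltnSn k)) mulrC.
Qed.

Lemma fps_mulA : associative fps_mul.
Proof.
move=> f g h; apply: funext => k.
transitivity ((fps_trunc k.+1 f * fps_trunc k.+1 g * fps_trunc k.+1 h)`_k).
  rewrite -mulrA coefM; apply: eq_bigr => i _.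
  rewrite coef_poly ltn_ord; congr (_ * _).
  by apply: fps_mul_trunc; rewrite ltnS leq_subr.
rewrite coefM; apply: eq_bigr => i _.
rewrite -(fps_mul_trunc f g (ltn_ord i)) coef_poly.
by rewrite ltnS leq_subr.
Qed.

Lemma fps_mul1 : left_id fps_one fps_mul.
Proof.
move=> f; apply: funext => k; rewrite /fps_mul big_ord_recl /fps_one eqxx mul1r.
by rewrite subn0 big1 ?addr0 // => i _; rewrite mul0r.
Qed.

Lemma fps_mulDl : left_distributive fps_mul +%R.
Proof.
move=> f g h; apply: funext => k; rewrite /fps_mul -[RHS]big_split.
by apply: eq_bigr => i _; exact: mulrDl.
Qed.

Lemma fps_oner_neq0 : fps_one != 0.
Proof.
by apply/eqP => /(congr1 (fun f : fps A => f 0%N)) /eqP; rewrite /fps_one oner_eq0.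
Qed.

HB.instance Definition _ := GRing.Zmodule_isComNzRing.Build (fps A)
  fps_mulA fps_mulC fps_mul1 fps_mulDl fps_oner_neq0.

End FpsRing.

Section Substitution.
Variable A : comNzRingType.
Implicit Types f g : fps A.

Definition fpsX : fps A := fun k => (k == 1%N)%:R.

Definition fps_deriv f : fps A := fun k => f k.+1 *+ k.+1.

(* Substitutions.  They are meant for substituted series without constant      *)
(* term, and then the sums contain every term contributing to the coefficient. *)

Definition comp1 f (tau : fps A) : fps A := fun k =>
  \sum_(a < k.+1) f a * (tau ^+ a) k.

Definition comp21 (h : fps (fps A)) (x y : fps A) : fps A := fun k =>
  \sum_(a < k.+1) \sum_(b < k.+1) h a b * (x ^+ a * y ^+ b) k.

Definition comp2 (h u v : fps (fps A)) : fps (fps A) := fun i j =>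
  \sum_(a < (i + j)%N.+1) \sum_(b < (i + j)%N.+1) h a b * (u ^+ a * v ^+ b) i j.

Definition varx : fps (fps A) := fun i j => ((i == 1%N) && (j == 0%N))%:R.
Definition vary : fps (fps A) := fun i j => ((i == 0%N) && (j == 1%N))%:R.

Definition derivx (h : fps (fps A)) : fps (fps A) := fun i j => h i.+1 j *+ i.+1.
Definition derivy (h : fps (fps A)) : fps (fps A) := fun i j => h i j.+1 *+ j.+1.

End Substitution.

(* Minimum and maximum of a set of natural numbers; [None] means that there is *)
(* none.  As a minimum, [None] is the value +oo of the orders below.           *)

Definition nat_min (A : set nat) : option nat :=
  xget None [set o | exists2 k, o = Some k & A k /\ forall j, A j -> (k <= j)%N].

Definition nat_max (A : set nat) : option nat :=
  xget None [set o | exists2 k, o = Some k & A k /\ forall j, A j -> (j <= k)%N].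

Section Germs.
Variable R : realType.
Local Notation C := R[i].
Local Notation ser1 := (fps C).
Local Notation ser2 := (fps (fps C)).

(* Germs of holomorphic functions at the origin of C and of C^2 are identified *)
(* with their (convergent) Taylor series.                                      *)

Definition holo1 (f : ser1) := exists r M : C,
  0 < r /\ forall k, `|f k| * r ^+ k <= M.

Definition holo2 (h : ser2) := exists r M : C,
  0 < r /\ forall i j, `|h i j| * r ^+ (i + j)%N <= M.

Definition holo_unit (h : ser2) := exists2 h', holo2 h' & h * h' = 1.

(* An irreducible plane curve germ is given by an irreducible equation.        *)
Definition irreducible_germ (f : ser2) :=
  [/\ holo2 f, f != 0, ~ holo_unit f &
      forall g h, holo2 g -> holo2 h -> f = g * h -> holo_unit g \/ holo_unit h].

(* Systems of coordinates of (C^2,0): germs of biholomorphisms.                *)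
Record coords := Coords {
  cu : ser2; cv : ser2;   (* the new coordinates as functions of the old ones *)
  cp : ser2; cq : ser2;   (* the old coordinates as functions of the new ones *)
  coords_holo : [/\ holo2 cu, holo2 cv, holo2 cp & holo2 cq];
  coords_origin : [/\ cu 0%N 0%N = 0, cv 0%N 0%N = 0, cp 0%N 0%N = 0 &
                     cq 0%N 0%N = 0];
  coords_inv : comp2 cu cp cq = varx C /\ comp2 cv cp cq = vary C;
  coords_inv' : comp2 cp cu cv = varx C /\ comp2 cq cu cv = vary C }.

Definition param := (ser1 * ser1)%type.

Definition holo_param (g : param) :=
  [/\ holo1 g.1, holo1 g.2, g.1 0%N = 0 & g.2 0%N = 0].

(* A primitive parametrization does not factor through a map t |-> tau(t) of   *)
(* order at least two.                                                         *)
Definition primitive (g : param) := forall (d : param) (tau : ser1),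
  holo_param d -> holo1 tau -> tau 0%N = 0 ->
  g.1 = comp1 d.1 tau -> g.2 = comp1 d.2 tau -> tau 1%N != 0.

Definition parametrizes (f : ser2) (g : param) :=
  [/\ holo_param g, primitive g & comp21 f g.1 g.2 = 0].

(* Order of a univariate series; [None] stands for +oo.                        *)
Definition ord1 (a : ser1) : option nat := nat_min [set k | a k != 0].

(* [f = 0] has the single Puiseux pair (n,m): in suitable coordinates it has a *)
(* parametrization (t^n, b(t)) where m is the least exponent of b that is not  *)
(* a multiple of n, and is prime to n.                                         *)
Definition cusp (f : ser2) (n m : nat) :=
  [/\ irreducible_germ f, (2 <= n < m)%N, coprime n m &
      exists (Phi : coords) (g : param),
        [/\ parametrizes f g, comp21 (cu Phi) g.1 g.2 = fpsX C ^+ n &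
            nat_min [set k | comp21 (cv Phi) g.1 g.2 k != 0 /\ ~~ (n %| k)%N]
            = Some m]].

(* [Phi] is a system of adapted coordinates of [f = 0], witnessed by the       *)
(* parametrization [g], which is t |-> (t^n, b(t)) in the coordinates [Phi].   *)
Definition adapted (f : ser2) (n m : nat) (Phi : coords) (g : param) :=
  [/\ parametrizes f g, comp21 (cu Phi) g.1 g.2 = fpsX C ^+ n &
      ord1 (comp21 (cv Phi) g.1 g.2) = Some m].

(* The 1-form a dx + b dy is the pair (a, b).                                  *)
Definition form1 := (ser2 * ser2)%type.

Definition holo_form (w : form1) := holo2 w.1 /\ holo2 w.2.

Definition form_scale (h : ser2) (w : form1) : form1 := (h * w.1, h * w.2).

(* The series alpha such that g^* w = alpha(t) dt.                             *)
Definition pull_param (g : param) (w : form1) : ser1 :=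
  comp21 w.1 g.1 g.2 * fps_deriv g.1 + comp21 w.2 g.1 g.2 * fps_deriv g.2.

Definition nu_C (g : param) (w : form1) : option nat :=
  omap succn (ord1 (pull_param g w)).

Definition Omega_C (g : param) : set form1 :=
  [set w | holo_form w /\ nu_C g w = None].

Definition saito_basis (g : param) (w1 w2 : form1) :=
  [/\ Omega_C g w1, Omega_C g w2,
      (forall w, Omega_C g w -> exists h1 h2,
         [/\ holo2 h1, holo2 h2 & w = form_scale h1 w1 + form_scale h2 w2]) &
      (forall h1 h2, holo2 h1 -> holo2 h2 ->
         form_scale h1 w1 + form_scale h2 w2 = 0 -> h1 = 0 /\ h2 = 0)].

(* The expression of a form in the coordinates [Phi], that is, its pull-back   *)
(* by the inverse of [Phi].                                                    *)
Definition form_in (Phi : coords) (w : form1) : form1 :=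
  let a := comp2 w.1 (cp Phi) (cq Phi) in
  let b := comp2 w.2 (cp Phi) (cq Phi) in
  (a * derivx (cp Phi) + b * derivx (cq Phi),
   a * derivy (cp Phi) + b * derivy (cq Phi)).

Definition monomial_ord (n m : nat) (h : ser2) : option nat :=
  nat_min [set k | exists i j, h i j != 0 /\ k = (n * i + m * j)%N].

(* Divisorial order of a form, computed in the adapted coordinates [Phi]; the  *)
(* outer [nat_min] is the minimum of two orders.                               *)
Definition nu_D (n m : nat) (Phi : coords) (w : form1) : option nat :=
  let w' := form_in Phi w in
  nat_min [set k | monomial_ord n m (varx C * w'.1) = Some k \/
                   monomial_ord n m (vary C * w'.2) = Some k].

Definition saito_orders (n m : nat) (Phi : coords) (g : param) : set nat :=
  [set k | exists w1 w2, saito_basis g w1 w2 /\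
           (nu_D n m Phi w1 = Some k \/ nu_D n m Phi w2 = Some k)].

Definition saito_mult n m Phi g := nat_min (saito_orders n m Phi g).
Definition saito_mult_tilde n m Phi g := nat_max (saito_orders n m Phi g).

Definition differential_values (g : param) : set nat :=
  [set k | exists2 w, holo_form w & nu_C g w = Some k].

End Germs.

Section Semimodule.
Local Open Scope nat_scope.
Variables n m : nat.

Definition semigroup : set nat := [set k | exists a b, k = n * a + m * b].

(* The basis (lambda_{-1}, ..., lambda_s) is a sequence of length s+2, with     *)
(* entries numbered from 0, so that lambda_i is [nth 0 lam i.+1].  [lam_union  *)
(* lam p] is the union of the first p sets lambda_k + Gamma; thus Lambda_i is  *)
(* [lam_union lam i.+2].                                                       *)
Definition lam_union (lam : seq nat) (p : nat) : set nat :=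
  [set k | exists q c, [/\ q < p, semigroup c & k = nth 0 lam q + c]].

Definition semimodule_basis (L : set nat) (s : nat) (lam : seq nat) :=
  [/\ size lam = s.+2, sorted ltn lam, L = lam_union lam s.+2 &
      forall j, j <= s -> ~ lam_union lam j.+1 (nth 0 lam j.+1)].

(* [ell lam d i] is ell_i^d, for d = n or m and 1 <= i <= s+1: the least       *)
(* l >= 1 such that lambda_{i-1} + d l belongs to Lambda_{i-2}.                *)
Definition ell (lam : seq nat) (d i : nat) : nat :=
  odflt 0 (nat_min [set l | 1 <= l /\ lam_union lam i (nth 0 lam i + d * l)]).

(* [tcrit lam i] is the critical value t_i for 0 <= i <= s+1, and              *)
(* [tcrit_tilde lam i] is the value written t_i with a tilde.                  *)
Fixpoint tcrit (lam : seq nat) (i : nat) : nat :=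
  if i is i'.+1 then
    minn (tcrit lam i' + n * ell lam n i) (tcrit lam i' + m * ell lam m i)
  else nth 0 lam 1.

Definition tcrit_tilde (lam : seq nat) (i : nat) : nat :=
  maxn (tcrit lam i.-1 + n * ell lam n i) (tcrit lam i.-1 + m * ell lam m i).

End Semimodule.

(* Main.v *)
Require Import Defs.
From mathcomp Require Import all_boot all_order all_algebra.
From mathcomp Require Import boolp classical_sets reals complex.
From mathcomp Require Import ring zify.

(** Why the theorem holds.

    In adapted coordinates the curve is [t |-> (t ^ n, b t)] with [b] of order [m],
    the weight of a form is at most its value, and below weight [n m] a form
    whose value exceeds its weight has initial part [c x ^ i y ^ j eta], where
    [eta = m y dx - n x dy] ([init_form]).  Transport of Saito bases, values and
    orders to these coordinates is the chain rule ([pull_push], [saito_push]);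
    identities between substitutions are checked on monomials, by density of the
    polynomials ([dense_eq0]).

    The core is an induction on the generators of the semimodule, whose invariant
    is the record [stage].  Write [L] for the values generated so far and [t] for
    the weight of the current form.  Two ideas carry it.
    First, the difference between value and weight increases from one generator to
    the next, so that reducing a multiple of the last form by the previous ones only
    adds terms of higher weight ([stage_reduce]).  Second, a form [u] with value
    outside [L] cannot have too large a weight: removing multiples of the last form
    raises the weight and preserves the value ([stage_excess]).  Hence the initial
    part of [u] is divisible by that of the current form, and divisibility by
    [x ^ p] or [y ^ q] at the next stage follows by subtracting a multiple of the
    current form: the difference would otherwise have a value outside [L] too close
    to its weight ([stage_step]).

    The exponents [p] and [q] come from arithmetic alone.  The complement of [L]
    has, above the lower of the two current bounds, the shape of a quadrant with
    one corner; a new generator in this quadrant cuts it into two smaller ones, the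
    corners of which are the two axes of the next critical values ([corner_add]).  In
    particular every number beyond the upper axis is in [L], so that the form
    starting with the larger critical value reduces to an invariant form.  Exact
    invariance, by a convergent form, is possible because every convergent series
    in [t] of large order is the restriction of a convergent function with the same
    order ([comp_surjective]).

    After the last generator this gives invariant forms [w] and [w'] of weights
    [t] and [T], the last two critical values, such that the initial part of [w']
    is not a multiple of that of [w], and such that invariant forms of weight
    below [T] have initial parts divisible by that of [w].  Saito bases exist
    ([saito_basis_exists]): invariant forms restrict to [x = 0] as a submodule of a
    free module of rank two over a discrete valuation ring, a basis of this
    restriction lifts to a formal basis, and Cramer's rule together with the
    convergence of formal quotients ([holo2_quotient]) makes the coordinates
    converge.  A combination of [w] and [w'] lying in the maximal ideal times the
    module of invariant forms would contradict the properties of the initial parts;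
    so [w] and [w'] form a basis ([saito_ww']), and the same comparison of initial
    parts bounds the weight of any member of any basis by [t] and [T]
    ([saito_wt_bounds]). *)

Set Implicit Arguments.
Unset Strict Implicit.
Unset Printing Implicit Defensive.

Import Order.TTheory GRing.Theory Num.Theory.
Local Open Scope ring_scope.

(** * Formal power series *)

Section Coefficients.
Variable A : comNzRingType.
Implicit Types (f g h : fps A) (a b c : A) (i j k : nat).

Lemma fps0E k : (0 : fps A) k = 0. Proof. by []. Qed.
Lemma fpsDE f g k : (f + g) k = f k + g k. Proof. by []. Qed.
Lemma fpsNE f k : (- f) k = - f k. Proof. by []. Qed.
Lemma fpsBE f g k : (f - g) k = f k - g k. Proof. by []. Qed.
Lemma fps1E k : (1 : fps A) k = (k == 0%N)%:R. Proof. by []. Qed.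
Lemma fpsME f g k : (f * g) k = \sum_(i < k.+1) f i * g (k - i)%N.
Proof. by []. Qed.

Lemma fps_sumE (I : Type) (r : seq I) (P : pred I) (F : I -> fps A) k :
  (\sum_(i <- r | P i) F i) k = \sum_(i <- r | P i) F i k.
Proof. by elim/big_rec2: _ => // i x y _ <-. Qed.

Definition single i a : fps A := fun k => if k == i then a else 0.

Lemma singleME i a f k :
  (single i a * f) k = if (i <= k)%N then a * f (k - i)%N else 0.
Proof.
rewrite fpsME; case: leqP => ik.
  have iP : (i < k.+1)%N by [].
  rewrite (bigD1 (Ordinal iP)) //= {1}/single eqxx big1 ?addr0 // => j ji.
  by rewrite /single (_ : _ == i = false) ?mul0r //; apply/negbTE.
apply: big1 => j _; rewrite /single (_ : _ == i = false) ?mul0r //.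
by apply/negbTE; rewrite neq_ltn (leq_trans (ltn_ord j) ik).
Qed.

Lemma singleM i j a b : single i a * single j b = single (i + j) (a * b).
Proof.
apply: funext => k; rewrite singleME /single.
case: leqP => ik; last first.
  by rewrite (_ : k == _ = false) //; apply/negbTE; lia.
have -> : (k - i == j)%N = (k == i + j)%N by lia.
by case: ifP => _ //; rewrite mulr0.
Qed.

Lemma single0_1 : single 0 1 = 1 :> fps A.
Proof. by apply: funext => k; rewrite fps1E /single; case: (k == 0%N). Qed.

Lemma singleD i a b : single i (a + b) = single i a + single i b.
Proof. by apply: funext => k; rewrite fpsDE /single; case: ifP; rewrite ?addr0. Qed.

Lemma single_exp i a k : single i a ^+ k = single (i * k) (a ^+ k).
Proof.
elim: k => [|k IH]; first by rewrite muln0 !expr0 single0_1.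
by rewrite !exprS IH singleM mulnS.
Qed.

Lemma fpsX_single : fpsX A = single 1 1.
Proof. by apply: funext => k; rewrite /fpsX /single; case: (k == 1%N). Qed.

Lemma fpsXn k : fpsX A ^+ k = single k 1.
Proof. by rewrite fpsX_single single_exp expr1n mul1n. Qed.

(** The [t]-adic filtration; its separatedness turns congruences modulo all
    powers into equalities. *)
Definition fps_ge (N : nat) f := forall k, (k < N)%N -> f k = 0.

Lemma fps_geM N M f g : fps_ge N f -> fps_ge M g -> fps_ge (N + M) (f * g).
Proof.
move=> fN gM k kNM; rewrite fpsME big1 // => i _.
case: (ltnP i N) => iN; first by rewrite fN ?mul0r.
rewrite gM ?mulr0 //; have := ltn_ord i; lia.
Qed.

Lemma fps_geX f k : fps_ge 1 f -> fps_ge k (f ^+ k).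
Proof.
move=> f1; elim: k => [|k IH]; first by move=> ?; rewrite ltn0.
by rewrite exprS -add1n; apply: fps_geM.
Qed.

Lemma fps_ge_lead N M f g : fps_ge N f -> fps_ge M g ->
  (f * g) (N + M)%N = f N * g M.
Proof.
move=> fN gM; rewrite fpsME.
have NP : (N < (N + M).+1)%N by lia.
rewrite (bigD1 (Ordinal NP)) //= addKn big1 ?addr0 // => i iN.
case: (ltnP i N) => iltN; first by rewrite fN ?mul0r.
rewrite gM ?mulr0 //; have := ltn_ord i.
have : (i : nat) != N by []. lia.
Qed.

Lemma fps_geW N M f : (N <= M)%N -> fps_ge M f -> fps_ge N f.
Proof. by move=> NM fM k kN; apply: fM; lia. Qed.

Lemma fps_geD N f g : fps_ge N f -> fps_ge N g -> fps_ge N (f + g).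
Proof. by move=> fN gN k kN; rewrite fpsDE fN ?gN ?addr0. Qed.

Lemma fps_geN N f : fps_ge N f -> fps_ge N (- f).
Proof. by move=> fN k kN; rewrite fpsNE fN ?oppr0. Qed.

Lemma fps_ge_sep f : (forall N, fps_ge N f) -> f = 0.
Proof. by move=> fN; apply: funext => k; rewrite (fN k.+1). Qed.

Lemma fps_ord f : f != 0 -> exists2 k, fps_ge k f & f k != 0.
Proof.
move=> f0; have [k fk] : exists k, f k != 0.
  apply: contrapT => nf; move/eqP: f0; apply; apply: funext => k.
  by apply/eqP; apply: contrapT => /negP fk; apply: nf; exists k.
exists (ex_minn (ex_intro (fun k => f k != 0) k fk)).
  move=> j; case: ex_minnP => i _ imin ji; apply/eqP; apply: contraTT ji => fj.
  by rewrite -leqNgt imin.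
by case: ex_minnP.
Qed.

Lemma fps_mul_eq0 f g :
  (forall a b, a * b = 0 -> a = 0 \/ b = 0) -> f * g = 0 -> f = 0 \/ g = 0.
Proof.
move=> idom fg0; case: (eqVneq f 0) => [->|f0]; first by left.
case: (eqVneq g 0) => [->|g0]; first by right.
have [i fi fi0] := fps_ord f0; have [j gj gj0] := fps_ord g0.
have := fps_ge_lead fi gj; rewrite fg0 fps0E => /esym/idom.
by case=> /eqP; rewrite ?(negbTE fi0) ?(negbTE gj0).
Qed.

(** A series is invertible as soon as its constant coefficient is: normalize
    it to [1 - z] with [z] of positive order and sum the geometric series. *)
Lemma fps_inv f c : f 0%N * c = 1 -> exists g, f * g = 1.
Proof.
move=> fc; pose z : fps A := 1 - single 0 c * f.
have z1 : fps_ge 1 z.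
  move=> k; rewrite ltnS leqn0 => /eqP ->.
  by rewrite /z fpsBE fps1E singleME /= subn0 mulrC fc subrr.
pose s N : fps A := \sum_(a < N) z ^+ a.
have sE N k : (k < N)%N -> s N k = s k.+1 k.
  move=> kN; rewrite /s !fps_sumE -(subnKC kN) big_split_ord /=.
  rewrite [X in _ + X]big1 ?addr0 // => a _.
  by apply: (fps_geX z1); rewrite addSn ltnS leq_addr.
pose G : fps A := fun k => s k.+1 k.
have zG : (1 - z) * G = 1.
  apply: funext => k; transitivity (((1 - z) * s k.+1) k).
    rewrite !fpsME; apply: eq_bigr => i _; congr (_ * _); rewrite /G [RHS]sE //.
    by lia.
  have -> : (1 - z) * s k.+1 = 1 - z ^+ k.+1.
    by rewrite -[1 - z]opprB mulNr -subrX1 opprB.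
  by rewrite fpsBE (fps_geX z1) ?subr0.
exists (single 0 c * G); rewrite mulrA -[X in X * G]/(f * single 0 c).
by rewrite [f * _]mulrC; move: zG; rewrite /z opprB addrC subrK.
Qed.

Lemma fps_derivD f g : fps_deriv (f + g) = fps_deriv f + fps_deriv g.
Proof. by apply: funext => k; rewrite /fps_deriv !fpsDE mulrnDl. Qed.

Lemma fps_deriv_single i a :
  fps_deriv (single i a) = single i.-1 (a *+ i).
Proof.
apply: funext => k; rewrite /fps_deriv /single.
case: i => [|i]; first by rewrite mulr0n if_same mul0rn.
by rewrite eqSS; case: eqP => [->|_]; rewrite ?mul0rn.
Qed.

End Coefficients.

(** * Substitution of series *)

Section Derivation.
Variable A : comNzRingType.
Implicit Types f g : fps A.

Lemma fps_derivN f : fps_deriv (- f) = - fps_deriv f.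
Proof. by apply: funext => k; rewrite /fps_deriv fpsNE mulNrn. Qed.

Lemma fps_derivB f g : fps_deriv (f - g) = fps_deriv f - fps_deriv g.
Proof. by rewrite fps_derivD fps_derivN. Qed.

Lemma fps_derivM f g :
  fps_deriv (f * g) = fps_deriv f * g + f * fps_deriv g.
Proof.
apply: funext => k; rewrite fpsDE [LHS]/fps_deriv fpsME -sumrMnl.
transitivity (\sum_(i < k.+2) (f i *+ i * g (k.+1 - i)%N
                             + f i * (g (k.+1 - i)%N *+ (k.+1 - i)))).
  apply: eq_bigr => i _; rewrite mulrnAl mulrnAr -mulrnDr subnKC //.
  by rewrite -ltnS.
rewrite big_split /=; congr (_ + _).
  by rewrite big_ord_recl /= mulr0n mul0r add0r; apply: eq_bigr.
rewrite big_ord_recr /= subnn mulr0n mulr0 addr0; apply: eq_bigr => i _.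
by rewrite /fps_deriv subSn // -ltnS.
Qed.

End Derivation.

Section TwoVariables.
Variable A : comNzRingType.
Implicit Types (h k u v : fps (fps A)) (c : A) (a b i j N M : nat).

Definition mono c a b : fps (fps A) := single a (single b c).

Lemma monoE c a b i j : mono c a b i j = if (i == a) && (j == b) then c else 0.
Proof. by rewrite /mono /single; case: (i == a). Qed.

Lemma mono_mulE c a b h i j : (mono c a b * h) i j =
  if (a <= i)%N && (b <= j)%N then c * h (i - a)%N (j - b)%N else 0.
Proof. by rewrite /mono singleME; case: (a <= i)%N => //=; rewrite singleME. Qed.

Lemma monoM c a b c' a' b' :
  mono c a b * mono c' a' b' = mono (c * c') (a + a') (b + b').
Proof. by rewrite /mono !singleM. Qed.

Lemma mono_exp c a b i : mono c a b ^+ i = mono (c ^+ i) (a * i) (b * i).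
Proof. by rewrite /mono !single_exp. Qed.

Lemma monoD c c' a b : mono (c + c') a b = mono c a b + mono c' a b.
Proof. by rewrite /mono !singleD. Qed.

Lemma mono1 : mono 1 0 0 = 1.
Proof. by rewrite /mono !single0_1. Qed.

Lemma varx_mono : varx A = mono 1 1 0.
Proof.
by apply: funext => i; apply: funext => j; rewrite monoE /varx; case: andb.
Qed.

Lemma vary_mono : vary A = mono 1 0 1.
Proof.
by apply: funext => i; apply: funext => j; rewrite monoE /vary; case: andb.
Qed.

Definition fps2_ge N h := forall i j, (i + j < N)%N -> h i j = 0.

Lemma fps2_geB N h k : fps2_ge N h -> fps2_ge N k -> fps2_ge N (h - k).
Proof. by move=> hN kN i j ij; rewrite !fpsBE hN // kN // subr0. Qed.

Lemma fps2_geM N M h k : fps2_ge N h -> fps2_ge M k -> fps2_ge (N + M) (h * k).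
Proof.
move=> hN kM i j ij; rewrite fpsME fps_sumE big1 // => a _.
rewrite fpsME big1 // => b _.
case: (ltnP (a + b) N) => ab; first by rewrite hN ?mul0r.
rewrite kM ?mulr0 //; have := ltn_ord a; have := ltn_ord b; lia.
Qed.

Lemma fps2_ge_sep h : (forall N, fps2_ge N h) -> h = 0.
Proof.
by move=> hN; apply: funext => i; apply: funext => j; rewrite (hN (i + j).+1).
Qed.

Definition trunc2 N h := \sum_(a < N) \sum_(b < N) mono (h a b) a b.

Lemma trunc2P N h : fps2_ge N (h - trunc2 N h).
Proof.
move=> i j ij; rewrite fpsBE fpsBE /trunc2 !fps_sumE.
have iN : (i < N)%N by lia. have jN : (j < N)%N by lia.
rewrite (bigD1 (Ordinal iN)) //= !fps_sumE (bigD1 (Ordinal jN)) //=.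
rewrite monoE !eqxx /= big1 ?addr0 => [|b bj]; last first.
  by rewrite monoE eqxx /= (_ : (j == b) = false) // eq_sym; apply/negbTE.
rewrite big1 ?addr0 ?subrr // => a ai; rewrite !fps_sumE big1 // => b _.
by rewrite monoE (_ : (i == a) = false) // eq_sym; apply/negbTE.
Qed.

Lemma fps_deriv_mono c a b : fps_deriv (mono c a b) = mono (c *+ a) a.-1 b.
Proof.
rewrite /mono fps_deriv_single; congr (single _ _).
apply: funext => j; rewrite /single.
elim: a => [|a IH]; first by rewrite !mulr0n if_same.
by rewrite !mulrSr fpsDE IH; case: ifP; rewrite ?addr0.
Qed.

Lemma derivxE h : derivx h = fps_deriv h.
Proof.
apply: funext => i; apply: funext => j; rewrite /derivx /fps_deriv.
elim: {2 4}(i.+1) => [|n IH]; first by rewrite !mulr0n.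
by rewrite !mulrSr fpsDE IH.
Qed.

Lemma derivxM h k : derivx (h * k) = derivx h * k + h * derivx k.
Proof. by rewrite !derivxE fps_derivM. Qed.

Lemma derivxB h k : derivx (h - k) = derivx h - derivx k.
Proof. by rewrite !derivxE fps_derivB. Qed.

Lemma derivx_mono c a b : derivx (mono c a b) = mono (c *+ a) a.-1 b.
Proof. by rewrite derivxE fps_deriv_mono. Qed.

Lemma derivyE h i : derivy h i = fps_deriv (h i).
Proof. by []. Qed.

Lemma derivyB h k : derivy (h - k) = derivy h - derivy k.
Proof. by apply: funext => i; rewrite fpsBE !derivyE fpsBE fps_derivB. Qed.

Lemma derivyM h k : derivy (h * k) = derivy h * k + h * derivy k.
Proof.
apply: funext => i; rewrite fpsDE derivyE !fpsME -big_split /=.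
rewrite (big_morph (@fps_deriv A) (@fps_derivD A) (_ : fps_deriv 0 = 0)).
  by apply: eq_bigr => a _; rewrite fps_derivM.
by apply: funext => j; rewrite /fps_deriv !fps0E mul0rn.
Qed.

Lemma derivy_mono c a b : derivy (mono c a b) = mono (c *+ b) a b.-1.
Proof.
apply: funext => i; rewrite derivyE /mono {1}/single [RHS]/single.
case: eqP => _; first by rewrite fps_deriv_single.
by apply: funext => j; rewrite /fps_deriv !fps0E mul0rn.
Qed.

Lemma derivx_ge N h : fps2_ge N.+1 h -> fps2_ge N (derivx h).
Proof. by move=> hN i j ij; rewrite /derivx hN ?mul0rn // addSn. Qed.

Lemma derivy_ge N h : fps2_ge N.+1 h -> fps2_ge N (derivy h).
Proof. by move=> hN i j ij; rewrite /derivy hN ?mul0rn // addnS. Qed.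

End TwoVariables.

(** A ring whose elements are determined by their residues in a filtration; it
    stands for the series in one and in two variables alike. *)
Record filtration (S : comNzRingType) (ge : nat -> S -> Prop) := Filtration {
  filtB : forall N s t, ge N s -> ge N t -> ge N (s - t);
  filt_zero : forall N, ge N 0;
  filtM : forall N M s t, ge N s -> ge M t -> ge (N + M)%N (s * t);
  filt0 : forall s, ge 0%N s;
  filt_sep : forall s, (forall N, ge N s) -> s = 0 }.

Lemma fps_filtration (A : comNzRingType) : filtration (@fps_ge A).
Proof.
split; [|by []|exact: fps_geM|by []|exact: fps_ge_sep].
by move=> N s t sN tN; apply: fps_geD => //; apply: fps_geN.
Qed.

Lemma fps2_filtration (A : comNzRingType) : filtration (@fps2_ge A).
Proof. by split=> //; [exact: fps2_geB|exact: fps2_geM|exact: fps2_ge_sep]. Qed.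

Section Evaluation.
Variables (A S : comNzRingType) (ge : nat -> S -> Prop).
Hypothesis geF : filtration ge.
Local Notation ser2 := (fps (fps A)).

Lemma filtD N s t : ge N s -> ge N t -> ge N (s + t).
Proof.
move=> sN tN; rewrite -[t]opprK -[- t]sub0r.
by apply: (filtB geF) => //; apply: (filtB geF) => //; apply: (filt_zero geF).
Qed.

Lemma filtMl N s t : ge N s -> ge N (s * t).
Proof.
by move=> sN; rewrite -[N]addn0; apply: (filtM geF) => //; apply: (filt0 geF).
Qed.

(** Polynomials are dense: an additive continuous map that kills the monomials
    is zero.  Every identity between substitutions below is checked on
    monomials only, thanks to this. *)
Lemma dense_eq0 (L : ser2 -> S) (e : nat) :
  (forall h k, L (h - k) = L h - L k) ->
  (forall N h, fps2_ge (N + e) h -> ge N (L h)) ->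
  (forall c a b, L (mono c a b) = 0) -> forall h, L h = 0.
Proof.
move=> LB Lc Lm h; have L0 : L 0 = 0 by rewrite -(subr0 0) LB subrr.
have LD f g : L (f + g) = L f + L g.
  by rewrite -{1}[g]opprK LB -{1}[- g]sub0r LB L0 sub0r opprK.
apply: (filt_sep geF) => N.
rewrite -[h](subrK (trunc2 (N + e) h)) LD [X in _ + X](_ : _ = 0) ?addr0.
  exact/Lc/trunc2P.
rewrite /trunc2 (big_morph L LD L0) big1 // => a _.
by rewrite (big_morph L LD L0) big1.
Qed.

Variable sc : A -> S.

(** The substitution [x := X, y := Y] is characterized rather than constructed, so
    that [comp21], [comp2] and the identity share one theory. *)
Definition evaluation (X Y : S) (L : ser2 -> S) :=
  [/\ forall h k, L (h - k) = L h - L k,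
      forall N h, fps2_ge N h -> ge N (L h) &
      forall c a b, L (mono c a b) = sc c * (X ^+ a * Y ^+ b)].

Lemma evaluation_uniq X Y L L' :
  evaluation X Y L -> evaluation X Y L' -> L =1 L'.
Proof.
move=> [LB Lc Lm] [LB' Lc' Lm'] h; apply/eqP; rewrite -subr_eq0; apply/eqP.
apply: (@dense_eq0 (fun h => L h - L' h) 0) => {h} [h k|N h|c a b].
- by rewrite LB LB'; ring.
- by rewrite addn0 => hN; apply: (filtB geF); [exact: Lc|exact: Lc'].
- by rewrite Lm Lm' subrr.
Qed.

Hypothesis scM : {morph sc : c d / c * d}.

Lemma evaluationM X Y L : evaluation X Y L -> {morph L : h k / h * k}.
Proof.
move=> [LB Lc Lm] h k; apply/eqP; rewrite -subr_eq0; apply/eqP.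
apply: (@dense_eq0 (fun h => L (h * k) - L h * L k) 0) => {h} [h l|N h|c a b].
- by rewrite mulrBl !LB; ring.
- rewrite addn0 => hN; rewrite -[N]addn0; apply: (filtB geF).
    by apply: Lc; apply: fps2_geM.
  by apply: (filtM geF); [exact: Lc|exact: (filt0 geF)].
apply: (@dense_eq0 (fun k => L (mono c a b * k) - L (mono c a b) * L k) 0)
  => {k} [h l|N h|d i j].
- by rewrite mulrBr !LB; ring.
- rewrite addn0 => hN; rewrite -[N]add0n; apply: (filtB geF).
    by apply: Lc; apply: fps2_geM.
  by apply: (filtM geF); [exact: (filt0 geF)|exact: Lc].
by rewrite monoM !Lm scM !exprD; ring.
Qed.

Hypothesis scD : {morph sc : c d / c + d}.

(** Both sides are additive and continuous up to a shift by one, and on monomials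
    the formula is the Leibniz rule. *)
Lemma evaluation_chain X Y L (D : S -> S) :
  evaluation X Y L ->
  (forall s t, D (s - t) = D s - D t) ->
  (forall s t, D (s * t) = D s * t + s * D t) ->
  (forall c, D (sc c) = 0) ->
  (forall N s, ge N.+1 s -> ge N (D s)) ->
  forall h, D (L h) = L (derivx h) * D X + L (derivy h) * D Y.
Proof.
move=> [LB Lc Lm] DB DM Dsc Dc h.
have sc0 : sc 0 = 0 by apply: (addrI (sc 0)); rewrite -scD !addr0.
have scn c j : sc (c *+ j) = sc c *+ j.
  by elim: j => [|j IH]; rewrite ?mulr0n // !mulrSr scD IH.
have DX s j : D (s ^+ j.+1) = s ^+ j * D s *+ j.+1.
  elim: j => [|j IH]; first by rewrite !expr1 expr0 mul1r.
  by rewrite exprS DM IH exprS -mulrnAl mulrSr -mulr_natr -[in RHS]mulr_natr; ring.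
apply/eqP; rewrite -subr_eq0; apply/eqP.
apply: (@dense_eq0
  (fun h => D (L h) - (L (derivx h) * D X + L (derivy h) * D Y)) 1)
  => {h} [h k|N h|c a b].
- by rewrite LB DB derivxB derivyB !LB; ring.
- rewrite addn1 => hN; apply: (filtB geF); first exact/Dc/Lc.
  by apply: filtD; apply: filtMl; apply: Lc; [exact: derivx_ge|exact: derivy_ge].
have D1 : D 1 = 0.
  by apply: (addrI (D 1)); rewrite addr0 -[in RHS](mulr1 1) DM mulr1 mul1r.
rewrite derivx_mono derivy_mono !Lm !DM Dsc mul0r add0r !scn.
case: a b => [|a] [|b]; rewrite ?expr0 ?D1 ?DX /= ?mulr0n ?exprS.
- by ring.
- by move: (Y ^+ b) => ?; ring.
- by move: (X ^+ a) => ?; ring.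
- by move: (X ^+ a) (Y ^+ b) => ? ?; ring.
Qed.

End Evaluation.

Section Composition.
Variable A : comNzRingType.
Implicit Types (h k u v : fps (fps A)) (x y : fps A).

Lemma const_term x : fps_ge 1 x <-> x 0%N = 0.
Proof.
split=> [x1|x0 k]; first exact: x1.
by rewrite ltnS leqn0 => /eqP ->.
Qed.

Lemma const_term2 u : fps2_ge 1 u <-> u 0%N 0%N = 0.
Proof.
split=> [u1|u0 i j]; first exact: u1.
by rewrite ltnS leqn0 addn_eq0 => /andP[/eqP -> /eqP ->].
Qed.

Lemma scal1M : {morph (@single A 0) : c d / c * d}.
Proof. by move=> c d; rewrite singleM. Qed.

Lemma scal1D : {morph (@single A 0) : c d / c + d}.
Proof. by move=> c d; rewrite singleD. Qed.

Definition scal2 (c : A) := mono c 0 0.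

Lemma scal2M : {morph scal2 : c d / c * d}.
Proof. by move=> c d; rewrite /scal2 monoM. Qed.

Lemma scal2D : {morph scal2 : c d / c + d}.
Proof. by move=> c d; rewrite /scal2 monoD. Qed.

Lemma exp_ge x y a b : fps_ge 1 x -> fps_ge 1 y -> fps_ge (a + b) (x ^+ a * y ^+ b).
Proof. by move=> x1 y1; apply: fps_geM; apply: fps_geX. Qed.

Lemma exp2_ge u v a b :
  fps2_ge 1 u -> fps2_ge 1 v -> fps2_ge (a + b) (u ^+ a * v ^+ b).
Proof.
have E w c : fps2_ge 1 w -> fps2_ge c (w ^+ c).
  move=> w1; elim: c => [|c IH]; first by move=> ? ?; rewrite ltn0.
  by rewrite exprS -add1n; apply: fps2_geM.
by move=> u1 v1; apply: fps2_geM; apply: E.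
Qed.

Lemma comp21_evaluation x y : x 0%N = 0 -> y 0%N = 0 ->
  evaluation (@fps_ge A) (@single A 0) x y (fun h => comp21 h x y).
Proof.
move=> /const_term x1 /const_term y1; split=> [h k|N h hN k kN|c a b].
- apply: funext => i; rewrite fpsBE /comp21 -sumrB; apply: eq_bigr => a _.
  by rewrite -sumrB; apply: eq_bigr => b _; rewrite !fpsBE mulrBl.
- rewrite /comp21 big1 // => a _; rewrite big1 // => b _.
  case: (ltnP (a + b) N) => ab; first by rewrite hN ?mul0r.
  by rewrite (exp_ge x1 y1) ?mulr0 //; lia.
apply: funext => k; rewrite singleME /= subn0 /comp21.
have [kab|abk] := ltnP k (a + b).
  rewrite (exp_ge x1 y1) // mulr0 big1 // => i _; rewrite big1 // => j _.
  rewrite monoE; case: andP => [[/eqP -> /eqP ->]|_]; last by rewrite mul0r.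
  by rewrite (exp_ge x1 y1) ?mulr0.
have ak : (a < k.+1)%N by lia. have bk : (b < k.+1)%N by lia.
rewrite (bigD1 (Ordinal ak)) //= (bigD1 (Ordinal bk)) //= monoE !eqxx /=.
rewrite big1 ?addr0 => [|j jb]; last first.
  by rewrite monoE eqxx /= (_ : (j == b :> nat) = false) ?mul0r //; apply/negbTE.
rewrite big1 ?addr0 // => i ia; rewrite big1 // => j _.
by rewrite monoE (_ : (i == a :> nat) = false) ?mul0r //; apply/negbTE.
Qed.

Lemma comp2_evaluation u v : u 0%N 0%N = 0 -> v 0%N 0%N = 0 ->
  evaluation (@fps2_ge A) scal2 u v (fun h => comp2 h u v).
Proof.
move=> /const_term2 u1 /const_term2 v1; split=> [h k|N h hN i' j' ijN|c a b].
- apply: funext => i; apply: funext => j; rewrite !fpsBE /comp2 -sumrB.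
  apply: eq_bigr => a _; rewrite -sumrB.
  by apply: eq_bigr => b _; rewrite !fpsBE mulrBl.
- rewrite /comp2 big1 // => a _; rewrite big1 // => b _.
  case: (ltnP (a + b) N) => ab; first by rewrite hN ?mul0r.
  by rewrite (exp2_ge u1 v1) ?mulr0 //; lia.
apply: funext => k; apply: funext => l; rewrite mono_mulE /= !subn0 /comp2.
have [kab|abk] := ltnP (k + l) (a + b).
  rewrite (exp2_ge u1 v1) // mulr0 big1 // => i _; rewrite big1 // => j _.
  rewrite monoE; case: andP => [[/eqP -> /eqP ->]|_]; last by rewrite mul0r.
  by rewrite (exp2_ge u1 v1) ?mulr0.
have ak : (a < (k + l).+1)%N by lia. have bk : (b < (k + l).+1)%N by lia.
rewrite (bigD1 (Ordinal ak)) //= (bigD1 (Ordinal bk)) //= monoE !eqxx /=.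
rewrite big1 ?addr0 => [|j jb]; last first.
  by rewrite monoE eqxx /= (_ : (j == b :> nat) = false) ?mul0r //; apply/negbTE.
rewrite big1 ?addr0 // => i ia; rewrite big1 // => j _.
by rewrite monoE (_ : (i == a :> nat) = false) ?mul0r //; apply/negbTE.
Qed.

Section OneVariable.
Variables x y : fps A.
Hypotheses (x0 : x 0%N = 0) (y0 : y 0%N = 0).
Let ev := comp21_evaluation x0 y0.

Lemma comp21M h k : comp21 (h * k) x y = comp21 h x y * comp21 k x y.
Proof. exact: (evaluationM (fps_filtration A) scal1M ev). Qed.

Lemma comp21B h k : comp21 (h - k) x y = comp21 h x y - comp21 k x y.
Proof. by case: ev. Qed.

Lemma comp21_mono c a b : comp21 (mono c a b) x y = single 0 c * (x ^+ a * y ^+ b).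
Proof. by case: ev. Qed.

Lemma comp21_0 : comp21 0 x y = 0.
Proof. by rewrite -(subrr 0) comp21B subrr. Qed.

Lemma comp21D h k : comp21 (h + k) x y = comp21 h x y + comp21 k x y.
Proof. by rewrite -{1}[k]opprK -[- k]sub0r !comp21B comp21_0 sub0r opprK. Qed.

Lemma comp21_varx : comp21 (varx A) x y = x.
Proof. by rewrite varx_mono comp21_mono single0_1 mul1r mulr1. Qed.

Lemma comp21_vary : comp21 (vary A) x y = y.
Proof. by rewrite vary_mono comp21_mono single0_1 !mul1r. Qed.

Lemma comp21_const h : comp21 h x y 0%N = h 0%N 0%N.
Proof. by rewrite /comp21 !big_ord_recl !big_ord0 !addr0 !expr0 mul1r mulr1. Qed.

Lemma comp21_deriv h : fps_deriv (comp21 h x y) =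
  comp21 (derivx h) x y * fps_deriv x + comp21 (derivy h) x y * fps_deriv y.
Proof.
apply: (evaluation_chain (fps_filtration A) scal1D ev).
- exact: fps_derivB.
- exact: fps_derivM.
- move=> c; rewrite fps_deriv_single mulr0n.
  by apply: funext => k; rewrite /single if_same.
- by move=> N s sN k kN; rewrite /fps_deriv sN ?mul0rn.
Qed.

End OneVariable.

Section TwoVar.
Variables u v : fps (fps A).
Hypotheses (u0 : u 0%N 0%N = 0) (v0 : v 0%N 0%N = 0).
Let ev := comp2_evaluation u0 v0.

Lemma comp2M h k : comp2 (h * k) u v = comp2 h u v * comp2 k u v.
Proof. exact: (evaluationM (fps2_filtration A) scal2M ev). Qed.

Lemma comp2B h k : comp2 (h - k) u v = comp2 h u v - comp2 k u v.
Proof. by case: ev. Qed.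

Lemma comp2_0 : comp2 0 u v = 0.
Proof. by rewrite -[X in comp2 X](subrr 0) comp2B subrr. Qed.

Lemma comp2D h k : comp2 (h + k) u v = comp2 h u v + comp2 k u v.
Proof. by rewrite -{1}[k]opprK -[- k]sub0r !comp2B comp2_0 sub0r opprK. Qed.

Lemma comp2_const h : comp2 h u v 0%N 0%N = h 0%N 0%N.
Proof.
by rewrite /comp2 !big_ord_recl !big_ord0 !addr0 !expr0 mul1r mulr1.
Qed.

Let scal2_deriv (c : A) : derivx (scal2 c) = 0 /\ derivy (scal2 c) = 0.
Proof.
rewrite /scal2 derivx_mono derivy_mono !mulr0n; split;
by apply: funext => i; apply: funext => j; rewrite monoE if_same.
Qed.

Lemma comp2_derivx h : derivx (comp2 h u v) =
  comp2 (derivx h) u v * derivx u + comp2 (derivy h) u v * derivx v.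
Proof.
apply: (evaluation_chain (fps2_filtration A) scal2D ev).
- exact: derivxB.
- exact: derivxM.
- by move=> c; case: (scal2_deriv c).
- exact: derivx_ge.
Qed.

Lemma comp2_derivy h : derivy (comp2 h u v) =
  comp2 (derivx h) u v * derivy u + comp2 (derivy h) u v * derivy v.
Proof.
apply: (evaluation_chain (fps2_filtration A) scal2D ev).
- exact: derivyB.
- exact: derivyM.
- by move=> c; case: (scal2_deriv c).
- exact: derivy_ge.
Qed.

Lemma comp21_comp2 x y h : x 0%N = 0 -> y 0%N = 0 ->
  comp21 (comp2 h u v) x y = comp21 h (comp21 u x y) (comp21 v x y).
Proof.
move=> x0 y0; have [LB Lc Lm] := comp21_evaluation x0 y0.
have [MB Mc Mm] := ev.
have X w a : comp21 (w ^+ a) x y = comp21 w x y ^+ a.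
  elim: a => [|a IH]; last by rewrite !exprS comp21M // IH.
  by rewrite !expr0 -mono1 Lm mulr1 mulr1 single0_1.
have E : evaluation (@fps_ge A) (@single A 0) (comp21 u x y) (comp21 v x y)
    (fun h => comp21 (comp2 h u v) x y).
  split=> [f k|N f fN|c a b]; [by rewrite MB LB|exact/Lc/Mc|].
  by rewrite Mm !comp21M // !X /scal2 Lm !mulr1.
have F : evaluation (@fps_ge A) (@single A 0) (comp21 u x y) (comp21 v x y)
    (fun h => comp21 h (comp21 u x y) (comp21 v x y)).
  by apply: comp21_evaluation; rewrite comp21_const.
exact: (evaluation_uniq (fps_filtration A) E F h).
Qed.

Lemma comp2_comp2 p q h : p 0%N 0%N = 0 -> q 0%N 0%N = 0 ->
  comp2 (comp2 h p q) u v = comp2 h (comp2 p u v) (comp2 q u v).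
Proof.
move=> p0 q0; have [LB Lc Lm] := ev.
have [MB Mc Mm] := comp2_evaluation p0 q0.
have X w a : comp2 (w ^+ a) u v = comp2 w u v ^+ a.
  elim: a => [|a IH]; last by rewrite !exprS comp2M // IH.
  by rewrite !expr0 -mono1 Lm mulr1 mulr1 /scal2.
have E : evaluation (@fps2_ge A) scal2 (comp2 p u v) (comp2 q u v)
    (fun h => comp2 (comp2 h p q) u v).
  split=> [f k|N f fN|c a b]; [by rewrite MB LB|exact/Lc/Mc|].
  by rewrite Mm !comp2M // !X [X in comp2 X]/scal2 Lm !mulr1.
have F : evaluation (@fps2_ge A) scal2 (comp2 p u v) (comp2 q u v)
    (fun h => comp2 h (comp2 p u v) (comp2 q u v)).
  by apply: comp2_evaluation; rewrite comp2_const.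
exact: (evaluation_uniq (fps2_filtration A) E F h).
Qed.

End TwoVar.

Lemma comp2_id h : comp2 h (varx A) (vary A) = h.
Proof.
have E : evaluation (@fps2_ge A) scal2 (varx A) (vary A) id.
  split=> // c a b; rewrite varx_mono vary_mono /scal2 !mono_exp !monoM !expr1n.
  by rewrite !mulr1 !mul1n !mul0n addn0 !add0n.
exact: (evaluation_uniq (fps2_filtration A) (comp2_evaluation _ _) E h).
Qed.

End Composition.

(** * Convergence *)

Section Norms.
Variable K : numFieldType.
Implicit Types (r M D : K) (N i j k : nat).

Definition seminorm (A : comNzRingType) (q : A -> K) :=
  [/\ q 0 = 0, forall a, 0 <= q a, forall a b, q (a + b) <= q a + q b &
      forall a b, q (a * b) <= q a * q b].

Lemma seminorm_sum (A : comNzRingType) (q : A -> K) (I : Type) (s : seq I)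
    (P : pred I) (F : I -> A) :
  seminorm q -> q (\sum_(i <- s | P i) F i) <= \sum_(i <- s | P i) q (F i).
Proof.
move=> [q0 _ qD _]; elim/big_rec2: _ => [|i x y _ h]; first by rewrite q0.
by apply: le_trans (qD _ _) _; rewrite lerD2l.
Qed.

Lemma seminorm_exp (A : comNzRingType) (q : A -> K) a k :
  seminorm q -> q (a ^+ k.+1) <= q a ^+ k.+1.
Proof.
move=> [_ q_ge0 _ qM]; elim: k => [|k IH]; first by rewrite !expr1.
rewrite exprS [in leRHS]exprS; apply: le_trans (qM _ _) _.
exact: ler_wpM2l.
Qed.

Lemma normr_seminorm : seminorm (@Num.norm K K).
Proof.
by split=> [||a b|a b]; rewrite ?normr0 ?normrM //; exact: ler_normD.
Qed.

(** Truncating the weighted l1 norm makes it a finite sum and keeps it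
    submultiplicative; convergence means that it is bounded in [N]. *)
Definition nrm (A : comNzRingType) (q : A -> K) r N (f : fps A) : K :=
  \sum_(k < N) q (f k) * r ^+ k.

Lemma sum_triangle (F : nat -> nat -> K) N :
  (forall i j, 0 <= F i j) ->
  \sum_(k < N) \sum_(i < k.+1) F i (k - i)%N <= \sum_(i < N) \sum_(j < N) F i j.
Proof.
move=> F0.
have -> : \sum_(k < N) \sum_(i < k.+1) F i (k - i)%N
        = \sum_(k < N) \sum_(i < N | (i <= k)%N) F i (k - i)%N.
  apply: eq_bigr => k _.
  by rewrite (big_ord_widen N (fun i => F i (k - i)%N) (ltn_ord k)).
rewrite (exchange_big_dep xpredT) //=; apply: ler_sum => i _.
rewrite -(big_mkord (fun k => (i <= k)%N) (fun k => F i (k - i)%N)).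
rewrite -(big_mkord xpredT (fun j => F i j)).
rewrite (big_cat_nat (n := i)) //=; last exact: ltnW.
rewrite big_nat_cond big_pred0 => [|k]; last first.
  by apply/negbTE/negP => /andP[/andP[_ ki]]; rewrite leqNgt ki.
rewrite add0r (big_addn 0 N i) [leRHS](big_cat_nat (n := N - i)) ?leq_subr //=.
rewrite [X in X <= _](_ : _ = \sum_(0 <= j < N - i) F i j).
  by rewrite lerDl sumr_ge0.
apply: eq_big => [j|j _]; first by rewrite leq_addl.
by rewrite addnK.
Qed.

Section Seminormed.
Variables (A : comNzRingType) (q : A -> K).
Hypothesis qN : seminorm q.
Implicit Types f g : fps A.

Lemma nrm_seminorm r N : 0 <= r -> seminorm (nrm q r N).
Proof.
move=> r0; have [q0 q_ge0 qD qM] := qN; split=> [|f|f g|f g].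
- by apply: big1 => k _; rewrite fps0E q0 mul0r.
- by apply: sumr_ge0 => k _; rewrite mulr_ge0 ?exprn_ge0.
- rewrite -big_split; apply: ler_sum => k _ /=; rewrite -mulrDl.
  by apply: ler_wpM2r; [exact: exprn_ge0|exact: qD].
have F0 i j : 0 <= (q (f i) * r ^+ i) * (q (g j) * r ^+ j).
  by rewrite !mulr_ge0 ?exprn_ge0.
rewrite /nrm mulr_suml.
under [leRHS]eq_bigr do rewrite mulr_sumr.
apply: le_trans (sum_triangle N F0); apply: ler_sum => k _.
have -> : \sum_(i < k.+1) (q (f i) * r ^+ i) * (q (g (k - i)%N) * r ^+ (k - i))
   = (\sum_(i < k.+1) q (f i) * q (g (k - i)%N)) * r ^+ k.
  rewrite mulr_suml; apply: eq_bigr => i _; rewrite mulrACA -exprD subnKC //.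
  by rewrite -ltnS.
apply: ler_wpM2r; first exact: exprn_ge0.
rewrite fpsME; apply: le_trans (seminorm_sum _ _ _ qN) _.
by apply: ler_sum => i _; apply: qM.
Qed.

Lemma nrm_ge0 r N f : 0 <= r -> 0 <= nrm q r N f.
Proof. by move=> r0; case: (nrm_seminorm N r0). Qed.

Lemma nrm_single0 r N a : 0 <= r -> nrm q r N (single 0 a) <= q a.
Proof.
move=> r0; have [q0 q_ge0 _ _] := qN; case: N => [|N].
  by rewrite /nrm big_ord0.
rewrite /nrm big_ord_recl /single /= mulr1 big1 ?addr0 // => i _.
by rewrite q0 mul0r.
Qed.

Lemma nrm_coef r N f k : 0 <= r -> (k < N)%N -> q (f k) * r ^+ k <= nrm q r N f.
Proof.
move=> r0 kN; have [q0 q_ge0 _ _] := qN.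
rewrite /nrm (bigD1 (Ordinal kN)) //= lerDl sumr_ge0 // => i _.
by rewrite mulr_ge0 ?exprn_ge0.
Qed.

Lemma nrm_le r s N f : 0 <= r -> r <= s -> nrm q r N f <= nrm q s N f.
Proof.
move=> r0 rs; have [q0 q_ge0 _ _] := qN; apply: ler_sum => k _.
apply: ler_wpM2l => //; apply: lerXn2r; rewrite ?nnegrE //; exact: le_trans rs.
Qed.

Lemma nrm_leN r N N' f : 0 <= r -> (N <= N')%N -> nrm q r N f <= nrm q r N' f.
Proof.
move=> r0 NN; have [q0 q_ge0 _ _] := qN; rewrite /nrm.
rewrite -!(big_mkord xpredT (fun k => q (f k) * r ^+ k)).
rewrite [leRHS](big_cat_nat (n := N)) //= lerDl sumr_ge0 // => i _.
by rewrite mulr_ge0 ?exprn_ge0.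
Qed.

End Seminormed.

Definition nrm1 r N : fps K -> K := nrm (@Num.norm K K) r N.
Definition nrm2 r N : fps (fps K) -> K := nrm (nrm1 r N) r N.

Lemma nrm1_seminorm r N : 0 <= r -> seminorm (nrm1 r N).
Proof. exact: (nrm_seminorm normr_seminorm). Qed.

Lemma nrm2_seminorm r N : 0 <= r -> seminorm (nrm2 r N).
Proof. by move=> r0; apply: nrm_seminorm => //; apply: nrm1_seminorm. Qed.

Lemma nrm2_le r s N h : 0 <= r -> r <= s -> nrm2 r N h <= nrm2 s N h.
Proof.
move=> r0 rs; have s0 := le_trans r0 rs.
apply: le_trans (nrm_le (nrm1_seminorm N s0) _ _ r0 rs).
apply: ler_sum => k _; apply: ler_wpM2r; first exact: exprn_ge0.
exact: (nrm_le normr_seminorm).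
Qed.

(** One notion for series in one and in two variables, so that closure under the
    ring operations is proved once. *)
Definition conv (S : Type) (nf : K -> nat -> S -> K) (s : S) :=
  exists r M, 0 < r /\ forall N, nf r N s <= M.

Lemma common_radius r1 r2 : 0 < r1 -> 0 < r2 ->
  exists r, [/\ 0 < r, r <= r1 & r <= r2].
Proof.
move=> r10 r20; exists (r1^-1 + r2^-1)^-1.
have p : 0 < r1^-1 + r2^-1 by rewrite addr_gt0 ?invr_gt0.
by split; rewrite ?invr_gt0 // -lef_pV2 ?posrE ?invr_gt0 // invrK ?lerDl ?lerDr
  invr_ge0 ltW.
Qed.

Record norm_family (S : comNzRingType) (nf : K -> nat -> S -> K) := NormFamily {
  nf_seminorm : forall r N, 0 <= r -> seminorm (nf r N);
  nf_le : forall r s N h, 0 <= r -> r <= s -> nf r N h <= nf s N h }.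

Lemma nrm1_family : norm_family nrm1.
Proof.
split; first exact: nrm1_seminorm.
by move=> *; apply: (nrm_le normr_seminorm).
Qed.

Lemma nrm2_family : norm_family nrm2.
Proof. by split; [exact: nrm2_seminorm|exact: nrm2_le]. Qed.

Section Family.
Variables (S : comNzRingType) (nf : K -> nat -> S -> K).
Hypothesis nfF : norm_family nf.

Lemma conv_common s t : conv nf s -> conv nf t ->
  exists r M, [/\ 0 < r, 0 <= M, forall N, nf r N s <= M & forall N, nf r N t <= M].
Proof.
move=> [r1 [M1 [r10 s1]]] [r2 [M2 [r20 t2]]].
have [r [r0 rr1 rr2]] := common_radius r10 r20.
have nf0 r' N u : 0 < r' -> 0 <= nf r' N u.
  by move=> r'0; case: (nf_seminorm nfF N (ltW r'0)).
have M10 : 0 <= M1 by apply: le_trans (s1 0%N); apply: nf0.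
have M20 : 0 <= M2 by apply: le_trans (t2 0%N); apply: nf0.
exists r, (M1 + M2); split=> //; rewrite ?addr_ge0 // => N.
  by apply: le_trans (nf_le nfF _ _ (ltW r0) rr1) (le_trans (s1 N) _); rewrite lerDl.
by apply: le_trans (nf_le nfF _ _ (ltW r0) rr2) (le_trans (t2 N) _); rewrite lerDr.
Qed.

Lemma convD s t : conv nf s -> conv nf t -> conv nf (s + t).
Proof.
move=> cs ct; have [r [M [r0 M0 sM tM]]] := conv_common cs ct.
exists r, (M + M); split=> // N; have [_ _ nD _] := nf_seminorm nfF N (ltW r0).
by apply: le_trans (nD _ _) _; apply: lerD.
Qed.

Lemma convM s t : conv nf s -> conv nf t -> conv nf (s * t).
Proof.
move=> cs ct; have [r [M [r0 M0 sM tM]]] := conv_common cs ct.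
exists r, (M * M); split=> // N; have [_ n0 _ nM] := nf_seminorm nfF N (ltW r0).
by apply: le_trans (nM _ _) _; apply: ler_pM.
Qed.

End Family.

Lemma nrm1_small r s N f : fps_ge 1 f -> 0 < r -> r <= s ->
  nrm1 r N f <= r / s * nrm1 s N f.
Proof.
move=> f1 r0 rs; have s0 := lt_le_trans r0 rs.
rewrite /nrm1 /nrm mulr_sumr; apply: ler_sum => -[[|k] kN] _ /=.
  by rewrite f1 // normr0 !mul0r mulr0.
rewrite [leRHS]mulrCA; apply: ler_wpM2l => //.
rewrite !exprS [leRHS]mulrA divfK ?gt_eqF //; apply: ler_wpM2l; first exact: ltW.
by apply: lerXn2r => //; rewrite nnegrE ltW.
Qed.

Lemma nrm2_small r s N h : fps2_ge 1 h -> 0 < r -> r <= s ->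
  nrm2 r N h <= r / s * nrm2 s N h.
Proof.
move=> h1 r0 rs; have s0 := lt_le_trans r0 rs.
rewrite /nrm2 /nrm mulr_sumr; apply: ler_sum => -[[|i] iN] _ /=.
  rewrite !mulr1; apply: nrm1_small => //.
  by move=> j; rewrite ltnS leqn0 => /eqP ->; apply: h1.
rewrite [leRHS]mulrCA; apply: ler_pM.
- exact: (nrm_ge0 normr_seminorm _ _ (ltW r0)).
- exact: (exprn_ge0 _ (ltW r0)).
- exact: (nrm_le normr_seminorm _ _ (ltW r0)).
rewrite !exprS mulrA divfK ?gt_eqF //; apply: ler_wpM2l; first exact: ltW.
by apply: lerXn2r => //; rewrite nnegrE ltW.
Qed.

Lemma nrm2E r N h : nrm2 r N h = \sum_(a < N) \sum_(b < N) `|h a b| * (r ^+ a * r ^+ b).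
Proof.
apply: eq_bigr => a _; rewrite /nrm1 /nrm mulr_suml.
by apply: eq_bigr => b _; rewrite -mulrA [r ^+ b * _]mulrC.
Qed.

(** Monomial by monomial, the triangle inequality bounds the norm of a
    substitution by the norm of the outer series, at a radius that dominates the
    norms of the substituted ones. *)
Section EvaluationNorm.
Variables (S : comNzRingType) (ge : nat -> S -> Prop) (sc : K -> S).
Variables (q : S -> K) (N : nat) (X Y : S) (L : fps (fps K) -> S) (r : K).
Hypotheses (LE : evaluation ge sc X Y L) (qN : seminorm q).
Hypothesis q_ge : forall s, ge N s -> q s = 0.
Hypothesis q_sc : forall c, q (sc c) <= `|c|.
Hypothesis q1 : q 1 <= 1.
Hypotheses (Xr : q X <= r) (Yr : q Y <= r).

Lemma evaluation_norm h : q (L h) <= nrm2 r N h.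
Proof.
have [q0 q_ge0 qD qM] := qN; have [LB Lc Lm] := LE.
have r0 : 0 <= r := le_trans (q_ge0 X) Xr.
have L0 : L 0 = 0 by rewrite -(subr0 0) LB subrr.
have LD f g : L (f + g) = L f + L g.
  by rewrite -{1}[g]opprK LB -{1}[- g]sub0r LB L0 sub0r opprK.
rewrite -[h](subrK (trunc2 N h)) LD subrK.
apply: le_trans (qD _ _) _; rewrite q_ge ?add0r; last exact/Lc/trunc2P.
rewrite nrm2E /trunc2 (big_morph L LD L0); apply: le_trans (seminorm_sum _ _ _ qN) _.
apply: ler_sum => a _; rewrite (big_morph L LD L0).
apply: le_trans (seminorm_sum _ _ _ qN) _; apply: ler_sum => b _; rewrite Lm.
have qX Z c : q Z <= r -> q (Z ^+ c) <= r ^+ c.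
  case: c => [|c] Zr; first by rewrite !expr0.
  apply: le_trans (seminorm_exp _ _ qN) _; apply: lerXn2r => //; exact: q_ge0.
apply: le_trans (qM _ _) _; apply: ler_pM => //.
by apply: le_trans (qM _ _) _; apply: ler_pM => //; apply: qX.
Qed.

End EvaluationNorm.

Lemma nrm1_ge r N f : fps_ge N f -> nrm1 r N f = 0.
Proof. by move=> fN; apply: big1 => k _; rewrite fN // normr0 mul0r. Qed.

Lemma nrm2_ge r N h : fps2_ge (N + N) h -> nrm2 r N h = 0.
Proof.
move=> hN; rewrite nrm2E big1 // => a _; rewrite big1 // => b _.
rewrite hN ?normr0 ?mul0r //; have := ltn_ord a; have := ltn_ord b; lia.
Qed.

Lemma nrm1_sc r N c : 0 <= r -> nrm1 r N (single 0 c) <= `|c|.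
Proof. exact: (nrm_single0 normr_seminorm). Qed.

Lemma nrm2_sc r N c : 0 <= r -> nrm2 r N (scal2 c) <= `|c|.
Proof.
move=> r0; apply: le_trans (nrm_single0 (nrm1_seminorm N r0) _ _ r0) _.
exact: nrm1_sc.
Qed.

(** Series without constant term become small on small discs; hence the radius
    of convergence of the outer series can be reached. *)
Lemma small_radius s1 r M (m1 : 0 < s1) (r0 : 0 < r) (M0 : 0 <= M) :
  exists s, [/\ 0 < s, s <= s1 & s / s1 * M <= r].
Proof.
have d0 : 0 < r + M by rewrite ltr_pwDl.
have dr : 0 < r / (r + M) by rewrite divr_gt0.
exists (s1 * (r / (r + M))); split.
- by rewrite mulr_gt0.
- by rewrite ler_piMr ?(ltW m1) // ler_pdivrMr // mul1r lerDl.
rewrite [s1 * _]mulrC mulfK ?gt_eqF // mulrAC ler_pdivrMr //.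
by apply: ler_wpM2l; rewrite ?lerDr ltW.
Qed.

Lemma conv_comp21 h x y : fps_ge 1 x -> fps_ge 1 y ->
  conv nrm2 h -> conv nrm1 x -> conv nrm1 y -> conv nrm1 (comp21 h x y).
Proof.
move=> x1 y1 [r [M [r0 hM]]] cx cy.
have [s1 [M1 [s10 M10 xM yM]]] := conv_common nrm1_family cx cy.
have [s [s0 ss1 sr]] := small_radius s10 r0 M10.
exists s, M; split=> // N; apply: le_trans (hM N).
have sle z : fps_ge 1 z -> (forall N, nrm1 s1 N z <= M1) -> nrm1 s N z <= r.
  move=> z1 zM; apply: le_trans (nrm1_small N z1 s0 ss1) (le_trans _ sr).
  by apply: ler_wpM2l => //; rewrite divr_ge0 // ltW.
apply: (evaluation_norm (comp21_evaluation (x1 0%N _) (y1 0%N _))) => //.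
- exact: nrm1_seminorm (ltW s0).
- by move=> f; apply: nrm1_ge.
- by move=> c; apply: nrm1_sc (ltW s0).
- by rewrite -single0_1; apply: le_trans (nrm1_sc _ _ (ltW s0)) _; rewrite normr1.
- exact: sle.
- exact: sle.
Qed.

Lemma conv_comp2 h u v : fps2_ge 1 u -> fps2_ge 1 v ->
  conv nrm2 h -> conv nrm2 u -> conv nrm2 v -> conv nrm2 (comp2 h u v).
Proof.
move=> u1 v1 [r [M [r0 hM]]] cu cv.
have [s1 [M1 [s10 M10 uM vM]]] := conv_common nrm2_family cu cv.
have [s [s0 ss1 sr]] := small_radius s10 r0 M10.
exists s, M; split=> // N; apply: le_trans (hM (N + N)%N).
have sle z : fps2_ge 1 z -> (forall N, nrm2 s1 N z <= M1) -> nrm2 s N z <= r.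
  move=> z1 zM; apply: le_trans (nrm2_small N z1 s0 ss1) (le_trans _ sr).
  by apply: ler_wpM2l => //; rewrite divr_ge0 // ltW.
apply: (evaluation_norm (comp2_evaluation (u1 0%N 0%N _) (v1 0%N 0%N _))) => //.
- exact: nrm2_seminorm (ltW s0).
- by move=> f; apply: nrm2_ge.
- by move=> c; apply: nrm2_sc (ltW s0).
- rewrite -mono1; apply: le_trans (nrm2_sc _ _ (ltW s0)) _; by rewrite normr1.
- exact: sle.
- exact: sle.
Qed.

(** A discrete Gronwall inequality: coefficients bounded by a constant times the
    sum of the previous ones grow at most geometrically.  All the convergence
    proofs for series defined by a recursion end with it. *)
Lemma gronwall (y : nat -> K) D : 0 <= D -> 
  (forall k, y k <= D * (1 + \sum_(j < k) y j)) ->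
  forall k, y k <= D * (1 + D) ^+ k.
Proof.
move=> D0 yD k; apply: le_trans (yD k) _; apply: ler_wpM2l => //.
elim: k => [|k IH]; first by rewrite big_ord0 addr0.
rewrite big_ord_recr /= addrA exprS mulrDl mul1r; apply: lerD => //.
by apply: le_trans (yD k) _; apply: ler_wpM2l.
Qed.

End Norms.

Section Holomorphy.
Variable R : realType.
Local Notation C := R[i].
Local Notation ser1 := (fps C).
Local Notation ser2 := (fps (fps C)).
Implicit Types (f : ser1) (h : ser2).

Lemma sum_half (N : nat) : \sum_(k < N) (2^-1 : C) ^+ k <= 2.
Proof.
have -> : \sum_(k < N) (2^-1 : C) ^+ k = 2 - 2 * 2^-1 ^+ N.
  elim: N => [|N IH]; first by rewrite big_ord0 expr0 mulr1 subrr.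
  by rewrite big_ord_recr /= IH exprS; field.
by rewrite lerBlDr lerDl mulr_ge0 ?exprn_ge0 ?invr_ge0.
Qed.

Lemma holo1P f : holo1 f <-> conv (@nrm1 _) f.
Proof.
split=> [[r [M [r0 fM]]]|[r [M [r0 fM]]]].
  exists (r / 2), (M * 2); split; first by rewrite divr_gt0.
  move=> N; rewrite /nrm1 /nrm.
  have M0 : 0 <= M.
    by apply: le_trans (fM 0%N); rewrite mulr_ge0 ?exprn_ge0 ?(ltW r0).
  apply: le_trans (ler_wpM2l M0 (sum_half N)).
  rewrite mulr_sumr; apply: ler_sum => k _; rewrite exprMn mulrA.
  by apply: ler_wpM2r; rewrite ?exprn_ge0 ?invr_ge0.
exists r, M; split=> // k; apply: le_trans (fM k.+1).
exact: (nrm_coef (normr_seminorm _) _ (ltW r0)).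
Qed.

Lemma holo2P h : holo2 h <-> conv (@nrm2 _) h.
Proof.
split=> [[r [M [r0 hM]]]|[r [M [r0 hM]]]].
  exists (r / 2), (M * 2 * 2); split; first by rewrite divr_gt0.
  move=> N; rewrite nrm2E.
  have M0 : 0 <= M.
    by apply: le_trans (hM 0%N 0%N); rewrite mulr_ge0 ?exprn_ge0 ?(ltW r0).
  have M20 : 0 <= M * 2 by rewrite mulr_ge0.
  apply: le_trans (ler_wpM2l M20 (sum_half N)).
  rewrite mulr_sumr; apply: ler_sum => a _.
  apply: (@le_trans _ _ (M * (\sum_(b < N) 2^-1 ^+ b) * 2^-1 ^+ a)); last first.
    by apply: ler_wpM2r; rewrite ?exprn_ge0 ?invr_ge0 // ler_wpM2l // sum_half.
  rewrite mulr_sumr mulr_suml; apply: ler_sum => b _.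
  have -> : `|h a b| * ((r / 2) ^+ a * (r / 2) ^+ b)
          = `|h a b| * r ^+ (a + b) * (2^-1 ^+ b * 2^-1 ^+ a).
    by rewrite exprD !exprMn; ring.
  by rewrite -[leRHS]mulrA; apply: ler_wpM2r; rewrite ?mulr_ge0 ?exprn_ge0 ?invr_ge0.
exists r, M; split=> // i j; apply: le_trans (hM (i + j).+1).
have r1 := ltW r0; rewrite addnC exprD mulrA.
apply: le_trans (nrm_coef (nrm1_seminorm _ r1) _ r1 (_ : (i < _)%N)); last by lia.
apply: ler_wpM2r; first exact: exprn_ge0.
by apply: (nrm_coef (normr_seminorm _)) => //; lia.
Qed.

Lemma holo1M f g : holo1 f -> holo1 g -> holo1 (f * g).
Proof. by move=> /holo1P cf /holo1P cg; apply/holo1P; exact: (convM (nrm1_family _) cf cg). Qed.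

Lemma holo1D f g : holo1 f -> holo1 g -> holo1 (f + g).
Proof. by move=> /holo1P cf /holo1P cg; apply/holo1P; exact: (convD (nrm1_family _) cf cg). Qed.

Lemma holo2M h k : holo2 h -> holo2 k -> holo2 (h * k).
Proof. by move=> /holo2P cf /holo2P cg; apply/holo2P; exact: (convM (nrm2_family _) cf cg). Qed.

Lemma holo2D h k : holo2 h -> holo2 k -> holo2 (h + k).
Proof. by move=> /holo2P cf /holo2P cg; apply/holo2P; exact: (convD (nrm2_family _) cf cg). Qed.

Lemma holo2N h : holo2 h -> holo2 (- h).
Proof.
by move=> [r [M [r0 hM]]]; exists r, M; split=> // i j; rewrite !fpsNE normrN.
Qed.

Lemma holo2B h k : holo2 h -> holo2 k -> holo2 (h - k).
Proof. by move=> hh hk; apply: holo2D => //; apply: holo2N. Qed.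

Lemma holo2_comp h u v : u 0%N 0%N = 0 -> v 0%N 0%N = 0 ->
  holo2 h -> holo2 u -> holo2 v -> holo2 (comp2 h u v).
Proof.
move=> /const_term2 u0 /const_term2 v0 /holo2P ch /holo2P cu /holo2P cv.
exact/holo2P/conv_comp2.
Qed.

Lemma holo1_comp h x y : x 0%N = 0 -> y 0%N = 0 ->
  holo2 h -> holo1 x -> holo1 y -> holo1 (comp21 h x y).
Proof.
move=> /const_term x0 /const_term y0 /holo2P ch /holo1P cx /holo1P cy.
exact/holo1P/conv_comp21.
Qed.

Lemma succ_le_exp2 (k : nat) : (k.+1%:R : C) <= 2 ^+ k.
Proof. by rewrite -natrX ler_nat; elim: k => // k; rewrite expnS; lia. Qed.

(** Differentiating halves the radius at worst, since [k + 1 <= 2 ^ k]. *)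
Lemma deriv_bound (z r M : C) (k : nat) : 0 < r ->
  `|z| * r ^+ k.+1 <= M -> `|z *+ k.+1| * (r / 2) ^+ k <= M / r.
Proof.
move=> r0 zM; rewrite ler_pdivlMr // -[z *+ _]mulr_natl normrM normr_nat exprMn.
apply: le_trans zM; rewrite exprS.
have -> : k.+1%:R * `|z| * (r ^+ k * 2^-1 ^+ k) * r
        = (`|z| * (r * r ^+ k)) * (k.+1%:R * 2^-1 ^+ k) by ring.
apply: ler_piMr; first by rewrite !mulr_ge0 ?exprn_ge0 ?(ltW r0).
by rewrite exprVn ler_pdivrMr ?mul1r ?succ_le_exp2 ?exprn_gt0.
Qed.

Lemma holo1_deriv f : holo1 f -> holo1 (fps_deriv f).
Proof.
move=> [r [M [r0 fM]]]; exists (r / 2), (M / r); rewrite divr_gt0 //.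
by split=> // k; apply: deriv_bound.
Qed.

Lemma holo2_derivx h : holo2 h -> holo2 (derivx h).
Proof.
move=> [r [M [r0 hM]]]; exists (r / 2), (M / r); rewrite divr_gt0 //.
split=> // i j; rewrite exprD mulrA.
have rj : 0 < r ^+ j by rewrite exprn_gt0.
apply: (@le_trans _ _ (`|derivx h i j| * (r / 2) ^+ i * r ^+ j)).
  apply: ler_wpM2l; first by rewrite mulr_ge0 ?exprn_ge0 ?divr_ge0 ?(ltW r0).
  apply: lerXn2r; rewrite ?nnegrE ?divr_ge0 ?(ltW r0) //.
  by rewrite ler_pdivrMr // ler_peMr ?(ltW r0) // ler1n.
rewrite -ler_pdivlMr // mulrAC; apply: deriv_bound => //.
by rewrite ler_pdivlMr // -mulrA -exprD.
Qed.

Definition swap h : ser2 := fun i j => h j i.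

Lemma holo2_swap h : holo2 h -> holo2 (swap h).
Proof.
by move=> [r [M [r0 hM]]]; exists r, M; split=> // i j; rewrite addnC; apply: hM.
Qed.

Lemma holo2_derivy h : holo2 h -> holo2 (derivy h).
Proof. by move=> /holo2_swap/holo2_derivx/holo2_swap. Qed.

Lemma holo2_mono (c : C) a b : holo2 (mono c a b).
Proof.
exists 1, `|c|; split=> // i j; rewrite expr1n mulr1 monoE.
by case: ifP => _ //; rewrite normr0.
Qed.

Lemma holo1_single (c : C) a : holo1 (single a c).
Proof.
exists 1, `|c|; split=> // i; rewrite expr1n mulr1 /single.
by case: ifP => _ //; rewrite normr0.
Qed.

Definition in_y (f : ser1) : ser2 := single 0 f.

Lemma holo2_in_y f : holo1 f -> holo2 (in_y f).
Proof.
move=> [r [M [r0 fM]]]; exists r, M; split=> // i j; rewrite /in_y /single.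
case: eqP => [->|_]; first by rewrite add0n.
by rewrite fps0E normr0 mul0r; apply: le_trans (fM 0%N); rewrite mulr_ge0 ?exprn_ge0 ?(ltW r0).
Qed.

Lemma fps_mul0 f g : f * g = 0 -> f = 0 \/ g = 0.
Proof.
by apply: fps_mul_eq0 => a b /eqP; rewrite mulf_eq0 => /orP[] /eqP; [left|right].
Qed.

Lemma fps2_mul0 h k : h * k = 0 -> h = 0 \/ k = 0.
Proof. by apply: fps_mul_eq0; apply: fps_mul0. Qed.

(** A quotient of convergent series that exists formally is convergent: its
    coefficients satisfy a linear recursion with geometric data. *)
Lemma holo1_quotient f g q : holo1 f -> holo1 g -> f != 0 -> f * q = g -> holo1 q.
Proof.
move=> /holo1P cf /holo1P cg f0 fq; have [e fe fe0] := fps_ord f0.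
have [s [B [s0 B0 fB gB]]] := conv_common (nrm1_family _) cf cg.
have s1 := ltW s0; have n0 := normr_seminorm C.
have bd z : (forall N, nrm1 s N z <= B) -> forall k, `|z k| * s ^+ k <= B.
  by move=> zB k; apply: le_trans (zB k.+1); apply: nrm_coef.
pose d := `|f e| * s ^+ e.
have d0 : 0 < d by rewrite mulr_gt0 ?normr_gt0 ?exprn_gt0.
have D0 : 0 <= B / d by rewrite divr_ge0 // ltW.
pose y k := `|q k| * s ^+ k.
have yD k : y k <= B / d * (1 + \sum_(j < k) y j).
  rewrite mulrAC ler_pdivlMr // mulrDr mulr1 mulr_sumr.
  have E : f e * q k = g (k + e)%N - \sum_(j < k) f (k + e - j)%N * q j.
    apply/eqP; rewrite -subr_eq0 opprB addrA subr_eq0 -fq mulrC [f * q]mulrC fpsME.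
    rewrite -addSn big_split_ord /= big_ord_recr /= addKn addrC.
    rewrite [X in _ == _ + X]big1 ?addr0 => [|j _]; last first.
      by rewrite fe ?mulr0 //; have := ltn_ord j; lia.
    rewrite eq_sym [X in _ == X]addrC mulrC addrC; apply/eqP; congr (_ + _).
    by apply: eq_bigr => j _; rewrite mulrC.
  have -> : y k * d = `|f e * q k| * s ^+ (k + e).
    by rewrite /y /d normrM exprD; ring.
  rewrite E; apply: le_trans (ler_wpM2r (exprn_ge0 _ s1) (ler_normB _ _)) _.
  rewrite mulrDl; apply: lerD; first exact: bd.
  apply: le_trans (ler_wpM2r (exprn_ge0 _ s1) (ler_norm_sum _ _ _)) _.
  rewrite mulr_suml; apply: ler_sum => j _.
  have -> : `|f (k + e - j)%N * q j| * s ^+ (k + e)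
     = `|f (k + e - j)%N| * s ^+ (k + e - j) * y j.
    have -> : s ^+ (k + e) = s ^+ (k + e - j) * s ^+ j.
      by rewrite -exprD subnK //; have := ltn_ord j; lia.
    by rewrite /y normrM; ring.
  by apply: ler_wpM2r; [rewrite mulr_ge0 ?exprn_ge0|apply: bd].
have D1 : 0 < 1 + B / d by rewrite ltr_pwDl.
exists (s / (1 + B / d)), (B / d); split; first by rewrite divr_gt0.
move=> k; rewrite expr_div_n mulrA ler_pdivrMr ?exprn_gt0 //.
exact: (gronwall D0 yD).
Qed.

(** The same in two variables, for a divisor that is not a multiple of [x]:
    dividing out the unit part of its restriction to [x = 0] reduces to a
    recursion on the power of [x]. *)
Lemma holo2_quotient (f g q : ser2) :
  holo2 f -> holo2 g -> f 0%N != 0 -> f * q = g -> holo2 q.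
Proof.
move=> hf hg f0 fq; have [e fe fe0] := fps_ord f0.
have f0h : holo1 (f 0%N).
  by have [r [M [r0 fM]]] := hf; exists r, M; split=> // k; apply: (fM 0%N k).
pose u : ser1 := fun k => f 0%N (k + e)%N.
have fu : f 0%N = single e 1 * u.
  apply: funext => k; rewrite singleME mul1r; case: leqP => ek; last by rewrite fe.
  by rewrite /u subnK.
have hu : holo1 u.
  by apply: (holo1_quotient (holo1_single 1 e) f0h _ (esym fu));
     apply: contra fe0 => /eqP z; rewrite fu z mul0r.
have [v uv] : exists v, u * v = 1.
  by apply: (fps_inv (c := (u 0%N)^-1)); rewrite mulfV //= /u add0n.
have hv : holo1 v.
  apply: (holo1_quotient hu (holo1_single 1 0)); last by rewrite uv single0_1.
  by apply/eqP => z; move: uv; rewrite z mul0r => /esym/eqP; rewrite oner_eq0.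
have [s [B [s0 B0 fB gB]]] := conv_common (nrm2_family _)
  (convM (nrm2_family _) (proj1 (holo2P _) (holo2_in_y hv)) (proj1 (holo2P _) hf))
  (convM (nrm2_family _) (proj1 (holo2P _) (holo2_in_y hv)) (proj1 (holo2P _) hg)).
set f' := in_y v * f in fB; set g' := in_y v * g in gB.
have fq' : f' * q = g' by rewrite /f' -mulrA fq.
have f'0 : f' 0%N = single e 1.
  by rewrite /f' singleME /= subn0 fu mulrCA [v * u]mulrC uv mulr1.
have s1 := ltW s0; have n1 N := nrm1_seminorm N s1.
have bd z : (forall N, nrm2 s N z <= B) -> forall i N, nrm1 s N (z i) * s ^+ i <= B.
  move=> zB i N; apply: le_trans (zB (N + i).+1).
  apply: le_trans (nrm_coef (n1 _) _ s1 (_ : i < _)%N); last by lia.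
  apply: ler_wpM2r; first exact: exprn_ge0.
  by apply: (nrm_leN (normr_seminorm C)) => //; lia.
have shift w N : nrm1 s N w * s ^+ e <= nrm1 s (N + e) (single e 1 * w).
  rewrite [leRHS]/nrm1 /nrm addnC big_split_ord /=; apply: ler_wpDl.
    by apply: sumr_ge0 => k _; rewrite mulr_ge0 ?exprn_ge0.
  rewrite /nrm1 /nrm mulr_suml; apply: ler_sum => k _.
  by rewrite singleME leq_addr mul1r addKn -mulrA -exprD addnC.
pose D := B / s ^+ e; have se : 0 < s ^+ e by rewrite exprn_gt0.
have D0 : 0 <= D by rewrite divr_ge0 // ltW.
have key i N : nrm1 s N (q i) * s ^+ i <= D * (1 + D) ^+ i.
  elim/ltn_ind: i N => i IH N.
  have E : single e 1 * q i = g' i - \sum_(j < i) f' (i - j)%N * q j.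
    apply/eqP; rewrite -subr_eq0 opprB addrA subr_eq0 -fq' mulrC [f' * q]mulrC fpsME.
    rewrite big_ord_recr /= subnn f'0 addrC; apply/eqP; congr (_ + _).
    by apply: eq_bigr => j _; rewrite mulrC.
  have G : 1 + \sum_(j < i) D * (1 + D) ^+ j <= (1 + D) ^+ i.
    elim: (i) => [|k IHk]; first by rewrite big_ord0 addr0.
    by rewrite big_ord_recr /= addrA exprS mulrDl mul1r lerD2r.
  apply: le_trans (ler_wpM2l D0 G); rewrite /D [leRHS]mulrAC ler_pdivlMr //.
  rewrite mulrAC; apply: le_trans (ler_wpM2r (exprn_ge0 _ s1) (shift _ _)) _.
  rewrite E; have [z0 zge zD zM] := n1 (N + e)%N.
  have zN w : nrm1 s (N + e) (- w) = nrm1 s (N + e) w.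
    by apply: eq_bigr => k _; rewrite fpsNE normrN.
  apply: le_trans (ler_wpM2r (exprn_ge0 _ s1) (zD _ _)) _.
  rewrite zN mulrDl mulrDr mulr1; apply: lerD; first exact: bd.
  apply: le_trans (ler_wpM2r (exprn_ge0 _ s1) (seminorm_sum _ _ _ (n1 _))) _.
  rewrite mulr_suml mulr_sumr; apply: ler_sum => j _.
  apply: le_trans (ler_wpM2r (exprn_ge0 _ s1) (zM _ _)) _.
  have -> : nrm1 s (N + e) (f' (i - j)%N) * nrm1 s (N + e) (q j) * s ^+ i
     = (nrm1 s (N + e) (f' (i - j)%N) * s ^+ (i - j))
       * (nrm1 s (N + e) (q j) * s ^+ j).
    have -> : s ^+ i = s ^+ (i - j) * s ^+ j by rewrite -exprD subnK // ltnW.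
    by ring.
  by apply: ler_pM; rewrite ?mulr_ge0 ?exprn_ge0 //; [apply: bd|apply: IH].
have D1 : 0 < 1 + D by rewrite ltr_pwDl.
have D1' : 1 <= 1 + D by rewrite lerDl.
exists (s / (1 + D)), D; split; first by rewrite divr_gt0.
move=> i j; rewrite expr_div_n mulrA ler_pdivrMr ?exprn_gt0 //.
apply: (@le_trans _ _ (D * (1 + D) ^+ i)).
  apply: le_trans (key i j.+1); rewrite addnC exprD mulrA.
  apply: ler_wpM2r; first exact: exprn_ge0.
  exact: (nrm_coef (normr_seminorm C)).
by rewrite exprD; apply: ler_wpM2l => //; rewrite ler_peMr ?exprn_ge0 ?exprn_ege1 // ltW.
Qed.

Lemma holo2_inv h : holo2 h -> h 0%N 0%N != 0 -> exists2 k, holo2 k & h * k = 1.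
Proof.
move=> hh h0; have [v hv] : exists v, h 0%N * v = 1.
  by apply: (fps_inv (c := (h 0%N 0%N)^-1)); rewrite mulfV.
have [k hk] := fps_inv hv; exists k => //.
apply: (holo2_quotient hh (holo2_mono 1 0 0)); last by rewrite hk mono1.
by apply: contra h0 => /eqP ->.
Qed.

End Holomorphy.

(** * Changes of coordinates *)

Section Coordinates.
Variable R : realType.
Local Notation C := R[i].
Local Notation ser1 := (fps C).
Local Notation ser2 := (fps (fps C)).
Implicit Types (Phi : coords R) (g : param R) (w : form1 R) (h : ser2).

Lemma form_eq w w' : w.1 = w'.1 -> w.2 = w'.2 -> w = w'.
Proof. by case: w w' => [a b] [a' b'] /= -> ->. Qed.

Lemma form1D w w' : (w + w').1 = w.1 + w'.1. Proof. by []. Qed.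
Lemma form2D w w' : (w + w').2 = w.2 + w'.2. Proof. by []. Qed.
Lemma form1N w : (- w).1 = - w.1. Proof. by []. Qed.
Lemma form2N w : (- w).2 = - w.2. Proof. by []. Qed.
Definition formE := (form1D, form2D, form1N, form2N).

Lemma nat_minP (A : set nat) k :
  nat_min A = Some k <-> A k /\ forall j, A j -> (k <= j)%N.
Proof.
rewrite /nat_min; split=> [|[Ak kA]].
  by case: xgetP => // o -> [k' -> [Ak' k'A]] [<-].
case: xgetP => [o -> [k' -> [Ak' k'A]]|/(_ (Some k)) []]; last by exists k.
by congr Some; apply/eqP; rewrite eqn_leq kA // k'A.
Qed.

Lemma nat_maxP (A : set nat) k :
  nat_max A = Some k <-> A k /\ forall j, A j -> (j <= k)%N.
Proof.
rewrite /nat_max; split=> [|[Ak kA]].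
  by case: xgetP => // o -> [k' -> [Ak' k'A]] [<-].
case: xgetP => [o -> [k' -> [Ak' k'A]]|/(_ (Some k)) []]; last by exists k.
by congr Some; apply/eqP; rewrite eqn_leq kA // k'A.
Qed.

Lemma ord1_Some (a : ser1) k : Defs.ord1 a = Some k <-> fps_ge k a /\ a k != 0.
Proof.
rewrite /Defs.ord1 nat_minP /=; split=> [[a0 ak]|[ak a0]]; split=> // j.
  move=> jk; apply/eqP; apply: contraTT jk => aj; rewrite -leqNgt; exact: ak.
by move=> aj; rewrite leqNgt; apply/negP => jk; move: aj; rewrite ak ?eqxx.
Qed.

Lemma ord1_None (a : ser1) : Defs.ord1 a = None <-> a = 0.
Proof.
split=> [E|->]; last first.
  case E: (Defs.ord1 _) => [k|] //; have [_] := proj1 (ord1_Some _ _) E.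
  by rewrite fps0E eqxx.
apply: contrapT => /eqP /fps_ord [k ak k0].
by have := proj2 (ord1_Some a k) (conj ak k0); rewrite E.
Qed.

Lemma Omega_CE g w : Omega_C g w <-> holo_form w /\ pull_param g w = 0.
Proof.
rewrite /Omega_C /nu_C /=; split=> -[hw w0]; split=> //.
  by apply/ord1_None; case: (Defs.ord1 _) w0.
by move/ord1_None: w0 => ->.
Qed.

Definition coords_sym Phi : coords R :=
  let: Coords u v p q H Z J J' := Phi in
  let: And4 hu hv hp hq := H in
  let: And4 u0 v0 p0 q0 := Z in
  Coords (And4 hp hq hu hv) (And4 p0 q0 u0 v0) J' J.

Lemma coords_symE Phi :
  [/\ cu (coords_sym Phi) = cp Phi, cv (coords_sym Phi) = cq Phi,
      cp (coords_sym Phi) = cu Phi & cq (coords_sym Phi) = cv Phi].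
Proof. by case: Phi => u v p q [? ? ? ?] [? ? ? ?] I I'. Qed.

Lemma form_in_holo Phi w : holo_form w -> holo_form (form_in Phi w).
Proof.
move=> [h1 h2]; have [hu hv hp hq] := coords_holo Phi.
have [u0 v0 p0 q0] := coords_origin Phi.
have c1 := holo2_comp p0 q0 h1 hp hq; have c2 := holo2_comp p0 q0 h2 hp hq.
by split; apply: holo2D; apply: holo2M => //;
  apply: holo2_derivx || apply: holo2_derivy.
Qed.

Lemma form_inD Phi w w' : form_in Phi (w + w') = form_in Phi w + form_in Phi w'.
Proof.
have [u0 v0 p0 q0] := coords_origin Phi.
by apply: form_eq; rewrite formE /form_in /= !(comp2D p0 q0); ring.
Qed.

Lemma form_in_scale Phi h w :
  form_in Phi (form_scale h w) = form_scale (comp2 h (cp Phi) (cq Phi)) (form_in Phi w).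
Proof.
have [u0 v0 p0 q0] := coords_origin Phi.
by apply: form_eq; rewrite /form_in /form_scale /= !(comp2M p0 q0); ring.
Qed.

(** The pull-backs of [dx] and [dy] under a change of coordinates and back are
    [dx] and [dy], by the chain rule applied to the identity. *)
Lemma form_in_sym Phi w : form_in (coords_sym Phi) (form_in Phi w) = w.
Proof.
have [eu ev ep eq] := coords_symE Phi.
have [u0 v0 p0 q0] := coords_origin Phi; have [Ip Iq] := coords_inv' Phi.
have back h : comp2 (comp2 h (cp Phi) (cq Phi)) (cu Phi) (cv Phi) = h.
  by rewrite (comp2_comp2 u0 v0) // Ip Iq comp2_id.
have dxp := comp2_derivx u0 v0 (cp Phi); have dyp := comp2_derivy u0 v0 (cp Phi).
have dxq := comp2_derivx u0 v0 (cq Phi); have dyq := comp2_derivy u0 v0 (cq Phi).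
have s0 a b : mono (0 : C) a b = 0.
  by apply: funext => i; apply: funext => j; rewrite monoE if_same.
rewrite Ip varx_mono derivx_mono mono1 in dxp.
rewrite Ip varx_mono derivy_mono mulr0n s0 in dyp.
rewrite Iq vary_mono derivx_mono mulr0n s0 in dxq.
rewrite Iq vary_mono derivy_mono mono1 in dyq.
apply: form_eq; rewrite /form_in ep eq /= !(comp2D u0 v0) !(comp2M u0 v0) !back.
  transitivity (w.1 * (comp2 (derivx (cp Phi)) (cu Phi) (cv Phi) * derivx (cu Phi) +
    comp2 (derivy (cp Phi)) (cu Phi) (cv Phi) * derivx (cv Phi)) +
    w.2 * (comp2 (derivx (cq Phi)) (cu Phi) (cv Phi) * derivx (cu Phi) +
    comp2 (derivy (cq Phi)) (cu Phi) (cv Phi) * derivx (cv Phi))); first by ring.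
  by rewrite -dxp -dxq mulr1 mulr0 addr0.
transitivity (w.1 * (comp2 (derivx (cp Phi)) (cu Phi) (cv Phi) * derivy (cu Phi) +
    comp2 (derivy (cp Phi)) (cu Phi) (cv Phi) * derivy (cv Phi)) +
    w.2 * (comp2 (derivx (cq Phi)) (cu Phi) (cv Phi) * derivy (cu Phi) +
    comp2 (derivy (cq Phi)) (cu Phi) (cv Phi) * derivy (cv Phi))); first by ring.
by rewrite -dyp -dyq mulr1 mulr0 add0r.
Qed.

Lemma coords_symK Phi w : form_in Phi (form_in (coords_sym Phi) w) = w.
Proof.
have [eu ev ep eq] := coords_symE Phi.
have [eu' ev' ep' eq'] := coords_symE (coords_sym Phi).
rewrite -[RHS](form_in_sym (coords_sym Phi)) /form_in.
by rewrite ep' eq' eu ev.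
Qed.

Definition push Phi g : param R :=
  (comp21 (cu Phi) g.1 g.2, comp21 (cv Phi) g.1 g.2).

Definition through_origin g := g.1 0%N = 0 /\ g.2 0%N = 0.

Lemma push_origin Phi g : through_origin g -> through_origin (push Phi g).
Proof.
move=> [g1 g2]; have [u0 v0 p0 q0] := coords_origin Phi.
by split; rewrite /push /= comp21_const.
Qed.

Lemma comp21_push Phi g h : through_origin g ->
  comp21 (comp2 h (cp Phi) (cq Phi)) (push Phi g).1 (push Phi g).2 = comp21 h g.1 g.2.
Proof.
move=> gO; have [g1 g2] := gO; have [P1 P2] := push_origin Phi gO.
have [u0 v0 p0 q0] := coords_origin Phi; have [Ip Iq] := coords_inv' Phi.
rewrite (comp21_comp2 p0 q0 _ P1 P2) /push /=.
rewrite -(comp21_comp2 u0 v0 (cp Phi) g1 g2) -(comp21_comp2 u0 v0 (cq Phi) g1 g2).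
by rewrite Ip Iq (comp21_varx g1 g2) (comp21_vary g1 g2).
Qed.

Lemma push_sym Phi g : through_origin g -> push (coords_sym Phi) (push Phi g) = g.
Proof.
move=> gO; have [g1 g2] := gO; have [eu ev ep eq] := coords_symE Phi.
have [u0 v0 p0 q0] := coords_origin Phi; have [Ip Iq] := coords_inv' Phi.
rewrite /push eu ev /= -(comp21_comp2 u0 v0 (cp Phi) g1 g2).
rewrite -(comp21_comp2 u0 v0 (cq Phi) g1 g2) Ip Iq (comp21_varx g1 g2) (comp21_vary g1 g2).
by case: (g).
Qed.

Lemma pull_push Phi g w : through_origin g ->
  pull_param (push Phi g) (form_in Phi w) = pull_param g w.
Proof.
move=> gO; have [g1 g2] := gO; have [P1 P2] := push_origin Phi gO.
have [u0 v0 p0 q0] := coords_origin Phi; have [Ip Iq] := coords_inv' Phi.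
have E1 := comp21_deriv P1 P2 (cp Phi); have E2 := comp21_deriv P1 P2 (cq Phi).
have G := push_sym Phi gO; have [eu ev ep eq] := coords_symE Phi.
rewrite {1}/push eu ev in G; have G1 := congr1 (@fst _ _) G.
have G2 := congr1 (@snd _ _) G; rewrite /= in G1 G2.
rewrite G1 in E1; rewrite G2 in E2.
rewrite [in RHS]/pull_param E1 E2 /pull_param /form_in.
move: (push Phi g) P1 P2 {E1 E2 G G1 G2} (comp21_push Phi w.1 gO)
  (comp21_push Phi w.2 gO) => f P1 P2 <- <-.
rewrite !(comp21D P1 P2) !(comp21M P1 P2).
do 2!move: (comp21 (comp2 _ _ _) _ _) => ?.
do 2!move: (comp21 (derivx _) _ _) => ?; do 2!move: (comp21 (derivy _) _ _) => ?.
do 2!move: (fps_deriv _) => ?; ring.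
Qed.

Lemma Omega_push Phi g w : through_origin g -> Omega_C g w ->
  Omega_C (push Phi g) (form_in Phi w).
Proof.
move=> gO /Omega_CE [hw w0]; apply/Omega_CE; split; first exact: form_in_holo.
by rewrite pull_push.
Qed.

(** The pull-back by a change of coordinates is bijective and semilinear over a
    ring isomorphism, hence preserves bases; this is what allows to work in
    adapted coordinates only. *)
Lemma saito_push Phi g w1 w2 : through_origin g -> saito_basis g w1 w2 ->
  saito_basis (push Phi g) (form_in Phi w1) (form_in Phi w2).
Proof.
move=> gO [O1 O2 gen free]; have PO := push_origin Phi gO.
have [eu ev ep eq] := coords_symE Phi.
have [hu hv hp hq] := coords_holo Phi; have [u0 v0 p0 q0] := coords_origin Phi.
have [Ip Iq] := coords_inv Phi.
split; [exact: Omega_push|exact: Omega_push| |].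
  move=> w /(Omega_push (coords_sym Phi) PO); rewrite push_sym // => /gen.
  move=> [h1 [h2 [hh1 hh2 E]]].
  exists (comp2 h1 (cp Phi) (cq Phi)), (comp2 h2 (cp Phi) (cq Phi)).
  split; [exact: holo2_comp|exact: holo2_comp|].
  by rewrite -!form_in_scale -form_inD -E coords_symK.
move=> h1 h2 hh1 hh2 /(congr1 (form_in (coords_sym Phi))).
rewrite form_inD !form_in_scale !form_in_sym ep eq.
have -> : form_in (coords_sym Phi) 0 = 0.
  by apply: (addrI (form_in (coords_sym Phi) 0)); rewrite -form_inD !addr0.
move=> /free [||z1 z2]; [exact: holo2_comp|exact: holo2_comp|].
have back h : comp2 (comp2 h (cu Phi) (cv Phi)) (cp Phi) (cq Phi) = h.
  by rewrite (comp2_comp2 p0 q0) // Ip Iq comp2_id.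
by rewrite -(back h1) -(back h2) z1 z2 (comp2_0 p0 q0).
Qed.

End Coordinates.

(** * Existence of a Saito basis *)

Lemma nat_least (P : nat -> Prop) :
  (exists k, P k) -> exists k, P k /\ forall j, P j -> (k <= j)%N.
Proof.
move=> [k Pk]; apply: contrapT => nP.
suff: forall j, ~ P j by move/(_ k).
elim/ltn_ind => j IH Pj; apply: nP; exists j; split=> // i Pi.
by rewrite leqNgt; apply/negP => /IH.
Qed.

Section SaitoExistence.
Variable R : realType.
Local Notation C := R[i].
Local Notation ser1 := (fps C).
Local Notation ser2 := (fps (fps C)).
Implicit Types (w : form1 R) (h : ser2) (f : ser1).

Lemma pullB (g : param R) w w' : through_origin g ->
  pull_param g (w - w') = pull_param g w - pull_param g w'.
Proof.
move=> [g1 g2]; rewrite /pull_param !formE !(comp21B g1 g2).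
do 4!move: (comp21 _ _ _) => ?; do 2!move: (fps_deriv _) => ?; ring.
Qed.

Lemma pullZ (g : param R) h w : through_origin g ->
  pull_param g (form_scale h w) = comp21 h g.1 g.2 * pull_param g w.
Proof.
move=> [g1 g2]; rewrite /pull_param /form_scale /= !(comp21M g1 g2).
do 3!move: (comp21 _ _ _) => ?; do 2!move: (fps_deriv _) => ?; ring.
Qed.

Lemma pullD (g : param R) w w' : through_origin g ->
  pull_param g (w + w') = pull_param g w + pull_param g w'.
Proof.
move=> [g1 g2]; rewrite /pull_param !formE !(comp21D g1 g2).
do 4!move: (comp21 _ _ _) => ?; do 2!move: (fps_deriv _) => ?; ring.
Qed.

Lemma holo_formB w w' : holo_form w -> holo_form w' -> holo_form (w - w').
Proof. by move=> [? ?] [? ?]; split; apply: holo2B. Qed.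

Lemma holo_formD w w' : holo_form w -> holo_form w' -> holo_form (w + w').
Proof. by move=> [? ?] [? ?]; split; apply: holo2D. Qed.

Lemma holo_formZ h w : holo2 h -> holo_form w -> holo_form (form_scale h w).
Proof. by move=> ? [? ?]; split; apply: holo2M. Qed.

Definition shiftx (e : nat) h : ser2 := fun i => h (i + e)%N.

Lemma shiftxE e h : (forall i, (i < e)%N -> h i = 0) -> h = mono 1 e 0 * shiftx e h.
Proof.
move=> h0; apply: funext => i; apply: funext => j.
rewrite mono_mulE mul1r subn0 /= andbT /shiftx; case: leqP => ei; last by rewrite h0.
by rewrite subnK.
Qed.

Lemma holo2_shiftx e h : holo2 h -> holo2 (shiftx e h).
Proof.
move=> [r [M [r0 hM]]]; exists r, (M / r ^+ e); split=> // i j.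
by rewrite ler_pdivlMr ?exprn_gt0 // -mulrA -exprD addnAC; apply: hM.
Qed.

(** Over a field the order decides divisibility: up to units every series is a
    power of the variable. *)
Lemma fps_divides (f g : ser1) e :
  fps_ge e f -> f e != 0 -> fps_ge e g -> exists q, f * q = g.
Proof.
move=> fe fe0 ge; pose u : ser1 := fun k => f (k + e)%N.
have fu : f = single e 1 * u.
  apply: funext => k; rewrite singleME mul1r; case: leqP => ek; last by rewrite fe.
  by rewrite /u subnK.
have [v uv] : exists v, u * v = 1.
  by apply: (fps_inv (c := (u 0%N)^-1)); rewrite mulfV //= /u add0n.
exists (v * (fun k => g (k + e)%N)); rewrite mulrA fu -[_ * v]mulrA uv mulr1.
apply: funext => k; rewrite singleME mul1r; case: leqP => ek; last by rewrite ge.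
by rewrite subnK.
Qed.

Definition wedge w w' : ser2 := w.1 * w'.2 - w.2 * w'.1.

Variable g : param R.
Hypotheses (gO : through_origin g) (g1_neq0 : g.1 != 0).

Lemma OmegaB w w' : Omega_C g w -> Omega_C g w' -> Omega_C g (w - w').
Proof.
move=> /Omega_CE [hw w0] /Omega_CE [hw' w'0]; apply/Omega_CE.
by split; [apply: holo_formB|rewrite pullB // w0 w'0 subrr].
Qed.

Lemma OmegaZ h w : holo2 h -> Omega_C g w -> Omega_C g (form_scale h w).
Proof.
move=> hh /Omega_CE [hw w0]; apply/Omega_CE.
by split; [apply: holo_formZ|rewrite pullZ // w0 mulr0].
Qed.

(** [Omega_C] is saturated with respect to [x], since [x] does not vanish on
    the curve. *)
Lemma Omega_divx w : Omega_C g w -> w.1 0%N = 0 -> w.2 0%N = 0 ->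
  exists2 w', Omega_C g w' & w = form_scale (mono 1 1 0) w'.
Proof.
move=> /Omega_CE [[hw1 hw2] w0] w1 w2.
have low h : h 0%N = 0 -> forall i, (i < 1)%N -> h i = 0.
  by move=> h0 i; rewrite ltnS leqn0 => /eqP ->.
pose w' : form1 R := (shiftx 1 w.1, shiftx 1 w.2).
have E : w = form_scale (mono 1 1 0) w' by apply: form_eq; apply: shiftxE; exact: low.
exists w' => //; apply/Omega_CE; split; first by split; apply: holo2_shiftx.
move: w0; rewrite {1}E pullZ // => /fps_mul0 []// /eqP.
have [g1 g2] := gO; rewrite (comp21_mono g1 g2) single0_1 expr1 expr0 mul1r mulr1.
by move=> /eqP z; move: g1_neq0; rewrite z eqxx.
Qed.

Variable f : ser2.
Hypotheses (hf : holo2 f) (f_neq0 : f != 0) (fg0 : comp21 f g.1 g.2 = 0).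

(** Powers of [x] can be divided out of an equation, since [x] does not vanish
    on the curve. *)
Lemma equation_not_divx : exists h, [/\ holo2 h, h 0%N != 0 & comp21 h g.1 g.2 = 0].
Proof.
have [e fe fe0] := fps_ord f_neq0; exists (shiftx e f).
split=> //; first exact: holo2_shiftx.
have [g1 g2] := gO; move: fg0; rewrite {1}(shiftxE fe) (comp21M g1 g2) => /fps_mul0 []//.
rewrite (comp21_mono g1 g2) single0_1 expr0 mul1r mulr1 => z.
exfalso; suff: forall k, g.1 ^+ k = 0 -> False by move/(_ e z).
elim=> [/eqP|k IH]; first by rewrite expr0 oner_eq0.
rewrite exprS => /fps_mul0 [/eqP|/IH //]; by rewrite (negbTE g1_neq0).
Qed.

(** A basis of the restriction of [Omega_C] to [x = 0], a submodule of a free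
    module of rank two over the discrete valuation ring of series in [y]. *)
Lemma restricted_basis : exists t1 t2,
  [/\ Omega_C g t1, Omega_C g t2, wedge t1 t2 0%N != 0 &
      forall w, Omega_C g w -> exists h1 h2 : ser1,
        [/\ holo1 h1, holo1 h2 & exists2 w', Omega_C g w' &
          w = form_scale (in_y h1) t1 + form_scale (in_y h2) t2
              + form_scale (mono 1 1 0) w']].
Proof.
have [h [hh h0 hg0]] := equation_not_divx.
have [g1 g2] := gO.
have hol0 k : @holo2 R k -> holo1 (k 0%N).
  by move=> [r [M [r0 kM]]]; exists r, M; split=> // j; apply: (kM 0%N j).
have z2 : holo2 (0 : ser2).
  by exists 1, 0; split=> // i j; rewrite normr0 mul0r.
have Om1 : Omega_C g (h, 0).
  by apply/Omega_CE; split=> //; rewrite /pull_param /= hg0 (comp21_0 g1 g2) !mul0r addr0.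
have Om2 : Omega_C g (0, h).
  by apply/Omega_CE; split=> //; rewrite /pull_param /= hg0 (comp21_0 g1 g2) !mul0r addr0.
have [e [[t1 [Ot1 t1e t1e0]] emin]] : exists e,
    (exists w, [/\ Omega_C g w, fps_ge e (w.2 0%N) & w.2 0%N e != 0]) /\
    forall j, (exists w, [/\ Omega_C g w, fps_ge j (w.2 0%N) & w.2 0%N j != 0]) ->
      (e <= j)%N.
  by apply: nat_least; have [e ? ?] := fps_ord h0; exists e, (0, h).
have [d [[t2 [Ot2 t2y t2d t2d0]] dmin]] : exists d,
    (exists w, [/\ Omega_C g w, w.2 0%N = 0, fps_ge d (w.1 0%N) & w.1 0%N d != 0]) /\
    forall j, (exists w, [/\ Omega_C g w, w.2 0%N = 0, fps_ge j (w.1 0%N) &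
      w.1 0%N j != 0]) -> (d <= j)%N.
  by apply: nat_least; have [d ? ?] := fps_ord h0; exists d, (h, 0).
have in_yE q k : (in_y q * k) 0%N = q * k 0%N :> ser1 by rewrite /in_y singleME.
have neq k i : k i != 0 -> k != 0 :> ser1 by apply: contra => /eqP ->.
exists t1, t2; split=> //.
  apply/eqP; rewrite /wedge fpsBE !fpsME !big_ord_recl !big_ord0 /= !addr0 t2y mulr0 sub0r.
  move=> /eqP; rewrite oppr_eq0 => /eqP /fps_mul0 [] /eqP; apply/negP; [exact: neq t1e0|exact: neq t2d0].
move=> w Ow.
have [q1 q1E] : exists q, t1.2 0%N * q = w.2 0%N.
  apply: (fps_divides t1e t1e0); case: (eqVneq (w.2 0%N) 0) => [-> //|/fps_ord [j wj wj0]].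
  by apply: (fps_geW _ wj); apply: emin; exists w.
have hq1 : holo1 q1.
  case/Omega_CE: Ow => -[_ /hol0 hw] _; case/Omega_CE: Ot1 => -[_ /hol0 ht] _.
  exact: holo1_quotient ht hw (neq _ _ t1e0) q1E.
have [w1 w1E] : exists w1, w1 = w - form_scale (in_y q1) t1 by eexists.
have Ow1 : Omega_C g w1.
  by rewrite w1E; exact: (OmegaB Ow (OmegaZ (holo2_in_y hq1) Ot1)).
have w1y : w1.2 0%N = 0 by rewrite w1E !formE fpsDE fpsNE /= in_yE mulrC q1E subrr.
have [q2 q2E] : exists q, t2.1 0%N * q = w1.1 0%N.
  apply: (fps_divides t2d t2d0); case: (eqVneq (w1.1 0%N) 0) => [-> //|/fps_ord [j wj wj0]].
  by apply: (fps_geW _ wj); apply: dmin; exists w1.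
have hq2 : holo1 q2.
  case/Omega_CE: Ow1 => -[/hol0 hw _] _; case/Omega_CE: Ot2 => -[/hol0 ht _] _.
  exact: holo1_quotient ht hw (neq _ _ t2d0) q2E.
have [w2 w2E] : exists w2, w2 = w1 - form_scale (in_y q2) t2 by eexists.
have Ow2 : Omega_C g w2.
  by rewrite w2E; exact: (OmegaB Ow1 (OmegaZ (holo2_in_y hq2) Ot2)).
have [|| w' Ow' w'E] := Omega_divx Ow2.
- by rewrite w2E !formE fpsDE fpsNE /= in_yE mulrC q2E subrr.
- by rewrite w2E !formE fpsDE fpsNE /= in_yE t2y w1y mulr0 subrr.
exists q1, q2; split=> //; exists w' => //; rewrite -w'E w2E w1E.
by rewrite -addrA [X in _ + X]addrC subrK addrC subrK.
Qed.

Lemma wedge_free w1 w2 h1 h2 : wedge w1 w2 != 0 ->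
  form_scale h1 w1 + form_scale h2 w2 = 0 -> h1 = 0 /\ h2 = 0.
Proof.
move=> F0 E; have E1 := congr1 (@fst _ _) E; have E2 := congr1 (@snd _ _) E.
rewrite /= in E1 E2; split.
  have : h1 * wedge w1 w2 = 0.
    transitivity ((h1 * w1.1 + h2 * w2.1) * w2.2 - (h1 * w1.2 + h2 * w2.2) * w2.1).
      by rewrite /wedge; ring.
    by rewrite E1 E2 !mul0r subrr.
  by move=> /fps2_mul0 []// /eqP; rewrite (negbTE F0).
have : h2 * wedge w1 w2 = 0.
  transitivity ((h1 * w1.2 + h2 * w2.2) * w1.1 - (h1 * w1.1 + h2 * w2.1) * w1.2).
    by rewrite /wedge; ring.
  by rewrite E1 E2 !mul0r subrr.
by move=> /fps2_mul0 []// /eqP; rewrite (negbTE F0).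
Qed.

Lemma mono1x_mul h (i : nat) : (mono (1 : C) 1 0 * h) i.+1 = h i.
Proof. by apply: funext => j; rewrite mono_mulE /= subn0 subn1 mul1r. Qed.

(** A basis of the restriction to [x = 0] lifts to a basis: dividing the remainders
    by [x] over and over produces formal coordinates, and these are convergent
    because, by Cramer, they are quotients of convergent series by the
    determinant, which is not divisible by [x]. *)
Lemma saito_basis_exists : exists w1 w2, saito_basis g w1 w2.
Proof.
have [t1 [t2 [Ot1 Ot2 F0 step]]] := restricted_basis.
exists t1, t2; split=> // [w Ow|h1 h2 _ _]; last first.
  by apply: wedge_free; apply: contra F0 => /eqP ->.
have /choice [S SP] : forall w, exists s : ser1 * ser1 * form1 R, Omega_C g w ->
    Omega_C g s.2 /\ w = form_scale (in_y s.1.1) t1 + form_scale (in_y s.1.2) t2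
              + form_scale (mono 1 1 0) s.2.
  move=> w'; case: (pselect (Omega_C g w')) => [/step|nO]; last by exists (0, 0, 0).
  by move=> [h1 [h2 [_ _ [w'' Ow'' E]]]]; exists (h1, h2, w'') => _; split; [exact: Ow''|exact: E].
pose om k := iter k (fun w => (S w).2) w.
have Oom k : Omega_C g (om k).
  by elim: k => [|k IH]; [exact: Ow|exact: (proj1 (SP _ IH))].
have omE k := proj2 (SP _ (Oom k)).
pose H1 k : ser2 := fun i => (S (om (k + i)%N)).1.1.
pose H2 k : ser2 := fun i => (S (om (k + i)%N)).1.2.
pose d k := om k - (form_scale (H1 k) t1 + form_scale (H2 k) t2).
have HE (H : nat -> ser2) k : (forall i, H k i.+1 = H k.+1 i) ->
    H k = in_y (H k 0%N) + mono 1 1 0 * H k.+1.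
  move=> HS; apply: funext => -[|i].
    rewrite fpsDE /in_y /single /= [X in _ = _ + X](_ : _ = 0) ?addr0 //.
    by apply: funext => j; rewrite mono_mulE.
  by rewrite fpsDE mono1x_mul /in_y /single /= add0r.
have dE k : d k = form_scale (mono 1 1 0) (d k.+1).
  have E1 : H1 k = in_y (S (om k)).1.1 + mono 1 1 0 * H1 k.+1.
    by rewrite (HE H1) => [|i]; rewrite /H1 ?addn0 // addnS addSn.
  have E2 : H2 k = in_y (S (om k)).1.2 + mono 1 1 0 * H2 k.+1.
    by rewrite (HE H2) => [|i]; rewrite /H2 ?addn0 // addnS addSn.
  rewrite /d E1 E2 -[om k.+1]/(S (om k)).2.
  move: (S (om k)) (omE k) (H1 k.+1) (H2 k.+1) => [[a1 a2] v] -> b1 b2 /=.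
  by apply: form_eq; rewrite !formE /form_scale /=; ring.
have d0 k : d k = 0.
  by apply: form_eq; apply: funext => i; (elim: i k => [|i IH] k; rewrite dE;
    [apply: funext => j; exact: mono_mulE|exact: etrans (mono1x_mul _ _) (IH _)]).
have wE : w = form_scale (H1 0%N) t1 + form_scale (H2 0%N) t2.
  by apply/eqP; rewrite -subr_eq0; apply/eqP; exact: (d0 0%N).
exists (H1 0%N), (H2 0%N); case/Omega_CE: (Ow) => -[hw1 hw2] _.
case/Omega_CE: (Ot1) => -[ht11 ht12] _; case/Omega_CE: (Ot2) => -[ht21 ht22] _.
have hF : holo2 (wedge t1 t2) by apply: holo2B; apply: holo2M.
split=> //.
  apply: (holo2_quotient hF (_ : holo2 (wedge w t2)) F0).
    by apply: holo2B; apply: holo2M.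
  by rewrite wE /wedge formE /=; ring.
apply: (holo2_quotient hF (_ : holo2 (wedge t1 w)) F0).
  by apply: holo2B; apply: holo2M.
by rewrite wE /wedge formE /=; ring.
Qed.

(** A matrix of convergent series that is invertible at the origin has a
    convergent inverse, its determinant being a unit. *)
Lemma saito_change t1 t2 w1 w2 a b c d :
  saito_basis g t1 t2 -> Omega_C g w1 -> Omega_C g w2 ->
  [/\ holo2 a, holo2 b, holo2 c & holo2 d] ->
  w1 = form_scale a t1 + form_scale b t2 ->
  w2 = form_scale c t1 + form_scale d t2 ->
  (a * d - b * c) 0%N 0%N != 0 -> saito_basis g w1 w2.
Proof.
move=> [O1 O2 gen free] Ow1 Ow2 [ha hb hc hd] E1 E2 D0.
have hD : holo2 (a * d - b * c) by apply: holo2B; apply: holo2M.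
have [k hk kE] := holo2_inv hD D0.
have t1E : t1 = form_scale (k * d) w1 + form_scale (- (k * b)) w2.
  rewrite E1 E2; apply: form_eq; rewrite !formE /=.
    by rewrite -[LHS]mul1r -kE; ring.
  by rewrite -[LHS]mul1r -kE; ring.
have t2E : t2 = form_scale (- (k * c)) w1 + form_scale (k * a) w2.
  rewrite E1 E2; apply: form_eq; rewrite !formE /=.
    by rewrite -[LHS]mul1r -kE; ring.
  by rewrite -[LHS]mul1r -kE; ring.
split=> // [w Ow|h1 h2 hh1 hh2 E].
  have [p [q [hp hq wE]]] := gen w Ow.
  exists (p * (k * d) - q * (k * c)), (q * (k * a) - p * (k * b)).
  split; [by apply: holo2B; do 2!apply: holo2M => //|
          by apply: holo2B; do 2!apply: holo2M => //|].
  rewrite wE {1}t1E {1}t2E.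
  by apply: form_eq; rewrite !formE /=; ring.
have [|||z1 z2] := free (h1 * a + h2 * c) (h1 * b + h2 * d).
- by apply: holo2D; apply: holo2M.
- by apply: holo2D; apply: holo2M.
- by rewrite -[RHS]E E1 E2; apply: form_eq; rewrite !formE /=; ring.
split.
  rewrite -[LHS]mulr1 -kE.
  transitivity (k * ((h1 * a + h2 * c) * d - (h1 * b + h2 * d) * c)); first by ring.
  by rewrite z1 z2 !mul0r subrr mulr0.
rewrite -[LHS]mulr1 -kE.
transitivity (k * ((h1 * b + h2 * d) * a - (h1 * a + h2 * c) * b)); first by ring.
by rewrite z1 z2 !mul0r subrr mulr0.
Qed.

End SaitoExistence.

(** * Arithmetic of the semimodule *)

Section Numbers.
Local Open Scope nat_scope.
Variables n m : nat.
Hypotheses (n2 : 2 <= n) (nm : n < m) (cop : coprime n m).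
Implicit Types (k p q : nat) (L : nat -> Prop).

Lemma residue k : exists2 j, j < n & m * j = k %[mod n].
Proof.
have m0 : 0 < m by lia.
have [v u vE _] := egcdnP n m0.
have g1 : gcdn m n = 1 by rewrite gcdnC; apply/eqP.
rewrite g1 in vE.
(* [v m = 1 + u n], so that [v] inverts [m] modulo [n] *)
exists ((v * k) %% n); first by rewrite ltn_mod; lia.
by rewrite modnMmr mulnA [m * v]mulnC vE mulnDl mul1n mulnAC modnMDl.
Qed.

Lemma gauss x y : n * x = m * y -> n %| y /\ m %| x.
Proof.
move=> E; split.
  by rewrite -(Gauss_dvdr y cop) -E dvdn_mulr.
have cop' : coprime m n by rewrite coprime_sym.
by rewrite -(Gauss_dvdr x cop') E dvdn_mulr.
Qed.

Lemma weight_uniq a b a' b' : n * a + m * b < n * m ->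
  n * a + m * b = n * a' + m * b' -> a = a' /\ b = b'.
Proof.
move=> lt E.
have [bb'|b'b] := leqP b b'.
  have [x xE] : exists x, n * x = m * (b' - b) by exists (a - a'); nia.
  have [/dvdnP [c cE] _] := gauss xE.
  by case: c cE => [|c] cE; nia.
have [x xE] : exists x, n * x = m * (b - b') by exists (a' - a); nia.
have [/dvdnP [c cE] _] := gauss xE.
by case: c cE => [|c] cE; nia.
Qed.

(** Compare [k] with the multiple [m j], [j < n], that is congruent to it modulo
    [n]. *)
Lemma gap_or_semigroup k :
  semigroup n m k \/ exists p q, [/\ 0 < p, 0 < q & k + n * p + m * q = n * m].
Proof.
have [j jn jE] := residue k; have [jk|kj] := leqP (m * j) k.
  left; have /dvdnP [a aE] : n %| k - m * j by rewrite -eqn_mod_dvd ?jE.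
  by exists a, j; nia.
right; have /dvdnP [a aE] : n %| m * j - k by rewrite -eqn_mod_dvd ?jE // ltnW.
by exists a, (n - j); split; nia.
Qed.

Lemma gap_semigroup k p q : 0 < p -> 0 < q -> k + n * p + m * q = n * m ->
  ~ semigroup n m k.
Proof.
move=> p0 q0 E [a [b kE]].
have [x xE] : exists x, n * x = m * (b + q) by exists (m - a - p); nia.
have [/dvdnP [c cE] _] := gauss xE.
by case: c cE => [|c] cE; nia.
Qed.

Definition add_gen L lam : nat -> Prop :=
  fun k => L k \/ exists2 c, semigroup n m c & k = lam + c.

(** Beyond [u] the complement of [L] is a single quadrant, with corner [U]. *)
Definition corner L u U :=
  (forall k p q, 0 < p -> 0 < q -> k + n * p + m * q = U -> ~ L k) /\
  (forall k, ~ L k -> u < k ->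
     exists p q, [/\ 0 < p, 0 < q & k + n * p + m * q = U]).

(** Being above [u], a new generator lies in the quadrant below [U], whose corner
    it splits into two, the lower of which becomes the new bound: this is where
    the axes of the next critical values come from. *)
Lemma corner_add L u U lam : corner L u U -> U <= n * m -> ~ L lam -> u < lam ->
  exists p q, [/\ 0 < p, 0 < q, lam + n * p + m * q = U &
    [/\ L (lam + n * p), forall l, 0 < l -> L (lam + n * l) -> p <= l,
        L (lam + m * q), forall l, 0 < l -> L (lam + m * l) -> q <= l &
        n * p <> m * q /\
        corner (add_gen L lam) (lam + minn (n * p) (m * q))
                               (lam + maxn (n * p) (m * q))]].
Proof.
move=> [Za Zb] Unm nL ulam; have [p [q [p0 q0 E]]] := Zb _ nL ulam.
exists p, q; split=> //.
have big x y : 0 < y -> n * x = m * y -> n * m <= n * x.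
  move=> y0 xE; have [/dvdnP [c cE] _] := gauss xE.
  by case: c cE => [|c] cE; nia.
split.
- apply: contrapT => /Zb [|p' [q' [p'0 q'0 E']]]; first by lia.
  by have := big p' (q - q'); nia.
- move=> l l0 Ll; rewrite leqNgt; apply/negP => lp; apply: (Za _ (p - l) q _ _ _ Ll); nia.
- apply: contrapT => /Zb [|p' [q' [p'0 q'0 E']]]; first by lia.
  by have := big (p - p') q'; nia.
- move=> l l0 Ll; rewrite leqNgt; apply/negP => lq; apply: (Za _ p (q - l) _ _ _ Ll); nia.
split; first by move=> e; have := big p q; nia.
split.
  move=> k p' q' p'0 q'0 kE [Lk|[c [a [b cE]] kE']].
    case: (leqP (n * p) (m * q)) kE => h kE.
      by apply: (Za k (p + p') q' _ _ _ Lk); nia.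
    by apply: (Za k p' (q + q') _ _ _ Lk); nia.
  case: (leqP (n * p) (m * q)) kE => h kE.
    by have := big (p' + a) (q - q' - b); nia.
  by have := big (p - p' - a) (q' + b); nia.
move=> k nk uk.
have nLk : ~ L k by move=> ?; apply: nk; left.
have [p' [q' [p'0 q'0 E']]] := Zb k nLk ltac:(lia).
have [p'p|pp'] := leqP p' p.
  have [q'q|qq'] := leqP q' q.
    case: nk; right; exists (n * (p - p') + m * (q - q')); last by nia.
    by exists (p - p'), (q - q').
  case: (leqP (n * p) (m * q)) uk => h uk; first by nia.
  by exists p', (q' - q); split; nia.
case: (leqP (n * p) (m * q)) uk => h uk; last by nia.
by exists (p' - p), q'; split; nia.
Qed.

End Numbers.

(** * Forms along a cusp in adapted coordinates *)

(** Course-of-values recursion on the list of the values found so far. *)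
Lemma strong_rec (T : Type) (x0 : T) (F : nat -> (nat -> T) -> T) :
  (forall k x y, (forall i, (i < k)%N -> x i = y i) -> F k x = F k y) ->
  exists x, forall k, x k = F k x.
Proof.
move=> Floc.
pose s := fix s N := if N is N'.+1 then rcons (s N') (F N' (nth x0 (s N'))) else [::].
have sz N : size (s N) = N by elim: N => //= N; rewrite size_rcons => ->.
have sS N i : (i < N)%N -> nth x0 (s N.+1) i = nth x0 (s N) i.
  by move=> iN; rewrite /= nth_rcons sz iN.
have sM N M i : (i < N)%N -> (N <= M)%N -> nth x0 (s M) i = nth x0 (s N) i.
  move=> iN /subnKC <-; elim: (M - N)%N => [|d IH]; first by rewrite addn0.
  by rewrite addnS sS ?IH //; lia.
exists (fun k => nth x0 (s k.+1) k) => k.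
rewrite [LHS]/= nth_rcons sz ltnn eqxx; apply: Floc => i ik.
by rewrite (sM i.+1 k).
Qed.

Section Adapted.
Variable R : realType.
Local Notation C := R[i].
Local Notation ser1 := (fps C).
Local Notation ser2 := (fps (fps C)).
Variables (n m : nat) (b : ser1).
Hypotheses (n2 : (2 <= n)%N) (nm : (n < m)%N) (cop : coprime n m).
Hypotheses (hb : holo1 b) (bm : fps_ge m b) (bm0 : b m != 0).
Implicit Types (w : form1 R) (h : ser2) (i j k v : nat) (c : C).

Definition curve : param R := (fpsX C ^+ n, b).

Lemma curve_origin : through_origin curve.
Proof.
split; rewrite /curve /=; last by apply: bm; lia.
by rewrite fpsXn /single; case: eqP => //; lia.
Qed.

Definition ser_wt_ge h k := forall i j, (n * i + m * j < k)%N -> h i j = 0.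

Definition wt_ge w k :=
  (forall i j, (n * i.+1 + m * j < k)%N -> w.1 i j = 0) /\
  (forall i j, (n * i + m * j.+1 < k)%N -> w.2 i j = 0).

Lemma wt_geW w k k' : (k' <= k)%N -> wt_ge w k -> wt_ge w k'.
Proof. by move=> kk [w1 w2]; split=> i j ij; [apply: w1|apply: w2]; lia. Qed.

Lemma wt_geB w w' k : wt_ge w k -> wt_ge w' k -> wt_ge (w - w') k.
Proof.
move=> [w1 w2] [w1' w2'].
by split=> i j ij; rewrite !formE !fpsDE !fpsNE ?w1 ?w1' ?w2 ?w2' // subrr.
Qed.

Lemma wt_geD w w' k : wt_ge w k -> wt_ge w' k -> wt_ge (w + w') k.
Proof.
move=> [w1 w2] [w1' w2'].
by split=> i j ij; rewrite !formE !fpsDE ?w1 ?w1' ?w2 ?w2' // addr0.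
Qed.

Lemma wt_ge1 w k : wt_ge w k -> ser_wt_ge w.1 (k - n).
Proof. by move=> [w1 _] i j ij; apply: w1; lia. Qed.

Lemma wt_ge2 w k : wt_ge w k -> ser_wt_ge w.2 (k - m).
Proof. by move=> [_ w2] i j ij; apply: w2; lia. Qed.

Lemma wt_geZ h w k k' : ser_wt_ge h k -> wt_ge w k' -> wt_ge (form_scale h w) (k + k').
Proof.
move=> hk wk; have E k1 (k2 : nat) h1 h2 : ser_wt_ge h1 k1 ->
    (forall i j, (n * i + m * j + k2 < k')%N -> h2 i j = 0) ->
    forall i j, (n * i + m * j + k2 < k1 + k')%N -> (h1 * h2) i j = 0.
  move=> h1k h2k i j ij; rewrite fpsME fps_sumE big1 // => p _.
  rewrite fpsME big1 // => q _.
  case: (ltnP (n * p + m * q) k1) => pq; first by rewrite h1k ?mul0r.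
  rewrite h2k ?mulr0 //; have := ltn_ord p; have := ltn_ord q; nia.
case: wk => w1 w2; split=> i j ij /=.
  by apply: (E k n _ _ hk _ i j _) => [i' j' ij'|]; [apply: w1|]; lia.
by apply: (E k m _ _ hk _ i j _) => [i' j' ij'|]; [apply: w2|]; lia.
Qed.

Lemma ser_wt_mono c i j : ser_wt_ge (mono c i j) (n * i + m * j).
Proof. by move=> i' j' ij; rewrite monoE; case: andP => // -[/eqP ? /eqP ?]; lia. Qed.

Lemma expX i : curve.1 ^+ i = single (n * i) 1.
Proof. by rewrite /curve /= fpsXn single_exp expr1n. Qed.

Lemma expb_ge j : fps_ge (m * j) (b ^+ j).
Proof.
elim: j => [|j IH]; first by move=> ?; rewrite muln0 ltn0.
by rewrite exprS mulnS; apply: fps_geM.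
Qed.

Lemma expb_lead j : (b ^+ j) (m * j)%N = b m ^+ j.
Proof.
elim: j => [|j IH]; first by rewrite muln0 !expr0 fps1E.
by rewrite !exprS mulnS (fps_ge_lead bm (@expb_ge j)) IH.
Qed.

Lemma single_ge i c : fps_ge i (single i c).
Proof. by move=> k ki; rewrite /single; case: eqP => // ?; lia. Qed.

Lemma monomial_ge i j : fps_ge (n * i + m * j) (curve.1 ^+ i * curve.2 ^+ j).
Proof. by rewrite expX; apply: fps_geM; [apply: single_ge|apply: expb_ge]. Qed.

Lemma monomial_lead i j :
  (curve.1 ^+ i * curve.2 ^+ j) (n * i + m * j)%N = b m ^+ j.
Proof.
rewrite expX (fps_ge_lead (@single_ge _ _) (@expb_ge j)) expb_lead.
by rewrite /single eqxx mul1r.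
Qed.

Lemma comp_ge h k : ser_wt_ge h k -> fps_ge k (comp21 h curve.1 curve.2).
Proof.
move=> hk l lk; rewrite /comp21 big1 // => i _; rewrite big1 // => j _.
case: (ltnP (n * i + m * j) k) => ij; first by rewrite hk ?mul0r.
by rewrite monomial_ge ?mulr0 //; lia.
Qed.

Lemma deriv1E : fps_deriv curve.1 = single n.-1 n%:R.
Proof. by rewrite /curve /= fpsXn fps_deriv_single. Qed.

Lemma deriv2_ge : fps_ge m.-1 (fps_deriv curve.2).
Proof. by move=> k km; rewrite /fps_deriv /= bm ?mul0rn //; lia. Qed.

Local Notation pull := (pull_param curve).

Lemma pull_ge w k : wt_ge w k -> fps_ge k.-1 (pull w).
Proof.
move=> wk; rewrite /pull_param; apply: fps_geD.
  apply: fps_geW (fps_geM (comp_ge (wt_ge1 wk)) (_ : fps_ge n.-1 _)); first by lia.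
  by rewrite deriv1E; apply: single_ge.
apply: fps_geW (fps_geM (comp_ge (wt_ge2 wk)) deriv2_ge); lia.
Qed.

(** [nu_C], as a relation between forms and their finite values. *)
Definition has_val w v :=
  exists2 k, v = k.+1 & (fps_ge k (pull w) /\ pull w k != 0).

Lemma has_valP w v : nu_C curve w = Some v <-> has_val w v.
Proof.
rewrite /nu_C; split=> [|[k -> /ord1_Some ->] //].
case E: (Defs.ord1 _) => [k|] //= [<-]; exists k => //; exact/ord1_Some.
Qed.

Lemma has_val_uniq w v v' : has_val w v -> has_val w v' -> v = v'.
Proof. by move=> /has_valP E /has_valP; rewrite E => -[]. Qed.

Lemma val_or_invariant w : pull w = 0 \/ exists v, has_val w v.
Proof.
case: (eqVneq (pull w) 0) => [|/fps_ord [k ? ?]]; first by left.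
by right; exists k.+1, k.
Qed.

Lemma wt_le_val w k v : wt_ge w k -> has_val w v -> (k <= v)%N.
Proof.
move=> /pull_ge wk [l -> [_ l0]]; rewrite leqNgt; apply/negP => lk.
by move: l0; rewrite wk ?eqxx //; lia.
Qed.

Lemma val_scale c i j w v : c != 0 -> has_val w v ->
  has_val (form_scale (mono c i j) w) (n * i + m * j + v).
Proof.
move=> c0 [k -> [wk wk0]]; exists (n * i + m * j + k)%N; first by rewrite addnS.
have [g1 g2] := curve_origin.
rewrite (pullZ _ _ curve_origin) (comp21_mono g1 g2).
have mg := fps_geM (@single_ge 0 c) (@monomial_ge i j).
split; first exact: fps_geM mg wk.
have := fps_ge_lead mg wk; rewrite !add0n => ->.
rewrite (fps_ge_lead (@single_ge 0 c) (@monomial_ge i j)) monomial_lead.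
by rewrite /single eqxx !mulf_neq0 // expf_neq0.
Qed.

Lemma val_sub_lt w w' v v' : has_val w v -> has_val w' v' -> (v < v')%N ->
  has_val (w - w') v.
Proof.
move=> [k -> [wk wk0]] [k' -> [wk' _]] kk; exists k => //.
rewrite (pullB _ _ curve_origin); split.
  by apply: fps_geD => //; apply: fps_geN; apply: fps_geW wk'; lia.
by rewrite fpsBE (wk' k) ?subr0.
Qed.

(** ** Convergent series of high order come from convergent functions *)

Lemma expb_bound : exists r B : C, [/\ 0 < r, r <= 1, 0 <= B &
  forall j l, (j <= n)%N -> `|(b ^+ j) l| * r ^+ l <= B].
Proof.
have /holo1P [r1 [M [r10 bM]]] := hb.
have [r [r0 rr1 rle1]] := common_radius r10 (@ltr01 C).
have n0 := normr_seminorm C; have r0' := ltW r0.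
have bM' N : nrm1 r N b <= M by apply: le_trans (bM N); apply: (nrm_le n0).
have M0 : 0 <= M by apply: le_trans (bM' 0%N); apply: (nrm_ge0 n0).
have M1 : 1 <= 1 + M by rewrite lerDl.
exists r, ((1 + M) ^+ n); split=> //; first by rewrite exprn_ge0 ?addr_ge0.
move=> j l jn; apply: le_trans (nrm_coef n0 _ r0' (ltnSn l)) _.
apply: (@le_trans _ _ ((1 + M) ^+ j)); last by apply: ler_weXn2l.
case: j jn => [|j] _.
  rewrite !expr0 -(@single0_1 C); apply: le_trans (nrm1_sc _ _ r0') _.
  by rewrite normr1.
apply: le_trans (seminorm_exp _ _ (nrm1_seminorm _ r0')) _.
apply: lerXn2r; rewrite ?nnegrE ?addr_ge0 //; first exact: (nrm_ge0 n0).
by apply: le_trans (bM' _) _; rewrite lerDr.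
Qed.

(** The monomials [x ^ i y ^ j] with [j < n] have pairwise distinct orders on the
    curve, and every large integer is one of these orders: this makes a
    triangular system, whose solution has geometric growth. *)
Lemma comp_surjective (al : ser1) (u : nat) : holo1 al -> fps_ge u al ->
  (n * m <= u)%N ->
  exists h, [/\ holo2 h, comp21 h curve.1 curve.2 = al & ser_wt_ge h u].
Proof.
move=> hal alu nmu; have [g1 g2] := curve_origin.
have /choice [J JP] : forall k, exists j, (j < n)%N /\ m * j = k %[mod n].
  by move=> k; have [j] := residue n2 nm cop k; exists j.
pose A k := ((k - m * J k) %/ n)%N.
have AJ k : (u <= k)%N -> (n * A k + m * J k = k)%N.
  move=> uk; have [Jn Jk] := JP k; have Jle : (m * J k <= k)%N by nia.
  have : (n %| k - m * J k)%N by rewrite -eqn_mod_dvd // Jk.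
  by move=> nd; rewrite /A [(n * (_ %/ n))%N]mulnC (divnK nd) subnK.
have AJu i j k : (j < n)%N -> (n * i + m * j = k)%N -> (u <= k)%N ->
    A k = i /\ J k = j.
  move=> jn ij uk; have [Jn Jk] := JP k; have E := AJ k uk.
  have [jJ|Jj] := leqP j (J k).
    have [x xE] : exists x, (n * x = m * (J k - j))%N by exists (i - A k)%N; nia.
    have [/dvdnP [c cE] _] := gauss cop xE.
    by case: c cE => [|c] cE; nia.
  have [x xE] : exists x, (n * x = m * (j - J k))%N by exists (A k - i)%N; nia.
  have [/dvdnP [c cE] _] := gauss cop xE.
  by case: c cE => [|c] cE; nia.
pose e k := curve.1 ^+ A k * curve.2 ^+ J k.
have [x xE] : exists x : nat -> C, forall k, x k = if (k < u)%N then 0 else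
    (b m ^+ J k)^-1 * (al k - \sum_(i < k) x i * e i k).
  apply: (strong_rec (0 : C)) => k x y xy; case: ifP => // _.
  by congr (_ * (_ - _)); apply: eq_bigr => i _; rewrite xy.
have x0 k : (k < u)%N -> x k = 0 by move=> ku; rewrite xE ku.
pose h : ser2 := fun i j => if (j < n)%N then x (n * i + m * j)%N else 0.
have hu : ser_wt_ge h u by move=> i j ij; rewrite /h x0 // if_same.
pose hN N : ser2 := \sum_(k < N) mono (x k) (A k) (J k).
have hNE N : ser_wt_ge (h - hN N) N.
  move=> i j ij; rewrite !fpsBE /hN !fps_sumE /h.
  have E (k : 'I_N) : (k : nat) != (n * i + m * j)%N -> mono (x k) (A k) (J k) i j = 0.
    move=> kij; rewrite monoE; case: andP => // -[/eqP iE /eqP jE].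
    apply: x0; rewrite ltnNge; apply/negP => /AJ EE; move/eqP: kij; apply.
    by rewrite iE jE.
  rewrite (bigD1 (Ordinal ij)) //= big1 ?addr0; last first.
    by move=> k kij; apply: E; apply: contra kij => /eqP kE; apply/eqP/val_inj.
  rewrite monoE; have [uij|iju] := leqP u (n * i + m * j); last first.
    by rewrite x0 // !if_same subrr.
  case: ltnP => jn; first by have [-> ->] := AJu i j _ jn erefl uij; rewrite !eqxx subrr.
  case: andP => [[_ /eqP jE]|_]; last by rewrite subrr.
  by have [] := JP (n * i + m * j)%N; rewrite -jE; lia.
have comph k : comp21 h curve.1 curve.2 k = \sum_(i < k.+1) x i * e i k.
  rewrite -[h](subrK (hN k.+1)) (comp21D g1 g2) fpsDE (comp_ge (hNE k.+1)) // add0r.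
  rewrite /hN (big_morph (fun h => comp21 h curve.1 curve.2)
    (comp21D g1 g2) (comp21_0 g1 g2)) fps_sumE.
  by apply: eq_bigr => i _; rewrite (comp21_mono g1 g2) singleME /= subn0.
have e_lead k : (u <= k)%N -> e k k = b m ^+ J k.
  by move=> uk; rewrite /e -{3}(AJ k uk) monomial_lead.
exists h; split=> //; last first.
  apply: funext => k; rewrite comph; have [ku|uk] := ltnP k u.
    by rewrite alu // big1 // => i _; rewrite x0 ?mul0r //; have := ltn_ord i; lia.
  rewrite big_ord_recr /= [X in _ + X * _]xE ltnNge uk /= e_lead // mulrC mulrA.
  by rewrite mulfV ?expf_neq0 // mul1r addrC subrK.
have [r2 [B2 [r20 r2le B20 bB2]]] := expb_bound.
have /holo1P [r1 [M1 [r10 aM1]]] := hal.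
have [s [s0 ss1 ss2]] := common_radius r10 r20.
have s0' := ltW s0; have sle1 : s <= 1 by apply: le_trans r2le.
have n0 := normr_seminorm C.
have aB k : `|al k| * s ^+ k <= M1.
  apply: le_trans (aM1 k.+1); apply: le_trans (nrm_coef n0 _ s0' (ltnSn k)) _.
  exact: (nrm_le n0).
have M10 : 0 <= M1 by apply: le_trans (aB 0%N); rewrite mulr_ge0 ?exprn_ge0.
have bB j l : (j <= n)%N -> `|(b ^+ j) l| * s ^+ l <= B2.
  move=> jn; apply: le_trans (bB2 j l jn); apply: ler_wpM2l => //.
  by apply: lerXn2r; rewrite ?nnegrE ?(ltW r20).
(* [G] bounds the inverse of the leading coefficients and [H] absorbs the
   loss from [s ^ (n i)] to [s ^ (n i + m j)]. *)
pose G := (1 + `|b m|^-1) ^+ n; pose H := (s ^+ (m * n))^-1.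
have G0 : 0 <= G by rewrite exprn_ge0 ?addr_ge0 ?invr_ge0.
have H0 : 0 <= H by rewrite invr_ge0 exprn_ge0.
pose D := G * (M1 + B2 * H); have D0 : 0 <= D by rewrite mulr_ge0 ?addr_ge0 ?mulr_ge0.
have GJ k : `|(b m ^+ J k)^-1| <= G.
  have [Jn _] := JP k; rewrite normfV normrX -exprVn.
  apply: (@le_trans _ _ ((1 + `|b m|^-1) ^+ J k)).
    by apply: lerXn2r; rewrite ?nnegrE ?addr_ge0 ?invr_ge0 // lerDr.
  by apply: ler_weXn2l; [rewrite lerDl invr_ge0|exact: ltnW].
have eB i k : (i < k)%N -> (u <= i)%N -> `|e i k| * s ^+ k <= B2 * H * s ^+ i.
  move=> ik ui; have [Jn _] := JP i; have E := AJ i ui.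
  have nk : (n * A i <= k)%N.
    by apply: leq_trans (ltnW ik); rewrite -{2}E leq_addr.
  have -> : e i k = (b ^+ J i) (k - n * A i)%N by rewrite /e expX singleME mul1r nk.
  have -> : s ^+ k = s ^+ (k - n * A i) * s ^+ (n * A i) by rewrite -exprD subnK.
  rewrite mulrA -[leRHS]mulrA; apply: ler_pM.
  - exact: mulr_ge0 (normr_ge0 _) (exprn_ge0 _ s0').
  - exact: exprn_ge0.
  - exact: bB (ltnW Jn).
  rewrite /H mulrC ler_pdivlMr ?exprn_gt0 // -{2}E exprD; apply: ler_wpM2l.
    exact: exprn_ge0.
  by apply: ler_wiXn2l => //; rewrite leq_mul2l ltnW ?orbT.
pose y k := `|x k| * s ^+ k.
have y0 k : 0 <= y k by apply: mulr_ge0; [exact: normr_ge0|exact: exprn_ge0].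
have yD k : y k <= D * (1 + \sum_(j < k) y j).
  have S0 : 0 <= \sum_(j < k) y j by apply: sumr_ge0 => j _; exact: y0.
  have [ku|uk] := ltnP k u.
    rewrite {1}/y x0 // normr0 mul0r; apply: mulr_ge0 => //.
    exact: addr_ge0 ler01 S0.
  have HB : 0 <= B2 * H by exact: mulr_ge0.
  rewrite {1}/y xE ltnNge uk /= normrM -mulrA /D -mulrA; apply: ler_pM => //.
    exact: mulr_ge0 (normr_ge0 _) (exprn_ge0 _ s0').
  apply: le_trans (ler_wpM2r (exprn_ge0 _ s0') (ler_normB _ _)) _.
  rewrite mulrDl mulrDl; apply: lerD.
    apply: le_trans (aB k) _; rewrite mulrDr mulr1 lerDl; exact: mulr_ge0.
  apply: le_trans (ler_wpM2r (exprn_ge0 _ s0') (ler_norm_sum _ _ _)) _.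
  rewrite mulr_suml mulrDr mulr1; apply: ler_wpDl => //.
  rewrite mulr_sumr; apply: ler_sum => i _; rewrite normrM -mulrA.
  have [iu|ui] := ltnP i u.
    by rewrite x0 // normr0 mul0r; apply: mulr_ge0.
  rewrite [leRHS]mulrCA; apply: ler_wpM2l; first exact: normr_ge0.
  exact: eB.
have D1 : 1 <= 1 + D by rewrite lerDl.
have D1' : 0 < 1 + D by rewrite ltr_pwDl.
pose t := s / (1 + D); have t0 : 0 < t by rewrite divr_gt0.
have t1 : t <= 1 by rewrite ler_pdivrMr // mul1r (le_trans sle1).
exists (t ^+ m), D; split; first by rewrite exprn_gt0.
move=> i j; rewrite /h; case: ifP => _; last by rewrite normr0 mul0r.
apply: (@le_trans _ _ (`|x (n * i + m * j)%N| * t ^+ (n * i + m * j))).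
  apply: ler_wpM2l => //; rewrite -exprM; apply: ler_wiXn2l => //; first exact: ltW.
  by rewrite mulnDr leq_add2r leq_mul2r ltnW ?orbT.
rewrite expr_div_n mulrA ler_pdivrMr ?exprn_gt0 //.
exact: (gronwall D0 yD).
Qed.

(** Hence any form of large value can be replaced by one of large weight with the
    same pull-back: subtracting it makes the curve invariant. *)
Lemma exact_lift w v : holo_form w -> fps_ge v (pull w) -> (n * m + n <= v)%N ->
  exists w', [/\ holo_form w', pull w' = pull w & wt_ge w' v.+1].
Proof.
move=> [hw1 hw2] wv vbig; have [g1 g2] := curve_origin.
have n0 : (n%:R : C) != 0 by rewrite pnatr_eq0; lia.
have hc1 : holo1 curve.1 by rewrite /curve /= fpsXn; apply: holo1_single.
have hp : holo1 (pull w).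
  rewrite /pull_param; apply: holo1D; apply: holo1M; try exact: holo1_deriv;
    exact: holo1_comp.
pose al : ser1 := fun k => pull w (k + n.-1)%N / n%:R.
have alE : single n.-1 n%:R * al = pull w.
  apply: funext => k; rewrite singleME; case: leqP => nk; last by rewrite wv //; lia.
  by rewrite /al subnK // mulrC divfK.
have hal : holo1 al.
  apply: (holo1_quotient (holo1_single n%:R n.-1) hp _ alE).
  apply/eqP => /(congr1 (fun f => f n.-1)) /eqP.
  by rewrite /single eqxx fps0E (negbTE n0).
have [] := comp_surjective (u := (v - n.-1)%N) hal.
- by move=> k kv; rewrite /al wv ?mul0r //; lia.
- by lia.
move=> h [hh hE hv]; exists (h, 0); split.
- split=> //=; exists 1, 0; split=> // i j; by rewrite normr0 mul0r.
- rewrite -alE -hE -deriv1E mulrC /pull_param; cbn [fst snd].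
  by rewrite (comp21_0 g1 g2) mul0r addr0.
by split=> //= i j ij; apply: hv; lia.
Qed.

(** Reduction of a form by forms realizing the values in [L]; [D] bounds the gap
    between value and weight of the latter, which controls the weight of the
    correction. *)
Lemma reduce (L : nat -> Prop) (D : nat) :
  (forall k, L k -> exists w, [/\ holo_form w, has_val w k & wt_ge w (k - D)]) ->
  forall w v, holo_form w -> fps_ge v (pull w) ->
  exists w', [/\ holo_form w', wt_ge w' (v.+1 - D) &
    pull (w - w') = 0 \/ exists v', [/\ has_val (w - w') v', ~ L v' & (v < v')%N]].
Proof.
move=> Lw w v; move: {2}(n * m + n - v)%N (leqnn (n * m + n - v)) => d.
elim: d w v => [|d IH] w v hd hw wv.
  have [w' [hw' E wt']] := exact_lift hw wv ltac:(lia).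
  exists w'; split=> //; first by apply: wt_geW wt'; lia.
  by left; rewrite (pullB _ _ curve_origin) E subrr.
have [z|nz] := eqVneq (pull w v) 0.
  have [||w' [hw' wt' H]] := IH w v.+1 _ hw.
  - by lia.
  - by move=> k; rewrite ltnS leq_eqVlt => /orP[/eqP ->|/wv].
  exists w'; split=> //; first by apply: wt_geW wt'; lia.
  by case: H => [H|[v' [? ? ?]]]; [left|right; exists v'; split=> //; lia].
have val_w : has_val w v.+1 by exists v.
case: (pselect (L v.+1)) => [Lv|nL]; last first.
  exists 0; split.
  - by split; exists 1, 0; split=> // i j; rewrite normr0 mul0r.
  - by split.
  by right; exists v.+1; rewrite subr0; split.
have [w0 [hw0 val_w0 wt0]] := Lw _ Lv.
have [k [kv] [w0k w0k0]] := val_w0; rewrite -kv in w0k w0k0.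
pose c := pull w v / pull w0 v.
have [g1 g2] := curve_origin.
have hcw : holo_form (form_scale (mono c 0 0) w0) := holo_formZ (holo2_mono _ _ _) hw0.
have [||w' [hw' wt' H]] := IH (w - form_scale (mono c 0 0) w0) v.+1 _ (holo_formB hw hcw).
- by lia.
- move=> i; rewrite ltnS (pullB _ _ curve_origin) (pullZ _ _ curve_origin).
  rewrite (comp21_mono g1 g2) !expr0 !mulr1 fpsBE singleME /= subn0.
  rewrite leq_eqVlt => /orP[/eqP ->|iv]; first by rewrite /c divfK // subrr.
  by rewrite wv // w0k // mulr0 subrr.
exists (form_scale (mono c 0 0) w0 + w'); split.
- exact: holo_formD.
- apply: wt_geD; last by apply: wt_geW wt'; lia.
  by have := wt_geZ (@ser_wt_mono c 0 0) wt0; rewrite !muln0.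
by rewrite opprD addrA; case: H => [H|[v' [? ? ?]]]; [left|right; exists v'; split=> //; lia].
Qed.

(** ** Leading parts *)

(** [c x ^ i y ^ j (m y dx - n x dy)]: up to constants, the forms of a given
    weight below [n m] whose value exceeds their weight. *)
Definition resonant c i j : form1 R := (mono (c * m%:R) i j.+1, mono (- (c * n%:R)) i.+1 j).

Definition resonant_wt i j := (n * i.+1 + m * j.+1)%N.

Definition lead w i j c := c != 0 /\ wt_ge (w - resonant c i j) (resonant_wt i j).+1.

Lemma nat_neq0 k : (0 < k)%N -> (k%:R : C) != 0.
Proof. by rewrite pnatr_eq0; lia. Qed.

Lemma wt_resonant c i j : wt_ge (resonant c i j) (resonant_wt i j).
Proof.
split=> i' j' ij; rewrite /= monoE; case: andP => // -[/eqP ? /eqP ?];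
  by move: ij; rewrite /resonant_wt; lia.
Qed.

Lemma lead_wt w i j c : lead w i j c -> wt_ge w (resonant_wt i j).
Proof.
move=> [_ wl]; rewrite -[w](subrK (resonant c i j)).
by apply: wt_geD (wt_resonant _ _ _); apply: wt_geW wl.
Qed.

Lemma lead_coef1 w i j c : lead w i j c -> w.1 i j.+1 = c * m%:R.
Proof.
move=> [_ [wl _]]; have := wl i j.+1; rewrite !formE !fpsDE !fpsNE /= monoE !eqxx /=.
by move=> /(_ (ltnSn _)) /eqP; rewrite subr_eq0 => /eqP.
Qed.

Lemma lead_sharp w i j c k : lead w i j c -> wt_ge w k -> (k <= resonant_wt i j)%N.
Proof.
move=> wl [w1 _]; rewrite leqNgt; apply/negP => /w1; rewrite (lead_coef1 wl).
by apply/eqP; rewrite mulf_neq0 ?nat_neq0 ?(proj1 wl) //; lia.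
Qed.

Lemma form_scaleB h w w' : form_scale h (w - w') = form_scale h w - form_scale h w'.
Proof. by apply: form_eq; rewrite /= mulrBr. Qed.

Lemma resonant_scale d c i j k l :
  form_scale (mono d k l) (resonant c i j) = resonant (d * c) (k + i) (l + j).
Proof.
by apply: form_eq; rewrite /= monoM ?addnS // ?mulrA // mulrN mulrA.
Qed.

Lemma lead_scale d w c i j k l : d != 0 -> lead w i j c ->
  lead (form_scale (mono d k l) w) (k + i) (l + j) (d * c).
Proof.
move=> d0 [c0 wl]; split; first exact: mulf_neq0.
rewrite -resonant_scale -form_scaleB; apply: wt_geW (wt_geZ (@ser_wt_mono d k l) wl).
by rewrite /resonant_wt; nia.
Qed.

Lemma lead_sub w w' i j c : lead w i j c -> wt_ge w' (resonant_wt i j).+1 -> lead (w - w') i j c.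
Proof.
by move=> [c0 wl] w'l; split=> //; rewrite addrAC; apply: wt_geB.
Qed.

Lemma lead_cancel w w' i j i' j' c : lead w i j c -> lead w' i' j' 1 ->
  (i' <= i)%N -> (j' <= j)%N ->
  wt_ge (w - form_scale (mono c (i - i') (j - j')) w') (resonant_wt i j).+1.
Proof.
move=> [c0 wl] w'l ii jj.
have [_] := lead_scale (i - i') (j - j') c0 w'l; rewrite !subnK // mulr1 => h.
rewrite -[w](subrK (resonant c i j)) -addrA -[X in _ + X]opprB.
exact: wt_geB.
Qed.

Lemma exact_weight w v k0 : has_val w v -> wt_ge w k0 ->
  exists k, [/\ (k0 <= k)%N, wt_ge w k & ~ wt_ge w k.+1].
Proof.
move=> wv wk0; have [k [nk kmin]] : exists k, ~ wt_ge w k.+1 /\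
    forall j, ~ wt_ge w j.+1 -> (k <= j)%N.
  by apply: nat_least; exists v => /wt_le_val /(_ wv); rewrite ltnn.
exists k; split=> //.
  by rewrite leqNgt; apply/negP => kk0; apply: nk; apply: wt_geW wk0.
case: k nk kmin => [|k] _ kmin; first by split.
by apply: contrapT => /kmin; rewrite ltnn.
Qed.

Lemma weight_semigroup w k : wt_ge w k -> ~ wt_ge w k.+1 ->
  [/\ semigroup n m k, (0 < k)%N &
      exists i j, (n * i.+1 + m * j = k)%N \/ (n * i + m * j.+1 = k)%N].
Proof.
move=> [w1 w2] nw.
have [i [j ijk]] : exists i j, (n * i.+1 + m * j = k)%N \/ (n * i + m * j.+1 = k)%N.
  apply: contrapT => no; apply: nw; split=> i j; rewrite ltnS leq_eqVlt.
    by move=> /orP[/eqP E|/w1 //]; case: no; exists i, j; left.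
  by move=> /orP[/eqP E|/w2 //]; case: no; exists i, j; right.
split; last by exists i, j.
  by case: ijk => <-; [exists i.+1, j|exists i, j.+1].
by case: ijk; nia.
Qed.

Lemma pull_mono1 c i j :
  pull (mono c i j, 0) (n * i.+1 + m * j).-1 = c * b m ^+ j * n%:R.
Proof.
have [g1 g2] := curve_origin; rewrite /pull_param; cbn [fst snd].
rewrite (comp21_0 g1 g2) mul0r addr0 deriv1E (comp21_mono g1 g2).
have E : ((n * i.+1 + m * j).-1 = (0 + (n * i + m * j)) + n.-1)%N by nia.
have cg := fps_geM (@single_ge 0 c) (@monomial_ge i j).
rewrite E (fps_ge_lead cg (@single_ge _ _)).
rewrite (fps_ge_lead (@single_ge 0 c) (@monomial_ge i j)) monomial_lead.
by rewrite /single !eqxx.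
Qed.

Lemma pull_mono2 c i j :
  pull (0, mono c i j) (n * i + m * j.+1).-1 = c * b m ^+ j.+1 * m%:R.
Proof.
have [g1 g2] := curve_origin; rewrite /pull_param; cbn [fst snd].
rewrite (comp21_0 g1 g2) mul0r add0r (comp21_mono g1 g2).
have E : ((n * i + m * j.+1).-1 = (0 + (n * i + m * j)) + m.-1)%N by nia.
have cg := fps_geM (@single_ge 0 c) (@monomial_ge i j).
rewrite E (fps_ge_lead cg deriv2_ge).
rewrite (fps_ge_lead (@single_ge 0 c) (@monomial_ge i j)) monomial_lead.
rewrite /single eqxx /fps_deriv /= (_ : m.-1.+1 = m); last by lia.
by rewrite [RHS]mulr_natr exprSr mulrnAr mulrA.
Qed.

Lemma pull_coef w (e : form1 R) k : wt_ge (w - e) k.+2 -> pull w k = pull e k.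
Proof.
move=> /pull_ge /(_ k (ltnSn k)); rewrite (pullB _ _ curve_origin) fpsBE => /eqP.
by rewrite subr_eq0 => /eqP.
Qed.

(** Below weight [n m] each weight is that of a single monomial, so that an
    initial part whose contribution to the value cancels is a multiple of
    [m y dx - n x dy]. *)
Lemma init_form w k : wt_ge w k -> ~ wt_ge w k.+1 -> (k < n * m)%N ->
  fps_ge k (pull w) -> exists i j c, k = resonant_wt i j /\ lead w i j c.
Proof.
move=> wk nwk knm pw; have [w1 w2] := wk.
have n0 := nat_neq0 (ltnW n2); have m0 : (m%:R : C) != 0 by apply: nat_neq0; lia.
have [_ k0 [i [j ijk]]] := weight_semigroup wk nwk.
have [A [B kE]] : exists A B, k = (n * A + m * B)%N.
  by case: ijk => <-; [exists i.+1, j|exists i, j.+1].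
have uniq A' B' : (n * A' + m * B' = k)%N -> A' = A /\ B' = B.
  by move=> E; apply: (weight_uniq n2 nm cop); rewrite ?E -?kE.
have pz e : wt_ge (w - e) k.+1 -> pull e k.-1 = 0.
  move=> we; rewrite -(@pull_coef w e); last by rewrite prednK.
  by apply: pw; lia.
clear i j ijk; case: A B kE uniq => [|i] [|j] kE uniq.
- by lia.
- have we : wt_ge (w - (0, mono (w.2 0%N j) 0 j)) k.+1.
    split=> i' j'; rewrite ltnS leq_eqVlt !formE !fpsDE !fpsNE => /orP[/eqP ij|ij] /=.
    + by have [] := uniq _ _ ij.
    + by rewrite w1 // subrr.
    + have [-> [->]] := uniq _ _ ij; by rewrite monoE !eqxx subrr.
    rewrite w2 // monoE; case: andP => [[/eqP E1 /eqP E2]|]; last by rewrite subrr.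
    by move: ij; rewrite E1 E2; lia.
  have := pz _ we; rewrite kE pull_mono2 => /eqP.
  rewrite !mulf_eq0 (negbTE m0) expf_eq0 (negbTE bm0) andbF !orbF => /eqP z.
  case: nwk; move: we; rewrite z; congr (wt_ge _ _).
  rewrite -[RHS]subr0; congr (_ - _); apply: form_eq => //=.
  by apply: funext => ?; apply: funext => ?; rewrite monoE if_same.
- have we : wt_ge (w - (mono (w.1 i 0%N) i 0, 0)) k.+1.
    split=> i' j'; rewrite ltnS leq_eqVlt !formE !fpsDE !fpsNE => /orP[/eqP ij|ij] /=.
    + have [[->] ->] := uniq _ _ ij; by rewrite monoE !eqxx subrr.
    + rewrite w1 // monoE; case: andP => [[/eqP E1 /eqP E2]|]; last by rewrite subrr.
      by move: ij; rewrite E1 E2; lia.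
    + by have [_] := uniq _ _ ij.
    by rewrite w2 // subrr.
  have := pz _ we; rewrite kE pull_mono1 => /eqP.
  rewrite expr0 mulr1 mulf_eq0 (negbTE n0) orbF => /eqP z.
  case: nwk; move: we; rewrite z; congr (wt_ge _ _).
  rewrite -[RHS]subr0; congr (_ - _); apply: form_eq => //=.
  by apply: funext => ?; apply: funext => ?; rewrite monoE if_same.
pose e : form1 R := (mono (w.1 i j.+1) i j.+1, mono (w.2 i.+1 j) i.+1 j).
have we : wt_ge (w - e) k.+1.
  split=> i' j'; rewrite ltnS leq_eqVlt !formE !fpsDE !fpsNE => /orP[/eqP ij|ij] /=.
  + have [[->] ->] := uniq _ _ ij; by rewrite monoE !eqxx subrr.
  + rewrite w1 // monoE; case: andP => [[/eqP E1 /eqP E2]|]; last by rewrite subrr.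
    by move: ij; rewrite E1 E2; lia.
  + have [-> [->]] := uniq _ _ ij; by rewrite monoE !eqxx subrr.
  rewrite w2 // monoE; case: andP => [[/eqP E1 /eqP E2]|]; last by rewrite subrr.
  by move: ij; rewrite E1 E2; lia.
have rel : w.1 i j.+1 * n%:R + w.2 i.+1 j * m%:R = 0.
  have := pz _ we; have -> : e = (mono (w.1 i j.+1) i j.+1, 0) + (0, mono (w.2 i.+1 j) i.+1 j).
    by apply: form_eq; rewrite !formE /= ?addr0 ?add0r.
  rewrite (pullD _ _ curve_origin) fpsDE kE pull_mono1 pull_mono2.
  rewrite mulrAC [X in _ + X]mulrAC -mulrDl => /eqP.
  by rewrite mulf_eq0 expf_eq0 (negbTE bm0) andbF orbF => /eqP.
exists i, j, (w.1 i j.+1 / m%:R).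
have eE : e = resonant (w.1 i j.+1 / m%:R) i j.
  apply: form_eq => /=; first by rewrite divfK.
  congr (mono _ _ _); apply: (mulIf m0); rewrite mulNr mulrAC divfK //.
  by apply/eqP; rewrite -addr_eq0 addrC rel.
split=> //; split; last by rewrite -eE /resonant_wt -kE.
apply/eqP => z; move/eqP: z; rewrite mulf_eq0 invr_eq0 (negbTE m0) orbF => /eqP z.
move: rel; rewrite z mul0r add0r => /eqP; rewrite mulf_eq0 (negbTE m0) orbF => /eqP z'.
case: nwk; move: we; rewrite /e z z'; congr (wt_ge _ _).
rewrite -[RHS]subr0; congr (_ - _); apply: form_eq => //=;
by apply: funext => ?; apply: funext => ?; rewrite monoE if_same.
Qed.

(** The initial part of [G w] is the product of the initial parts of [G] and [w].
    So [G] has order at least [T - t], where [t] is the weight of [w], and the terms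
    of [w] beyond its initial part only affect weights above [T]. *)
Lemma lead_mult w w' G i j T : lead w i j 1 -> wt_ge w' T -> (resonant_wt i j <= T)%N ->
  wt_ge (w' - form_scale G w) T.+1 -> wt_ge (w' - form_scale G (resonant 1 i j)) T.+1.
Proof.
move=> wl w'T tT H; have [_ wle] := wl.
have m0 : (m%:R : C) != 0 by apply: nat_neq0; lia.
have split_G : form_scale G (resonant 1 i j)
    = form_scale G w - form_scale G (w - resonant 1 i j).
  by rewrite form_scaleB opprB addrC subrK.
have GT g : (g <= T - resonant_wt i j)%N -> ser_wt_ge G g.
  elim: g => [|g IH] gT; first by move=> ? ?; rewrite ltn0.
  have {}IH := IH (ltnW gT); move=> p q; rewrite ltnS leq_eqVlt => /orP[/eqP pq|/IH //].
  have W : (n * (p + i).+1 + m * (q + j.+1) < T)%N by move: gT; rewrite /resonant_wt; nia.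
  have [E1 _] := H; have := E1 (p + i)%N (q + j.+1)%N (ltnW W).
  have [w'1 _] := w'T; rewrite !formE !fpsDE !fpsNE w'1 // sub0r => /eqP.
  rewrite oppr_eq0 => /eqP Gw0.
  have [E2 _] := wt_geZ IH wle; have {E2} := E2 (p + i)%N (q + j.+1)%N.
  rewrite form_scaleB !formE !fpsDE !fpsNE Gw0 sub0r /= [G * _]mulrC mono_mulE.
  rewrite leq_addl leq_addl /= !addnK mul1r => /(_ _) E2.
  have /eqP := E2 ltac:(rewrite /resonant_wt; nia).
  by rewrite oppr_eq0 mulf_eq0 (negbTE m0) => /eqP.
rewrite split_G opprB addrCA addrC; apply: wt_geD => //.
have := wt_geZ (GT _ (leqnn _)) wle; apply: wt_geW; lia.
Qed.

(** ** The induction on critical values *)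

(** What is known of the curve once the part [L] of the values has been
    generated.  The critical values are [t = resonant_wt i0 j0] and [T], and [D] is the
    difference between the last generator of [L] and the weight of a form with
    this value.  Every value in [L] exceeds the weight of some form by at most [D];
    the forms whose value is outside [L] have initial parts divisible by that of [w];
    and [w'] is an invariant form of weight [T] whose initial part is not divisible
    by that of [w]. *)
Record stage (L : nat -> Prop) (D i0 j0 T : nat) (w w' : form1 R) : Prop := Stage {
  stage_lt : (resonant_wt i0 j0 < T)%N;
  stage_bound : (T + D <= n * m)%N;
  stage_corner : corner n m L (resonant_wt i0 j0 + D) (T + D);
  stage_real : forall k, L k ->
    exists w, [/\ holo_form w, has_val w k & wt_ge w (k - D)];
  stage_holo : holo_form w;
  stage_lead : lead w i0 j0 1;
  stage_val : pull w = 0 \/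
    exists v, [/\ has_val w v, ~ L v & (resonant_wt i0 j0 + D < v)%N];
  stage_tilde : [/\ holo_form w', pull w' = 0, wt_ge w' T &
    forall G, ~ wt_ge (w' - form_scale G w) T.+1];
  stage_init : forall u k, holo_form u -> wt_ge u k -> ~ wt_ge u k.+1 ->
    (exists2 v, has_val u v & ~ L v) \/ (pull u = 0 /\ (k < T)%N) ->
    exists i j c, [/\ (i0 <= i)%N, (j0 <= j)%N, k = resonant_wt i j & lead u i j c] }.

Section Stage.
Variables (L : nat -> Prop) (D i0 j0 T : nat) (w w' : form1 R).
Hypothesis st : stage L D i0 j0 T w w'.

Lemma stage_cancel u k v : holo_form u -> wt_ge u k -> ~ wt_ge u k.+1 ->
  has_val u v -> ~ L v -> (resonant_wt i0 j0 <= k)%N /\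
  ((exists2 v', has_val w v' & (v' + (k - resonant_wt i0 j0) <= v)%N) \/
   exists u', [/\ holo_form u', wt_ge u' k.+1 & has_val u' v]).
Proof.
move=> hu uk nuk uv nLv.
have [i [j [c [ii jj kE ul]]]] :=
  stage_init st hu uk nuk (or_introl (ex_intro2 _ _ v uv nLv)).
have [c0 _] := ul; split; first by rewrite kE /resonant_wt; nia.
pose q := form_scale (mono c (i - i0) (j - j0)) w.
have hq : holo_form (u - q).
  by apply: holo_formB hu (holo_formZ (holo2_mono _ _ _) (stage_holo st)).
have qk : wt_ge (u - q) k.+1.
  by rewrite kE; apply: lead_cancel ul (stage_lead st) ii jj.
have [wz|[v' [wv' _ _]]] := stage_val st.
  right; exists (u - q); split; [exact: hq|exact: qk|]; move: uv => [l -> [ul1 ul2]]; exists l => //.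
  by rewrite (pullB _ _ curve_origin) /q (pullZ _ _ curve_origin) wz mulr0 subr0.
have qv : has_val q (v' + (k - resonant_wt i0 j0)).
  have := val_scale (i - i0) (j - j0) c0 wv'; congr (has_val _ _).
  by rewrite kE /resonant_wt; nia.
have [vv|vv] := leqP (v' + (k - resonant_wt i0 j0)) v; first by left; exists v'.
right; exists (u - q); split; [exact: hq|exact: qk|].
exact: val_sub_lt uv qv vv.
Qed.

(** If the value of [u] exceeded its weight less than is the case for [w],
    subtracting multiples of [w] would raise the weight forever without changing
    the value. *)
Lemma stage_excess u k v : holo_form u -> wt_ge u k -> ~ wt_ge u k.+1 ->
  has_val u v -> ~ L v ->
  exists2 v', has_val w v' & (resonant_wt i0 j0 <= k)%N /\ (v' + (k - resonant_wt i0 j0) <= v)%N.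
Proof.
move: {2}(v - k)%N (leqnn (v - k)) => d.
elim: d u k => [|d IH] u k hd hu uk nuk uv nLv.
  have [tk [[v' ? ?]|[u' [_ u'k u'v]]]] := stage_cancel hu uk nuk uv nLv.
    by exists v'.
  by have := wt_le_val u'k u'v; lia.
have [tk [[v' ? ?]|[u' [hu' u'k u'v]]]] := stage_cancel hu uk nuk uv nLv.
  by exists v'.
have [k1 [kk1 k1w k1nw]] := exact_weight u'v u'k.
have [v' wv' [tk1 vk1]] := IH u' k1 ltac:(lia) hu' k1w k1nw u'v nLv.
by exists v' => //; lia.
Qed.

(** Multiplying [w] by a monomial, and correcting by forms that realize the
    values in [L], gives the candidates for the next stage. *)
Lemma stage_reduce d k l lam : has_val w lam -> lam = (resonant_wt i0 j0 + d)%N ->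
  (D < d)%N -> L (lam + n * k + m * l)%N ->
  (forall q, add_gen n m L lam q -> exists u, [/\ holo_form u, has_val u q & wt_ge u (q - d)]) ->
  exists u, [/\ holo_form u, lead u (k + i0) (l + j0) 1 &
    pull u = 0 \/ exists v, [/\ has_val u v, ~ add_gen n m L lam v &
       (lam + n * k + m * l < v)%N]].
Proof.
move=> wlam lamE Dd Lv real.
have [u0 [hu0 u0v u0w]] := stage_real st Lv.
pose q := form_scale (mono 1 k l) w.
have hq : holo_form q by apply: holo_formZ (holo2_mono _ _ _) (stage_holo st).
have ql : lead q (k + i0) (l + j0) 1.
  by have := lead_scale k l (oner_neq0 C) (stage_lead st); rewrite mulr1.
have qv : has_val q (lam + n * k + m * l).
  have := val_scale k l (oner_neq0 C) wlam; congr (has_val _ _); lia.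
have [v vE [qv1 qv2]] := qv; have [v0 v0E [u1 u2]] := u0v.
have vv : v0 = v by lia.
subst v0; pose c := pull q v / pull u0 v.
have [g1 g2] := curve_origin.
have hc : holo_form (form_scale (mono c 0 0) u0) := holo_formZ (holo2_mono _ _ _) hu0.
have wc : wt_ge (form_scale (mono c 0 0) u0) (resonant_wt (k + i0) (l + j0)).+1.
  have := wt_geZ (@ser_wt_mono c 0 0) u0w; apply: wt_geW.
  by move: lamE; rewrite /resonant_wt => ->; nia.
have pv : fps_ge v.+1 (pull (q - form_scale (mono c 0 0) u0)).
  move=> i; rewrite ltnS (pullB _ _ curve_origin) (pullZ _ _ curve_origin).
  rewrite (comp21_mono g1 g2) !expr0 !mulr1 fpsBE singleME /= subn0.
  rewrite leq_eqVlt => /orP[/eqP ->|iv]; first by rewrite /c divfK // subrr.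
  by rewrite qv1 // u1 // mulr0 subrr.
have [r [hr rw H]] := reduce real (holo_formB hq hc) pv.
exists (q - form_scale (mono c 0 0) u0 - r); split.
- by apply: holo_formB => //; apply: holo_formB.
- apply: lead_sub; first exact: lead_sub.
  by apply: wt_geW rw; move: lamE vE; rewrite /resonant_wt => ->; nia.
- case: H => [H|[v' [H1 H2 H3]]]; first by left.
  by right; exists v'; split=> //; lia.
Qed.

(** The corner below which the value [lam] of [w] lies gives the exponents [p], [q].
    The forms [x ^ p w] and [y ^ q w] have values in [L] and can be reduced; the
    one of lower weight is the next [w], the other one becomes invariant, because
    no number as large as its value is missing from the new [L].

    For the divisibility of initial parts, let [x ^ k y ^ l w] have the same
    initial part as some [u] with value outside the new [L].  Their difference has
    the value of [x ^ k y ^ l w] and a higher weight, which [stage_excess] forbids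
    unless that value is in [L]; then the corner forces [p <= k] or [q <= l]. *)
Lemma stage_step lam : has_val w lam -> ~ L lam -> (resonant_wt i0 j0 + D < lam)%N ->
  exists p q, [/\ (0 < p)%N, (0 < q)%N,
    (forall l, (0 < l)%N -> L (lam + n * l)%N -> (p <= l)%N) /\ L (lam + n * p)%N,
    (forall l, (0 < l)%N -> L (lam + m * l)%N -> (q <= l)%N) /\ L (lam + m * q)%N &
    exists i1 j1 u u', resonant_wt i1 j1 = (resonant_wt i0 j0 + minn (n * p) (m * q))%N /\
      stage (add_gen n m L lam) (lam - resonant_wt i0 j0) i1 j1
        (resonant_wt i0 j0 + maxn (n * p) (m * q)) u u'].
Proof.
move=> wlam nL tlam; set t := resonant_wt i0 j0.
have [p [q [p0 q0 E [Lp pmin Lq qmin [npq cor]]]]] :=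
  corner_add n2 nm cop (stage_corner st) (stage_bound st) nL tlam.
exists p, q; split=> //; pose d := (lam - t)%N.
have lamE : lam = (t + d)%N by rewrite /d /t; lia.
have tT := stage_lt st; have TD := stage_bound st.
have real k : add_gen n m L lam k ->
    exists u, [/\ holo_form u, has_val u k & wt_ge u (k - d)].
  case=> [/(stage_real st) [u [hu uv uw]]|[c [a [b' cE]] kE]].
    by exists u; split=> //; apply: wt_geW uw; rewrite /d /t; lia.
  exists (form_scale (mono 1 a b') w); split.
  - exact: holo_formZ (holo2_mono _ _ _) (stage_holo st).
  - have := val_scale a b' (oner_neq0 C) wlam; congr (has_val _ _); lia.
  have := wt_geZ (@ser_wt_mono 1 a b') (lead_wt (stage_lead st)).
  by apply: wt_geW; rewrite kE lamE cE /t; lia.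
have Dd : (D < d)%N by rewrite /d /t; lia.
have red k l := @stage_reduce d k l lam wlam lamE Dd.
have [uy [huy ly vy]] : exists u, [/\ holo_form u, lead u i0 (q + j0) 1 &
    pull u = 0 \/ exists v, [/\ has_val u v, ~ add_gen n m L lam v &
       (lam + m * q < v)%N]].
  have [|u] := red 0%N q _ real; first by rewrite muln0 addn0.
  by rewrite muln0 addn0 add0n; exists u.
have [ux [hux lx vx]] : exists u, [/\ holo_form u, lead u (p + i0) j0 1 &
    pull u = 0 \/ exists v, [/\ has_val u v, ~ add_gen n m L lam v &
       (lam + n * p < v)%N]].
  have [|u] := red p 0%N _ real; first by rewrite muln0 addn0.
  by rewrite muln0 addn0 add0n; exists u.
(* Any form with value outside the new [L] has an initial part divisible by
   that of [x ^ p w] or of [y ^ q w]. *)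
have init u k : holo_form u -> wt_ge u k -> ~ wt_ge u k.+1 ->
    (exists2 v, has_val u v & ~ add_gen n m L lam v) \/
    (pull u = 0 /\ (k < t + maxn (n * p) (m * q))%N) ->
    exists i j c, [/\ (i0 <= i)%N, (j0 <= j)%N, k = resonant_wt i j, lead u i j c &
      ((p <= i - i0)%N \/ (q <= j - j0)%N) /\
      forall v, has_val u v -> (k + d < v)%N].
  move=> hu uk nuk H.
  have H0 : (exists2 v, has_val u v & ~ L v) \/ (pull u = 0 /\ (k < T)%N).
    case: H => [[v uv nLv]|[u0 kT]].
      by left; exists v => // Lv; apply: nLv; left.
    right; split=> //; move: kT TD lamE E tlam Dd; rewrite /d /t; lia.
  have [i [j [c [ii jj kE ul]]]] := stage_init st hu uk nuk H0.
  have [c0 _] := ul.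
  pose v0 := (k + d)%N.
  have gt v : has_val u v -> (v0 < v)%N.
    move=> uv; case: H => [[v1 uv1 nLv1]|[u0 _]]; last first.
      by have [l _ [_]] := uv; rewrite u0 fps0E eqxx.
    rewrite -(has_val_uniq uv uv1) in nLv1.
    have nLv : ~ L v by move=> Lv; apply: nLv1; left.
    have [v' wv' [tk vk]] := stage_excess hu uk nuk uv nLv.
    rewrite (has_val_uniq wv' wlam) in vk.
    rewrite ltn_neqAle; apply/andP; split; last by rewrite /v0; move: vk lamE tk; rewrite /t; lia.
    apply/eqP => vE; apply: nLv1; right.
    exists (n * (i - i0) + m * (j - j0))%N; first by exists (i - i0)%N, (j - j0)%N.
    by rewrite -vE /v0 lamE kE /t /resonant_wt; nia.
  exists i, j, c; split=> //; split=> //.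
  pose h := form_scale (mono c (i - i0) (j - j0)) w.
  have hh : holo_form h by apply: holo_formZ (holo2_mono _ _ _) (stage_holo st).
  have hv : has_val h v0.
    have := val_scale (i - i0) (j - j0) c0 wlam; congr (has_val _ _).
    by rewrite /v0 lamE kE /t /resonant_wt; nia.
  have hk : wt_ge (h - u) k.+1.
    have := lead_cancel ul (stage_lead st) ii jj; rewrite -kE => hk.
    by rewrite -opprB -[- _]sub0r; apply: wt_geB.
  have hv' : has_val (h - u) v0.
    have [u0|[v uv]] := val_or_invariant u; last exact: val_sub_lt hv uv (gt v uv).
    have [l lE [l1 l2]] := hv; exists l => //.
    by rewrite (pullB _ _ curve_origin) u0 subr0.
  have Lv0 : L v0.
    apply: contrapT => nLv0.
    have [k1 [kk1 k1w k1nw]] := exact_weight hv' hk.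
    have [v' wv' [tk vk]] := stage_excess (holo_formB hh hu) k1w k1nw hv' nLv0.
    rewrite (has_val_uniq wv' wlam) in vk.
    by move: vk lamE tk kk1; rewrite /v0 /t; lia.
  have [pi|ip] := leqP p (i - i0); first by left.
  have [qj|jq] := leqP q (j - j0); first by right.
  exfalso; have [Za _] := stage_corner st; apply: (Za v0 (p - (i - i0)) (q - (j - j0)))%N Lv0.
  - by lia.
  - by lia.
  rewrite -E /v0 lamE kE /t /resonant_wt; nia.
have [_ Zb'] := cor.
have TD' : (t + maxn (n * p) (m * q) + d <= n * m)%N.
  by move: E TD lamE; rewrite /t; lia.
have inv u : holo_form u ->
    (pull u = 0 \/ exists v, [/\ has_val u v, ~ add_gen n m L lam v &
       (lam + maxn (n * p) (m * q) < v)%N]) -> pull u = 0.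
  move=> _ [//|[v [_ nLv vb]]].
  by have [|p' [q' [p'0 q'0 E']]] := Zb' v nLv; lia.
have corE : corner n m (add_gen n m L lam)
   (t + minn (n * p) (m * q) + d) (t + maxn (n * p) (m * q) + d).
  by move: cor; rewrite lamE !(addnAC t d).
have [xy|yx] := ltnP (n * p) (m * q).
- exists (p + i0)%N, j0, ux, uy.
  have t1 : resonant_wt (p + i0) j0 = (t + n * p)%N by rewrite /t /resonant_wt; nia.
  have t2 : resonant_wt i0 (q + j0) = (t + m * q)%N by rewrite /t /resonant_wt; nia.
  move: corE TD' inv init; rewrite (minn_idPl (ltnW xy)) (maxn_idPr (ltnW xy)).
  move=> corE TD' inv init; split; first by rewrite t1.
  split=> //; rewrite ?t1 //.
  + by rewrite ltn_add2l.
  + case: vx => [|[v [? ? ?]]]; [by left|right; exists v; split=> //].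
    by rewrite addnAC -lamE.
  + split=> //; first exact: inv; first by rewrite -t2; apply: lead_wt ly.
    move=> G; rewrite -t2 => H0.
    have tle : (resonant_wt (p + i0) j0 <= resonant_wt i0 (q + j0))%N by rewrite t1 t2; lia.
    have [E1 _] := lead_mult lx (lead_wt ly) tle H0.
    have := E1 i0 (q + j0).+1; rewrite !formE !fpsDE !fpsNE (lead_coef1 ly) /=.
    rewrite [G * _]mulrC mono_mulE (_ : (p + i0 <= i0)%N = false) /=; last by lia.
    rewrite subr0 mul1r => /(_ (ltnSn _)) /eqP.
    by rewrite (negbTE (nat_neq0 _)) //; lia.
  move=> u k hu uk nuk H.
  have [i [j [c [ii jj kE ul [pq gt]]]]] := init u k hu uk nuk H.
  exists i, j, c; split=> //; case: pq => [pi|qj]; first by lia.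
  exfalso; have kb : (t + m * q <= k)%N by rewrite kE /t /resonant_wt; nia.
  case: H => [[v uv nLv]|[_ kT]]; last by lia.
  have vb := gt v uv.
  by have [|p' [q' [p'0 q'0 E']]] := Zb' v nLv; lia.
have {}yx : (m * q < n * p)%N by rewrite ltn_neqAle yx andbT; apply/eqP => h; apply: npq.
exists i0, (q + j0)%N, uy, ux.
have t1 : resonant_wt (p + i0) j0 = (t + n * p)%N by rewrite /t /resonant_wt; nia.
have t2 : resonant_wt i0 (q + j0) = (t + m * q)%N by rewrite /t /resonant_wt; nia.
move: corE TD' inv init; rewrite (minn_idPr (ltnW yx)) (maxn_idPl (ltnW yx)).
move=> corE TD' inv init; split; first by rewrite t2.
split=> //; rewrite ?t2 //.
+ by rewrite ltn_add2l.
+ case: vy => [|[v [? ? ?]]]; [by left|right; exists v; split=> //].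
  by rewrite addnAC -lamE.
+ split=> //; first exact: inv; first by rewrite -t1; apply: lead_wt lx.
  move=> G; rewrite -t1 => H0.
  have tle : (resonant_wt i0 (q + j0) <= resonant_wt (p + i0) j0)%N by rewrite t1 t2; lia.
  have [E1 _] := lead_mult ly (lead_wt lx) tle H0.
  have := E1 (p + i0)%N j0.+1; rewrite !formE !fpsDE !fpsNE (lead_coef1 lx) /=.
  rewrite [G * _]mulrC mono_mulE andbC (_ : ((q + j0).+1 <= j0.+1)%N = false) /=; last by lia.
  rewrite subr0 mul1r => /(_ (ltnSn _)) /eqP.
  by rewrite (negbTE (nat_neq0 _)) //; lia.
move=> u k hu uk nuk H.
have [i [j [c [ii jj kE ul [pq gt]]]]] := init u k hu uk nuk H.
exists i, j, c; split=> //; case: pq => [pi|qj]; last by lia.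
exfalso; have kb : (t + n * p <= k)%N by rewrite kE /t /resonant_wt; nia.
case: H => [[v uv nLv]|[_ kT]]; last by lia.
have vb := gt v uv.
by have [|p' [q' [p'0 q'0 E']]] := Zb' v nLv; lia.
Qed.

End Stage.

(** *** The first stage *)

Definition positive_semigroup k := semigroup n m k /\ (0 < k)%N.

Lemma monomial_form_val (e : form1 R) k :
  wt_ge e k -> (0 < k)%N -> pull e k.-1 != 0 -> has_val e k.
Proof. by move=> ek k0 e0; exists k.-1; [rewrite prednK|split=> //; exact: pull_ge]. Qed.

Lemma wt_mono1 c i j : wt_ge (mono c i j, 0) (n * i.+1 + m * j).
Proof.
by split=> //= i' j' ij; rewrite monoE; case: andP => // -[/eqP E1 /eqP E2]; lia.
Qed.

Lemma wt_mono2 c i j : wt_ge (0, mono c i j) (n * i + m * j.+1).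
Proof.
by split=> //= i' j' ij; rewrite monoE; case: andP => // -[/eqP E1 /eqP E2]; lia.
Qed.

Lemma holo2_0 : holo2 (0 : ser2).
Proof. by exists 1, 0; split=> // i j; rewrite normr0 mul0r. Qed.

Lemma val_dx i j : has_val (mono 1 i j, 0) (n * i.+1 + m * j).
Proof.
apply: monomial_form_val; [exact: wt_mono1|by nia|].
by rewrite pull_mono1 mul1r mulf_neq0 ?expf_neq0 ?nat_neq0 //; lia.
Qed.

Lemma val_dy i j : has_val (0, mono 1 i j) (n * i + m * j.+1).
Proof.
apply: monomial_form_val; [exact: wt_mono2|by nia|].
by rewrite pull_mono2 mul1r mulf_neq0 ?expf_neq0 ?nat_neq0 //; lia.
Qed.

Lemma real_semigroup k : positive_semigroup k ->
  exists w, [/\ holo_form w, has_val w k & wt_ge w k].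
Proof.
move=> [[[|i] [j kE]] k0]; last first.
  exists (mono 1 i j, 0); rewrite kE; split; [|exact: val_dx|exact: wt_mono1].
  by split; [exact: holo2_mono|exact: holo2_0].
case: j kE => [|j] kE; first by lia.
exists (0, mono 1 0 j); rewrite kE; split; [|exact: val_dy|exact: wt_mono2].
by split; [exact: holo2_0|exact: holo2_mono].
Qed.

(** Only the leading terms on the curve of the two monomials contribute in
    degree [N - 1], and these cancel. *)
Lemma cancel_val p i j q k l N : (n * i.+1 + m * j = N)%N -> (n * k + m * l.+1 = N)%N ->
  p * b m ^+ j * n%:R + q * b m ^+ l.+1 * m%:R = 0 ->
  fps_ge N (pull (mono p i j, mono q k l)).
Proof.
move=> E1 E2 z.
have -> : (mono p i j, mono q k l) = (mono p i j, 0) + (0, mono q k l) :> form1 R.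
  by apply: form_eq; rewrite !formE /= ?addr0 ?add0r.
have wN : wt_ge ((mono p i j, 0) + (0, mono q k l)) N.
  by apply: wt_geD; [rewrite -E1; exact: wt_mono1|rewrite -E2; exact: wt_mono2].
case: N E1 E2 wN => [|N] E1 E2 wN; first by move=> ?; rewrite ltn0.
move=> r; rewrite ltnS leq_eqVlt => /orP[/eqP ->|rN]; last exact: pull_ge wN r rN.
rewrite (pullD _ _ curve_origin) fpsDE.
have := @pull_mono1 p i j; rewrite E1 /= => ->.
by have := @pull_mono2 q k l; rewrite E2 /= => ->.
Qed.

(** A value outside [Gamma] is a gap, hence below [n m], where [init_form] applies.
    The two critical values are the weights of [m y dx - n x dy] and of the
    differential of the quasi-homogeneous equation, both corrected to
    higher order. *)
Lemma stage_first : exists w w', stage positive_semigroup 0 0 0 (n * m) w w'.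
Proof.
have n0 := nat_neq0 (ltnW n2); have m0 : (m%:R : C) != 0 by apply: nat_neq0; lia.
have real k : positive_semigroup k ->
    exists w, [/\ holo_form w, has_val w k & wt_ge w (k - 0)].
  by rewrite subn0; exact: real_semigroup.
have gap k : ~ positive_semigroup k -> (0 < k)%N ->
    exists p q, [/\ (0 < p)%N, (0 < q)%N & (k + n * p + m * q = n * m)%N].
  by move=> nk k0; have [sk|//] := gap_or_semigroup n2 nm cop k; case: nk.
have hh c i j d k l : holo_form ((mono c i j, mono d k l) : form1 R).
  by split; exact: holo2_mono.
have [|r [hr rw rv]] := reduce real (hh (1 * m%:R) 0%N 1%N (- (1 * n%:R)) 1%N 0%N)
    (_ : fps_ge (n + m) _).
  by apply: cancel_val; [by lia|by lia|rewrite !expr1; ring].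
(* the differential of the quasi-homogeneous equation of the curve, divided by [n] *)
pose c := - (b m ^+ n * m%:R / n%:R).
have [|r' [hr' rw' rv']] := reduce real (hh c m.-1 0%N 1 0%N n.-1)
    (_ : fps_ge (n * m) _).
  apply: cancel_val; [by nia|by nia|].
  rewrite prednK ?(ltnW n2) // expr0 mulr1 mul1r mulNr divfK //.
  by rewrite addrC subrr.
exists (resonant 1 0 0 - r), ((mono c m.-1 0, mono 1 0 n.-1) - r').
have wl : lead (resonant 1 0 0 - r) 0 0 1.
  apply: lead_sub; last by apply: wt_geW rw; rewrite /resonant_wt; lia.
  split; first exact: oner_neq0.
  by rewrite subrr.
have tw : wt_ge (mono c m.-1 0, mono 1 0 n.-1) (n * m).
  split=> i j ij; rewrite /= monoE; case: andP => // -[/eqP E1 /eqP E2];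
  by move: ij; rewrite E1 E2; nia.
have corn : corner n m positive_semigroup (resonant_wt 0 0 + 0) (n * m + 0).
  rewrite !addn0; split=> [k p q p0 q0 E [sk _]|k nk kb].
    exact: (gap_semigroup n2 nm cop p0 q0 E sk).
  by apply: gap => //; move: kb; rewrite /resonant_wt; lia.
split; [|by rewrite addn0|exact: corn|exact: real| |exact: wl| | |].
- by rewrite /resonant_wt; nia.
- exact: holo_formB (hh _ _ _ _ _ _) hr.
- by case: rv => [|[v [? ? vb]]]; [left|right; exists v; split=> //; rewrite /resonant_wt; lia].
- split.
  + exact: holo_formB (hh _ _ _ _ _ _) hr'.
  + case: rv' => [//|[v [_ nv vb]]].
    by have [|p [q [p0 q0 E]]] := gap v nv; lia.
  + by apply: wt_geB => //; apply: wt_geW rw'; lia.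
  move=> G H0.
  have H1 : wt_ge ((mono c m.-1 0, mono 1 0 n.-1) - form_scale G (resonant 1 0 0 - r)) (n * m).+1.
    have -> : (mono c m.-1 0, mono 1 0 n.-1) - form_scale G (resonant 1 0 0 - r)
      = (mono c m.-1 0, mono 1 0 n.-1) - r' - form_scale G (resonant 1 0 0 - r) + r'.
      by rewrite addrAC subrK.
    by apply: wt_geD => //; apply: wt_geW rw'; lia.
  have tT : (resonant_wt 0 0 <= n * m)%N by rewrite /resonant_wt; nia.
  have [_ E2] := lead_mult wl tw tT H1.
  have := E2 0%N n.-1; rewrite !formE !fpsDE !fpsNE /= monoE !eqxx /=.
  rewrite [G * _]mulrC mono_mulE /= subr0 => E3.
  have /eqP := E3 ltac:(nia).
  by rewrite oner_eq0.
move=> u k hu uk nuk H; have [sk k0 _] := weight_semigroup uk nuk.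
have pk : positive_semigroup k by [].
have [knm pu] : (k < n * m)%N /\ fps_ge k (pull u).
  case: H => [[v uv nv]|[u0 kT]]; last by rewrite u0.
  have kv := wt_le_val uk uv.
  have vk : (k < v)%N by rewrite ltn_neqAle kv andbT; apply/eqP => E; apply: nv; rewrite -E.
  have [|p [q [p0 q0 E]]] := gap v nv; first by lia.
  split; first by lia.
  by have [l lE [ul _]] := uv; apply: fps_geW ul; lia.
have [i [j [d [kE ul]]]] := init_form uk nuk knm pu.
by exists i, j, d.
Qed.

(** *** All critical values *)

Lemma lam_unionS lam p :
  lam_union n m lam p.+1 = add_gen n m (lam_union n m lam p) (nth 0%N lam p).
Proof.
apply: funext => k; apply: propext; split=> [[q [c [qp sc kE]]]|[[q [c [qp sc kE]]]|[c sc kE]]].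
- move: qp; rewrite ltnS leq_eqVlt => /orP[/eqP qE|qp].
    by right; exists c; rewrite -?qE.
  by left; exists q, c.
- by exists q, c; split=> //; lia.
- by exists p, c.
Qed.

Section Basis.
Variables (s : nat) (lam : seq nat).
Hypothesis Hlam : semimodule_basis n m (differential_values curve) s lam.
Local Notation gen := (nth 0%N lam).

Lemma valuesP v : differential_values curve v <-> exists2 w, holo_form w & has_val w v.
Proof. by split=> -[w hw /has_valP wv]; exists w. Qed.

Lemma gen_value q : (q < s.+2)%N -> differential_values curve (gen q).
Proof.
case: Hlam => _ _ LE _ qs; rewrite LE; exists q, 0%N; split=> //; last by rewrite addn0.
by exists 0%N, 0%N; rewrite !muln0.
Qed.

Lemma gen_mono q r : (q <= r)%N -> (r < s.+2)%N -> (gen q <= gen r)%N.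
Proof.
case: Hlam => sz so _ _; rewrite leq_eqVlt => /orP[/eqP -> //|qr] rs.
by apply: ltnW; apply: (sorted_ltn_nth ltn_trans 0%N so) => //; rewrite inE sz //; lia.
Qed.

Lemma new_value p v : differential_values curve v -> ~ lam_union n m lam p v ->
  (gen p <= v)%N /\ (p < s.+2)%N.
Proof.
case: (Hlam) => _ _ LE _; rewrite {1}LE => -[q [c [qs sc vE]]] np.
have pq : (p <= q)%N.
  by rewrite leqNgt; apply/negP => qp; apply: np; exists q, c.
by have := gen_mono pq qs; lia.
Qed.

Lemma value_ge w v : has_val w v -> (n <= v)%N.
Proof. by apply: wt_le_val; split=> i j ij; nia. Qed.

(** Below order [m] only the powers of [x] contribute to the pull-back. *)
Lemma small_value w v : has_val w v -> (v < m)%N -> exists i, v = (n * i.+1)%N.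
Proof.
move=> wv vm; have nv := value_ge wv; move: wv => [l vE [_ wl]].
have [g1 g2] := curve_origin.
have : comp21 w.1 curve.1 curve.2 (l - n.-1)%N != 0.
  apply: contra wl => /eqP z; rewrite /pull_param fpsDE deriv1E mulrC singleME.
  rewrite (_ : n.-1 <= l)%N; last by lia.
  rewrite [X in _ + X](_ : _ = 0) ?addr0.
    by rewrite z mulr0.
  have f0 f : @fps_ge C 0 f by move=> ?; rewrite ltn0.
  by apply: (fps_geM (f0 _) deriv2_ge); lia.
rewrite /comp21 => c0.
have [i [j ij0]] : exists i j, (curve.1 ^+ i * curve.2 ^+ j) (l - n.-1)%N != 0.
  apply: contrapT => no; move/eqP: c0; apply; apply: big1 => i _; apply: big1 => j _.
  apply/eqP; rewrite mulf_eq0; apply/orP; right; apply/negP => /negP h.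
  by apply: no; exists i, j.
have jl : (n * i + m * j <= l - n.-1)%N.
  by rewrite leqNgt; apply/negP => h; move: ij0; rewrite monomial_ge ?eqxx.
case: j ij0 jl => [|j] ij0 jl; last by nia.
exists i; move: ij0; rewrite expr0 mulr1 expX /single.
case: ((l - n.-1)%N =P (n * i)%N) => [lE _|_]; last by rewrite eqxx.
by rewrite vE mulnS -lE; lia.
Qed.

Lemma gen0 : gen 0 = n.
Proof.
case: (Hlam) => sz so LE _.
have dn : differential_values curve n.
  apply/valuesP; exists (mono 1 0 0, 0); first by split; [exact: holo2_mono|exact: holo2_0].
  by have := val_dx 0 0; rewrite muln1 muln0 addn0.
have [w _ wv] := proj1 (valuesP _) (gen_value (isT : (0 < s.+2)%N)).
have no0 : ~ lam_union n m lam 0 n by move=> [q [c []]].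
by have [g0 _] := new_value dn no0; have := value_ge wv; lia.
Qed.

Lemma gen1 : gen 1 = m.
Proof.
case: (Hlam) => sz so LE new.
have dm : differential_values curve m.
  apply/valuesP; exists (0, mono 1 0 0); first by split; [exact: holo2_0|exact: holo2_mono].
  by have := val_dy 0 0; rewrite muln1 muln0 add0n.
have nom : ~ lam_union n m lam 1 m.
  move=> [[|q] [c [// _ [a [b' cE]]]]]; rewrite gen0 => mE.
  have E : (n * 0 + m * 1 = n * a.+1 + m * b')%N by rewrite muln0 add0n muln1; nia.
  by have [] := weight_uniq n2 nm cop (_ : (n * 0 + m * 1 < n * m)%N) E; first by nia.
have [g1m _] := new_value dm nom.
have [w _ wv] := proj1 (valuesP _) (gen_value (isT : (1 < s.+2)%N)).
have := new 0%N (leq0n _); have [|mg] := ltnP (gen 1) m; last by lia.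
move=> gm; have [i iE] := small_value wv gm; case.
by exists 0%N, (n * i)%N; rewrite gen0; split=> //; [exists i, 0%N; lia|rewrite iE mulnS].
Qed.

Lemma lam_union2 : lam_union n m lam 2 = positive_semigroup.
Proof.
apply: funext => k; apply: propext; split.
  move=> [[|[|q]] [c [// _ [a [b' cE]]]]]; rewrite ?gen0 ?gen1 => kE.
    by split; [exists a.+1, b'; nia|lia].
  by split; [exists a, b'.+1; nia|lia].
move=> [[[|a] [b' kE]] k0].
  case: b' kE => [|b'] kE; first by lia.
  exists 1%N, (m * b')%N; rewrite gen1; split=> //; last by nia.
  by exists 0%N, b'; lia.
exists 0%N, (n * a + m * b')%N; rewrite gen0; split=> //; last by nia.
by exists a, b'.
Qed.

Lemma ellE d i l : (0 < l)%N -> lam_union n m lam i (gen i + d * l)%N ->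
  (forall l', (0 < l')%N -> lam_union n m lam i (gen i + d * l')%N -> (l <= l')%N) ->
  ell n m lam d i = l.
Proof.
move=> l0 Ll lmin; rewrite /ell.
have [_ ->] // := nat_minP (fun l => (1 <= l)%N /\ lam_union n m lam i (gen i + d * l)%N) l.
by split=> // l' [? ?]; apply: lmin.
Qed.

Lemma crit_first : tcrit n m lam 1 = resonant_wt 0 0 /\ tcrit_tilde n m lam 1 = (n * m)%N.
Proof.
have in1 k : lam_union n m lam 1 (m + k)%N -> exists a b', (m + k = n * a.+1 + m * b')%N.
  by move=> [[|q] [c [// _ [a [b' cE]]]]]; rewrite gen0 => kE; exists a, b'; nia.
have e1 : ell n m lam n 1 = 1%N.
  apply: ellE => //; rewrite gen1; exists 0%N, m; rewrite gen0; split=> //; last by lia.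
  by exists 0%N, 1%N; lia.
have e2 : ell n m lam m 1 = n.-1.
  apply: ellE; first by lia.
    rewrite gen1; exists 0%N, (n * m.-1)%N; rewrite gen0; split=> //; last by nia.
    by exists m.-1, 0%N; lia.
  move=> l l0; rewrite gen1 => /in1 [a [b' E]]; rewrite leqNgt; apply/negP => ln.
  have lE : (n * 0 + m * l.+1 = n * a.+1 + m * b')%N by rewrite muln0 add0n mulnS.
  by have [] := weight_uniq n2 nm cop (_ : (n * 0 + m * l.+1 < n * m)%N) lE; first by nia.
rewrite /tcrit_tilde /= e1 e2 gen1 /resonant_wt; split; nia.
Qed.

(** At each stage the next generator is the value of [w]: it is the least value
    not yet generated, and every such value bounds that of [w]. *)
Lemma stage_next p D i0 j0 T w w' : (p < s.+2)%N ->
  stage (lam_union n m lam p) D i0 j0 T w w' -> (0 < p)%N ->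
  [/\ has_val w (gen p), ~ lam_union n m lam p (gen p) & (resonant_wt i0 j0 + D < gen p)%N].
Proof.
case: (Hlam) => _ _ _ new ps st p0.
have nL : ~ lam_union n m lam p (gen p).
  by case: p p0 ps {st} => // p _ ps; apply: new.
have [u hu uv] := proj1 (valuesP _) (gen_value ps).
have w0 : wt_ge u 0 by split.
have [k [_ uk nuk]] := exact_weight uv w0.
have [v wv [_ vg]] := stage_excess st hu uk nuk uv nL.
have [wz|[v' [wv' nLv' tv']]] := stage_val st.
  by have [l _ [_]] := wv; rewrite wz fps0E eqxx.
rewrite (has_val_uniq wv' wv) in nLv' tv'.
have dv : differential_values curve v.
  by apply/valuesP; exists w => //; exact: stage_holo st.
have [gv _] := new_value dv nLv'.
by have -> : gen p = v by lia.
Qed.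

Lemma crit_stage i : (i <= s)%N -> exists D i0 j0 w w',
  stage (lam_union n m lam i.+2) D i0 j0 (tcrit_tilde n m lam i.+1) w w' /\
  tcrit n m lam i.+1 = resonant_wt i0 j0.
Proof.
elim: i => [|i IH] si.
  have [w [w' st]] := stage_first; exists 0%N, 0%N, 0%N, w, w'.
  by have [-> ->] := crit_first; rewrite lam_union2.
have [D [i0 [j0 [w [w' [st tE]]]]]] := IH (ltnW si).
have [wv nL tg] := stage_next (si : (i.+2 < s.+2)%N) st isT.
have [p [q [p0 q0 [pmin Lp] [qmin Lq] [i1 [j1 [u [u' [t1E st1]]]]]]]] :=
  stage_step st wv nL tg.
exists (gen i.+2 - resonant_wt i0 j0)%N, i1, j1, u, u'.
have en := ellE p0 Lp pmin; have em := ellE q0 Lq qmin.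
have -> : tcrit_tilde n m lam i.+2 = (resonant_wt i0 j0 + maxn (n * p) (m * q))%N.
  by rewrite /tcrit_tilde -[i.+2.-1]/i.+1 tE en em addn_maxr.
split; first by rewrite lam_unionS.
have -> : tcrit n m lam i.+2 = minn (tcrit n m lam i.+1 + n * ell n m lam n i.+2)
  (tcrit n m lam i.+1 + m * ell n m lam m i.+2) by [].
by rewrite t1E tE en em addn_minr.
Qed.

(** ** The two Saito multiplicities *)

Definition has_wt w k := wt_ge w k /\ ~ wt_ge w k.+1.

Section LastStage.
Variables (L : nat -> Prop) (D i0 j0 T : nat) (w w' : form1 R).
Hypotheses (st : stage L D i0 j0 T w w') (pw : pull w = 0).
Local Notation t := (resonant_wt i0 j0).

Lemma Omega_w : Omega_C curve w.
Proof. exact: (proj2 (Omega_CE _ _) (conj (stage_holo st) pw)). Qed.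

Lemma Omega_w' : Omega_C curve w'.
Proof. by have [h p _ _] := stage_tilde st; exact: (proj2 (Omega_CE _ _) (conj h p)). Qed.

Lemma Omega_ge u : Omega_C curve u -> wt_ge u t.
Proof.
move=> /Omega_CE [hu pu].
suff: forall k, (k <= t)%N -> wt_ge u k by apply.
elim=> [|k IH] kt; first by split.
have uk := IH (ltnW kt); apply: contrapT => nuk.
have [|i [j [c [ii jj kE _]]]] := stage_init st hu uk nuk.
  by right; split; [exact: pu|have := stage_lt st; lia].
by move: kt; rewrite kE /resonant_wt; nia.
Qed.

(** As long as the weight is below [T], [stage_init] removes the initial part of
    an invariant form by a multiple of [w]. *)
Lemma Omega_mod u : Omega_C curve u ->
  exists2 G, holo2 G & wt_ge (u - form_scale G w) T.
Proof.
move=> Ou; suff: forall k, (k <= T)%N ->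
    exists2 G, holo2 G & wt_ge (u - form_scale G w) k by apply.
elim=> [|k IH] kT; first by exists 0; [exact: holo2_0|split].
have [G hG Gk] := IH (ltnW kT).
case: (pselect (wt_ge (u - form_scale G w) k.+1)) => [|nGk]; first by exists G.
have /Omega_CE [ho po] := OmegaB curve_origin Ou (OmegaZ curve_origin hG Omega_w).
have [|i [j [c [ii jj kE ul]]]] := stage_init st ho Gk nGk.
  by right; split; [exact: po|].
exists (G + mono c (i - i0) (j - j0)).
  by apply: holo2D => //; exact: holo2_mono.
have -> : u - form_scale (G + mono c (i - i0) (j - j0)) w
  = u - form_scale G w - form_scale (mono c (i - i0) (j - j0)) w.
  by apply: form_eq; rewrite !formE /=; ring.
by rewrite kE; apply: lead_cancel ul (stage_lead st) ii jj.
Qed.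

Lemma ser_wt_split (G : ser2) : ser_wt_ge (G - mono (G 0%N 0%N) 0 0) 1.
Proof.
move=> i j ij; have [-> ->] : i = 0%N /\ j = 0%N by nia.
by rewrite !fpsBE monoE eqxx subrr.
Qed.

Lemma unit_mult_w (G : ser2) k : G 0%N 0%N != 0 -> wt_ge (form_scale G w) k -> (k <= t)%N.
Proof.
move=> G0 Gk; rewrite leqNgt; apply/negP => tk.
have wl := lead_scale 0 0 G0 (stage_lead st).
have rest := wt_geZ (@ser_wt_split G) (lead_wt (stage_lead st)).
have E : form_scale (mono (G 0%N 0%N) 0 0) w
    = form_scale G w - form_scale (G - mono (G 0%N 0%N) 0 0) w.
  by apply: form_eq; rewrite !formE /=; ring.
have := lead_sharp wl; rewrite E => /(_ t.+1); rewrite !add0n ltnn.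
by case/(_ _)/negP => //; apply: wt_geB => //; apply: wt_geW Gk.
Qed.

Lemma has_wt_w : has_wt w t.
Proof.
split; first exact: lead_wt (stage_lead st).
by move=> /(lead_sharp (stage_lead st)); rewrite ltnn.
Qed.

Lemma has_wt_w' : has_wt w' T.
Proof.
have [_ _ w'T nG] := stage_tilde st; split=> // w'T1.
apply: (nG 0); have -> : form_scale 0 w = 0 by apply: form_eq; rewrite /= mul0r.
by rewrite subr0.
Qed.

(** If [h'] is a unit, dividing by it would contradict that the initial part of
    [w'] is no multiple of that of [w]; otherwise [h' w'] has weight above [T],
    and the initial part of [h w] cannot be cancelled. *)
Lemma combination_le (h h' : ser2) k : holo2 h -> holo2 h' ->
  (h 0%N 0%N != 0) || (h' 0%N 0%N != 0) ->
  wt_ge (form_scale h w + form_scale h' w') k -> (k <= T)%N.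
Proof.
move=> hh hh' nz hk; rewrite leqNgt; apply/negP => Tk.
have hT := wt_geW Tk hk; have [hw' _ w'T nG] := stage_tilde st.
case: (eqVneq (h' 0%N 0%N) 0) nz => [h'0|h'0 _].
  rewrite orbF => h0; have h'1 : ser_wt_ge h' 1.
    by move=> i j ij; have [-> ->] : i = 0%N /\ j = 0%N by nia.
  have : wt_ge (form_scale h w) T.+1.
    rewrite -[form_scale h w](addrK (form_scale h' w')); apply: wt_geB => //.
    by have := wt_geZ h'1 w'T; rewrite add1n.
  by move=> /(unit_mult_w h0); have := stage_lt st; lia.
have [k' _ kE] := holo2_inv hh' h'0.
apply: (nG (- (k' * h))).
have -> : w' - form_scale (- (k' * h)) w = form_scale k' (form_scale h w + form_scale h' w').
  rewrite -[X in X - _](_ : form_scale (h' * k') w' = w'); last first.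
    by rewrite kE; apply: form_eq; rewrite /= mul1r.
  by apply: form_eq; rewrite !formE /=; ring.
by have := @wt_geZ k' _ 0 _ (fun _ _ => ltac:(by [])) hT; rewrite add0n.
Qed.

Variable f : ser2.
Hypotheses (hf : holo2 f) (f0 : f != 0) (fc : comp21 f curve.1 curve.2 = 0).

(** [w] and [w'] form a basis: their matrix in any basis is invertible at the
    origin, since a combination of [w] and [w'] in the maximal ideal times
    [Omega_C] is a multiple of [w], with a coefficient that vanishes at the origin,
    up to weight [T]. *)
Lemma saito_ww' : saito_basis curve w w'.
Proof.
have c1 : curve.1 != 0.
  apply/eqP => /(congr1 (fun g => g n)) /eqP.
  by rewrite /curve /= fpsXn /single eqxx fps0E oner_eq0.
have [t1 [t2 Bt]] := saito_basis_exists curve_origin c1 hf f0 fc.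
have [O1 O2 gent _] := Bt.
have [a [d [ha hd wE]]] := gent _ Omega_w.
have [a' [d' [ha' hd' w'E]]] := gent _ Omega_w'.
apply: (saito_change Bt Omega_w Omega_w' (And4 ha hd ha' hd') wE w'E).
have mulE (p q : ser2) : (p * q) 0%N 0%N = p 0%N 0%N * q 0%N 0%N.
  by rewrite !fpsME !big_ord_recl !big_ord0 !addr0 fpsME !big_ord_recl !big_ord0 addr0.
rewrite !fpsBE !mulE; apply/eqP => det0.
have [x [y [xy xa xd]]] : exists x y : C, [/\ (x != 0) || (y != 0),
    x * a 0%N 0%N + y * a' 0%N 0%N = 0 & x * d 0%N 0%N + y * d' 0%N 0%N = 0].
  move: (a 0%N 0%N) (a' 0%N 0%N) (d 0%N 0%N) (d' 0%N 0%N) det0 => A A' B B' det0.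
  case: (boolP ((A' != 0) || (- A != 0))) => [nz|].
    exists A', (- A); split=> //; first by ring.
    by rewrite -[RHS]oppr0 -det0; ring.
  rewrite negb_or !negbK oppr_eq0 => /andP[/eqP -> /eqP ->].
  case: (boolP ((B' != 0) || (- B != 0))) => [nz|].
    by exists B', (- B); split=> //; ring.
  rewrite negb_or !negbK oppr_eq0 => /andP[/eqP -> /eqP ->].
  by exists 1, 0; split; rewrite ?oner_neq0 //; ring.
have [G1 hG1 G1T] := Omega_mod O1; have [G2 hG2 G2T] := Omega_mod O2.
pose e1 := mono x 0 0 * a + mono y 0 0 * a'.
pose e2 := mono x 0 0 * d + mono y 0 0 * d'.
have e1z : ser_wt_ge e1 1.
  move=> i j ij; have [-> ->] : i = 0%N /\ j = 0%N by nia.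
  by rewrite /e1 !fpsDE !mono_mulE /= !subn0.
have e2z : ser_wt_ge e2 1.
  move=> i j ij; have [-> ->] : i = 0%N /\ j = 0%N by nia.
  by rewrite /e2 !fpsDE !mono_mulE /= !subn0.
pose G := e1 * G1 + e2 * G2.
have G0 : G 0%N 0%N = 0.
  by rewrite /G !fpsDE !mulE e1z ?e2z ?mul0r ?addr0 //; lia.
have W : wt_ge (form_scale (mono x 0 0 - G) w + form_scale (mono y 0 0) w') T.+1.
  have -> : form_scale (mono x 0 0 - G) w + form_scale (mono y 0 0) w'
    = form_scale e1 (t1 - form_scale G1 w) + form_scale e2 (t2 - form_scale G2 w).
    have E : form_scale (mono x 0 0) w + form_scale (mono y 0 0) w'
        = form_scale e1 t1 + form_scale e2 t2.
      by rewrite {1}wE {1}w'E /e1 /e2; apply: form_eq; rewrite !formE /=; ring.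
    transitivity (form_scale (mono x 0 0) w + form_scale (mono y 0 0) w' - form_scale G w).
      by apply: form_eq; rewrite !formE /=; ring.
    by rewrite E /G; apply: form_eq; rewrite !formE /=; ring.
  rewrite -add1n; apply: wt_geD; exact: wt_geZ.
have hG : holo2 G.
  by apply: holo2D; apply: holo2M => //; apply: holo2D; apply: holo2M => //;
    exact: holo2_mono.
have := combination_le (holo2B (holo2_mono x 0 0) hG) (holo2_mono y 0 0) _ W.
by rewrite !fpsBE G0 !monoE /= subr0 ltnn => /(_ xy).
Qed.

Lemma saito_sym (g : param R) u1 u2 : saito_basis g u1 u2 -> saito_basis g u2 u1.
Proof.
move=> [O1 O2 genu free]; split=> // [u /genu [h1 [h2 [? ? ->]]]|h1 h2 H1 H2 E].
  by exists h2, h1; split=> //; rewrite addrC.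
by have [|-> ->] := free h2 h1 H2 H1; first by rewrite addrC.
Qed.

(** An element of a basis is a combination of [w] and [w'] with coefficients that
    do not both vanish at the origin, since [w] and [w'] are in turn combinations
    of the given basis. *)
Lemma saito_wt_bounds u1 u2 k : saito_basis curve u1 u2 -> has_wt u1 k ->
  (t <= k <= T)%N.
Proof.
move=> [O1 O2 genu free] [uk nuk]; apply/andP; split.
  by rewrite leqNgt; apply/negP => kt; apply: nuk; apply: wt_geW (Omega_ge O1).
have [_ _ gen_w _] := saito_ww'.
have [h [h' [hh hh' uE]]] := gen_w _ O1.
have [a [d [ha hd wE]]] := genu _ Omega_w.
have [a' [d' [ha' hd' w'E]]] := genu _ Omega_w'.
have [|||z _] := free (h * a + h' * a' - 1) (h * d + h' * d') .
- by apply: holo2B; [by apply: holo2D; apply: holo2M|rewrite -mono1; exact: holo2_mono].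
- by apply: holo2D; apply: holo2M.
- transitivity (form_scale h (form_scale a u1 + form_scale d u2)
     + form_scale h' (form_scale a' u1 + form_scale d' u2) - u1).
    by apply: form_eq; rewrite !formE /=; ring.
  by rewrite -wE -w'E -uE subrr.
apply: (combination_le hh hh'); last by rewrite -uE.
apply: contraT; rewrite negb_or !negbK => /andP[/eqP h0 /eqP h'0].
move/(congr1 (fun g : ser2 => g 0%N 0%N)): z.
have mulE (p q : ser2) : (p * q) 0%N 0%N = p 0%N 0%N * q 0%N 0%N.
  by rewrite !fpsME !big_ord_recl !big_ord0 !addr0 fpsME !big_ord_recl !big_ord0 addr0.
rewrite !fpsBE !fpsDE !mulE h0 h'0 !mul0r addr0 sub0r -mono1 monoE /= => /eqP.
by rewrite oppr_eq0 oner_eq0.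
Qed.

End LastStage.

End Basis.

End Adapted.

(** * Back to the original coordinates *)

Section DivisorialOrder.
Variables (R : realType) (n m : nat).
Implicit Types (h : fps (fps R[i])) (w : form1 R).

Lemma monomial_ordP h k : monomial_ord n m h = Some k <->
  (exists i j, h i j != 0 /\ k = (n * i + m * j)%N) /\ ser_wt_ge n m h k.
Proof.
rewrite /monomial_ord nat_minP /=; split=> -[ex low]; split=> //.
  move=> i j ij; apply/eqP; apply: contraTT ij => hij; rewrite -leqNgt.
  by apply: low; exists i, j.
move=> _ [i [j [hij ->]]]; rewrite leqNgt; apply/negP => /low hz.
by rewrite hz eqxx in hij.
Qed.

Lemma monomial_ord_le h i j : h i j != 0 ->
  exists2 k, monomial_ord n m h = Some k & (k <= n * i + m * j)%N.
Proof.
move=> hij; have [k [kP kmin]] := nat_least (P := fun k => exists i j,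
    h i j != 0 /\ k = (n * i + m * j)%N)
  (ex_intro _ _ (ex_intro _ i (ex_intro _ j (conj hij erefl)))).
by exists k; [apply/nat_minP|apply: kmin; exists i, j].
Qed.

Lemma nu_DP (Phi : coords R) w k :
  nu_D n m Phi w = Some k <-> has_wt n m (form_in Phi w) k.
Proof.
rewrite /nu_D; move: (form_in Phi w) => v; rewrite nat_minP /=.
have X i j : (varx R[i] * v.1) i.+1 j = v.1 i j.
  by rewrite varx_mono mono_mulE /= subn1 subn0 mul1r.
have X0 j : (varx R[i] * v.1) 0%N j = 0 by rewrite varx_mono mono_mulE.
have Y i j : (vary R[i] * v.2) i j.+1 = v.2 i j.
  by rewrite vary_mono mono_mulE /= subn1 subn0 mul1r.
have Y0 i : (vary R[i] * v.2) i 0%N = 0 by rewrite vary_mono mono_mulE.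
split=> [[ex low]|[vk nvk]].
  split.
    split=> i j ij; apply/eqP; apply: contraTT ij => vij; rewrite -leqNgt.
      have [l lE ll] := monomial_ord_le (h := varx R[i] * v.1) (i := i.+1) (j := j)
        ltac:(by rewrite X).
      by apply: leq_trans ll; apply: low; left.
    have [l lE ll] := monomial_ord_le (h := vary R[i] * v.2) (i := i) (j := j.+1)
      ltac:(by rewrite Y).
    by apply: leq_trans ll; apply: low; right.
  move=> [v1 v2]; case: ex => /monomial_ordP [[i [j [vij kE]]] _].
    case: i vij kE => [|i] vij kE; first by rewrite X0 eqxx in vij.
    by move: vij; rewrite X v1 ?eqxx // -kE.
  case: j vij kE => [|j] vij kE; first by rewrite Y0 eqxx in vij.
  by move: vij; rewrite Y v2 ?eqxx // -kE.
have low1 l : monomial_ord n m (varx R[i] * v.1) = Some l -> (k <= l)%N.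
  move=> /monomial_ordP [[[|i] [j [vij ->]]] _]; first by rewrite X0 eqxx in vij.
  rewrite leqNgt; apply/negP => lk; case: vk => v1 _.
  by move: vij; rewrite X v1 ?eqxx.
have low2 l : monomial_ord n m (vary R[i] * v.2) = Some l -> (k <= l)%N.
  move=> /monomial_ordP [[i [[|j] [vij ->]]] _]; first by rewrite Y0 eqxx in vij.
  rewrite leqNgt; apply/negP => lk; case: vk => _ v2.
  by move: vij; rewrite Y v2 ?eqxx.
split; last by move=> l [/low1|/low2].
apply: contrapT => no; apply: nvk; split=> i j; rewrite ltnS leq_eqVlt => /orP[/eqP ij|ij].
- apply/eqP; apply: contrapT => /negP vij; apply: no; left.
  have [l lE ll] := monomial_ord_le (h := varx R[i] * v.1) (i := i.+1) (j := j)
        ltac:(by rewrite X).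
  by rewrite lE; congr Some; have := low1 _ lE; lia.
- by case: vk => v1 _; apply: v1.
- apply/eqP; apply: contrapT => /negP vij; apply: no; right.
  have [l lE ll] := monomial_ord_le (h := vary R[i] * v.2) (i := i) (j := j.+1)
        ltac:(by rewrite Y).
  by rewrite lE; congr Some; have := low2 _ lE; lia.
- by case: vk => _ v2; apply: v2.
Qed.

Lemma differential_values_push (Phi : coords R) (g : param R) : through_origin g ->
  differential_values (push Phi g) = differential_values g.
Proof.
move=> gO; have PO := push_origin Phi gO.
apply: funext => k; apply: propext; split=> -[w hw wk].
  exists (form_in (coords_sym Phi) w); first exact: form_in_holo.
  by rewrite -wk /nu_C -(pull_push (coords_sym Phi) w PO) (push_sym Phi gO).
exists (form_in Phi w); first exact: form_in_holo.
by rewrite -wk /nu_C (pull_push Phi w gO).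
Qed.

End DivisorialOrder.

Theorem theorem1p2 (R : realType) (f : fps (fps R[i])) (n m : nat)
    (Hcusp : cusp f n m)
    (Phi : coords R) (g : param R) (Hadapted : adapted f n m Phi g)
    (s : nat) (lam : seq nat)
    (Hlam : semimodule_basis n m (differential_values g) s lam) :
  (saito_mult n m Phi g, saito_mult_tilde n m Phi g)
  = (Some (tcrit n m lam s.+1), Some (tcrit_tilde n m lam s.+1)).
Proof.
have [[hf f0 _ _] /andP[n2 nm] cop _] := Hcusp.
have [[[hg1 hg2 g1 g2] _ fg] E1 /ord1_Some [bm bm0]] := Hadapted.
have gO : through_origin g by [].
have [hu hv hp hq] := coords_holo Phi.
have [u0 v0 p0 q0] := coords_origin Phi.
have [Ip Iq] := coords_inv' Phi.
pose b := comp21 (cv Phi) g.1 g.2.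
have hb : holo1 b by exact: holo1_comp.
have pushE : push Phi g = curve n b by rewrite /push E1.
have Hlam' : semimodule_basis n m (differential_values (curve n b)) s lam.
  by rewrite -pushE differential_values_push.
have PO := push_origin Phi gO.
pose f' := comp2 f (cp Phi) (cq Phi).
have hf' : holo2 f' by exact: holo2_comp.
have f'0 : f' != 0.
  apply: contra f0 => /eqP z.
  have := comp2_comp2 u0 v0 f p0 q0; rewrite Ip Iq comp2_id -/f' z => <-.
  by rewrite (comp2_0 u0 v0).
have fc : comp21 f' (curve n b).1 (curve n b).2 = 0.
  by rewrite -pushE (comp21_push Phi f gO).
have [D [i0 [j0 [w [w' [st tE]]]]]] := crit_stage n2 nm cop hb bm bm0 Hlam' (leqnn s).
have pw : pull_param (curve n b) w = 0.
  have [//|[v [wv nv _]]] := stage_val st.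
  case: nv; case: (Hlam') => _ _ <- _; apply/valuesP.
  by exists w => //; exact: stage_holo st.
have B := saito_ww' n2 nm cop bm bm0 st pw hf' f'0 fc.
have back u u' : saito_basis (curve n b) u u' ->
    saito_basis g (form_in (coords_sym Phi) u) (form_in (coords_sym Phi) u').
  by rewrite -pushE => /(saito_push (coords_sym Phi) PO); rewrite push_sym.
have bounds k : saito_orders n m Phi g k -> (tcrit n m lam s.+1 <= k <= tcrit_tilde n m lam s.+1)%N.
  move=> [w1 [w2 [Bw]]]; have := saito_push Phi gO Bw; rewrite pushE tE => Bc.
  have Bs := saito_sym Bc.
  by case=> /nu_DP; [apply: (saito_wt_bounds n2 nm cop bm bm0 st pw hf' f'0 fc Bc)
                    |apply: (saito_wt_bounds n2 nm cop bm bm0 st pw hf' f'0 fc Bs)].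
have Omin : saito_orders n m Phi g (tcrit n m lam s.+1).
  exists (form_in (coords_sym Phi) w), (form_in (coords_sym Phi) w').
  split; first exact: back.
  left; apply/nu_DP; rewrite coords_symK tE; exact: has_wt_w st.
have Omax : saito_orders n m Phi g (tcrit_tilde n m lam s.+1).
  exists (form_in (coords_sym Phi) w), (form_in (coords_sym Phi) w').
  split; first exact: back.
  right; apply/nu_DP; rewrite coords_symK; exact: has_wt_w' st.
congr pair.
  by apply/nat_minP; split=> // k /bounds /andP[].
by apply/nat_maxP; split=> // k /bounds /andP[].
Qed.
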